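(* Let $n$ be a positive integer and let $\rho_n$ denote the regular character of the hyperoctahedral group $W_n$. Then $$\rho_n=\sum_{\lambda}\mathrm{Ind}_{Z_{W_n}(w_\lambda)}^{W_n}(\varphi_\lambda),$$ where the sum is over all signed partitions $\lambda$ of $n$ and $w_\lambda\in W_n$ and the linear character $\varphi_\lambda$ of the centralizer $Z_{W_n}(w_\lambda)$ are as defined in the context.
   Context: Notation: $[k]=\{1,\dots,k\}$. $W_n$ is the group, under composition of functions, of permutations $w$ of $\{\pm1,\dots,\pm n\}$ with $w(-a)=-w(a)$. $s_i$ is the transposition of $i,i+1$; $t_i$ is the element sending $i$ to $-i$ and fixing $j$ for $j\in[n]$, $j\neq i$. Length in $W_n$ is with respect to the Coxeter generators $\{t_1,s_1,\dots,s_{n-1}\}$. For $P\subseteq[n]$ let $w_{0,P}=\prod_{j\in P}t_j$ and $\epsilon_P^{\pm}=\frac12(\mathrm{id}\pm w_{0,P})\in\mathbb{C}W_n$. A negative cycle $(a_1\ a_2\cdots a_r)^-$ maps $a_j\mapsto a_{j+1}$ for $j<r$ and $a_r\mapsto -a_1$. A signed partition of $n$ is a tuple of nonzero integers $\lambda=(\lambda_1,\dots,\lambda_a,\lambda_{a+1},\dots,\lambda_{a+b})$ with $\sum|\lambda_i|=n$, whose positive entries $\lambda_1,\dots,\lambda_a$ come first, in nonincreasing order, followed by the negative entries $\lambda_{a+1},\dots,\lambda_{a+b}$ in order of nonincreasing absolute value. Put $\widehat\lambda_0=0$, $\widehat\lambda_i=\sum_{j\le i}|\lambda_j|$, $\Lambda_i=\{\widehat\lambda_{i-1}+1,\dots,\widehat\lambda_i\}$.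 Let $W_{|\lambda|}$ be the subgroup of $w\in W_n$ with $w(\Lambda_i)\subseteq\pm\Lambda_i$ for all $i$; let $X_{|\lambda|}$ be the set of minimal length representatives of its left cosets in $W_n$ (unique in each coset), and $x_{|\lambda|}=\sum_{w\in X_{|\lambda|}}w$. For $i\in[a+b]$, $c_i=(\widehat\lambda_{i-1}+1\ \ \widehat\lambda_{i-1}+2\cdots\widehat\lambda_i)$ (positive cycle), and $d_i=c_iw_{0,\Lambda_i}$ if $\lambda_i$ is odd, $d_i=(\widehat\lambda_{i-1}+1\ \cdots\ \widehat\lambda_i)^-$ if $\lambda_i$ is even. $w_\lambda=c_1\cdots c_a d_{a+1}\cdots d_{a+b}$. For $i$ with $\lambda_i=\lambda_{i+1}$, $y_i\in W_n$ is given by $y_i(l)=l+|\lambda_i|$ for $l\in\Lambda_i$, $y_i(l)=l-|\lambda_i|$ for $l\in\Lambda_{i+1}$, and $y_i(l)=l$ for other $l\in[n]$. It is known that $Z_{W_n}(w_\lambda)$ is generated by $c_i,w_{0,\Lambda_i}$ ($i\in[a]$), $d_i$ ($i\in[a+b]\setminus[a]$), and $y_i$ ($i\in[a+b-1]$, $\lambda_i=\lambda_{i+1}$). Let $\omega_m=e^{2\pi\sqrt{-1}/m}$. For an element $g$ of order $|g|=m$ in a group, $\zeta_g=\frac1m\sum_{j=1}^m\omega_m^{-j}g^j$, and if $m$ is odd, $\tilde\zeta_g=\frac1m\sum_{j=1}^m(\omega_m^{(m+1)/2})^{-j}g^j$. Put $f_i=\epsilon_{\Lambda_i}^+\zeta_{c_i}$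 if $i\in[a]$; $f_i=\epsilon_{\Lambda_i}^-\tilde\zeta_{c_i}$ if $i>a$ and $\lambda_i$ is odd; $f_i=\zeta_{d_i}$ if $i>a$ and $\lambda_i$ is even; and $\widetilde e_\lambda=x_{|\lambda|}f_1\cdots f_{a+b}\in\mathbb{C}W_n$. The group $Z_{W_n}(w_\lambda)$ acts on $\widetilde e_\lambda$ by right multiplication as scalars, and $\varphi_\lambda$ is the linear character of $Z_{W_n}(w_\lambda)$ afforded by the right module $\mathbb{C}\widetilde e_\lambda$. Explicitly, $\varphi_\lambda(c_i)=\omega_{|c_i|}$ for $i\in[a]$, $\varphi_\lambda(d_i)=\omega_{|d_i|}$ for $i\in[a+b]\setminus[a]$, $\varphi_\lambda(w_{0,\Lambda_i})=1$ for $i\in[a]$, and $\varphi_\lambda(y_i)=1$ for $i\in[a+b-1]$ with $\lambda_i=\lambda_{i+1}$. *)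

(* Defs.v *)
From HB Require Import structures.
From mathcomp Require Import all_boot all_order all_algebra all_fingroup.
From mathcomp Require Import all_solvable all_field all_character.

Set Implicit Arguments.
Unset Strict Implicit.
Unset Printing Implicit Defensive.

Import Order.TTheory GRing.Theory Num.Theory.
Local Open Scope ring_scope.

(** * The hyperoctahedral group *)

(* {+-1, ..., +-n}: the pair (i, b) stands for i + 1 if b = false and for
   -(i + 1) if b = true.  So an index i : 'I_n stands for i + 1 in [n]. *)
Definition pm (n : nat) : finType := ('I_n * bool)%type.

Definition pmopp (n : nat) (x : pm n) : pm n := (x.1, ~~ x.2).

Record signed_perm (n : nat) := SignedPerm {
  sp_perm :> {perm pm n};
  _ : [forall x, sp_perm (pmopp x) == pmopp (sp_perm x)]
}.

HB.instance Definition _ n := [isSub for @sp_perm n].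
HB.instance Definition _ n := [Finite of signed_perm n by <:].

Section SignedPermGroup.
Variable n : nat.
Implicit Types u v w : signed_perm n.

Lemma signed_permN w x : w (pmopp x) = pmopp (w x).
Proof. by case: w => w /= /forallP/(_ x)/eqP. Qed.

(* The group law is composition of functions, (u * v) x = u (v x); it is
   opposite to the group law of {perm pm n}, for which (s * t) x = t (s x). *)
Fact sp_mul_subproof u v :
  [forall x, (sp_perm v * sp_perm u)%g (pmopp x)
             == pmopp ((sp_perm v * sp_perm u)%g x)].
Proof. by apply/forallP=> x; rewrite !permM !signed_permN. Qed.
Definition sp_mul u v := SignedPerm (sp_mul_subproof u v).

Fact sp_one_subproof :
  [forall x, (1 : {perm pm n})%g (pmopp x) == pmopp ((1 : {perm pm n})%g x)].
Proof. by apply/forallP=> x; rewrite !perm1. Qed.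
Definition sp_one := SignedPerm sp_one_subproof.

Fact sp_inv_subproof w :
  [forall x, (sp_perm w)^-1%g (pmopp x)
             == pmopp ((sp_perm w)^-1%g x)].
Proof.
apply/forallP=> x; apply/eqP/(@perm_inj _ w).
by rewrite signed_permN !permKV.
Qed.
Definition sp_inv w := SignedPerm (sp_inv_subproof w).

Fact sp_mulA : associative sp_mul.
Proof. by move=> u v w; apply: val_inj; rewrite /= mulgA. Qed.
Fact sp_mul1 : left_id sp_one sp_mul.
Proof. by move=> w; apply: val_inj; rewrite /= mulg1. Qed.
Fact sp_mulV : left_inverse sp_one sp_inv sp_mul.
Proof. by move=> w; apply: val_inj; rewrite /= mulgV. Qed.

HB.instance Definition _ :=
  Finite_isGroup.Build (signed_perm n) sp_mulA sp_mul1 sp_mulV.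

Lemma sp_mulE u v x : (u * v)%g x = u (v x).
Proof. exact: permM. Qed.

End SignedPermGroup.

Notation W n := [set: signed_perm n]%G.

(* The element of W_n sending i in [n] to f i if i is not in P, and to - f i if
   i is in P. *)
Section OfPerm.
Variables (n : nat) (f : {perm 'I_n}) (P : {set 'I_n}).

Definition sp_fun (x : pm n) : pm n := (f x.1, x.2 (+) (x.1 \in P)).

Fact sp_fun_inj : injective sp_fun.
Proof.
by move=> [i b] [j c] /= [/perm_inj <- /addIb <-].
Qed.

Fact sp_of_subproof :
  [forall x, perm sp_fun_inj (pmopp x) == pmopp (perm sp_fun_inj x)].
Proof. by apply/forallP=> x; rewrite !permE /sp_fun /pmopp /= addNb. Qed.

Definition sp_of : signed_perm n := SignedPerm sp_of_subproof.
End OfPerm.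

Section Generators.
Variable n : nat.

Definition sp_t (j : 'I_n) : signed_perm n := sp_of 1%g [set j].

Definition sp_s (i j : 'I_n) : signed_perm n := sp_of (tperm i j) set0.

Definition coxeter_gens : {set signed_perm n} :=
  [set sp_t j | j : 'I_n & j == 0%N :> nat] :|:
  [set sp_s p.1 p.2 | p : 'I_n * 'I_n & p.2 == p.1.+1 :> nat].

(* The least k such that w is a product of k generators.  Searching below
   #|W_n| is enough: the prefixes of a reduced word are distinct. *)
Definition sp_length (w : signed_perm n) : nat :=
  find (fun k => w \in (coxeter_gens ^+ k)%g) (iota 0 #|W n|).

Definition w0 (P : {set 'I_n}) : signed_perm n := (\prod_(j in P) sp_t j)%g.

(* The cyclic permutation (p_1 p_2 ... p_r), where p_1 < ... < p_r are the
   elements of P. *)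
Definition cycle_perm (P : {set 'I_n}) : {perm 'I_n} :=
  perm (can_inj (prev_next (enum_uniq (mem P)))).

Definition pos_cycle (P : {set 'I_n}) : signed_perm n :=
  sp_of (cycle_perm P) set0.

Definition neg_cycle (P : {set 'I_n}) : signed_perm n :=
  sp_of (cycle_perm P) [set l in P | [forall k in P, (k <= l)%N]].

End Generators.

(** * Signed partitions *)

Definition is_signed_partition (n : nat) (la : seq int) : bool :=
  let pos := [seq x <- la | 0 < x] in
  let neg := [seq x <- la | x < 0] in
  [&& 0 \notin la, sumn [seq `|x|%N | x <- la] == n, la == pos ++ neg,
      sorted geq [seq `|x|%N | x <- pos] & sorted geq [seq `|x|%N | x <- neg]].

Record signed_partition (n : nat) := SignedPartition {
  spart :> seq int;
  spartP : is_signed_partition n spart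
}.

HB.instance Definition _ n := [isSub for @spart n].
HB.instance Definition _ n := [Countable of signed_partition n by <:].

(* A signed partition of n has at most n entries, each of absolute value at
   most n. *)
Section SignedPartitionFinite.
Variable n : nat.

Definition spart_code (la : signed_partition n) :
    n.-bseq ('I_n.+1 * bool)%type :=
  insub_bseq n [seq (inord `|x|%N, x < 0) | x <- la].

Definition spart_decode (s : n.-bseq ('I_n.+1 * bool)%type) :
    option (signed_partition n) :=
  insub [seq (if p.2 then - (p.1 : nat)%:Z else (p.1 : nat)%:Z)
         | p : 'I_n.+1 * bool <- s].

Fact spart_bounds (la : seq int) : 0 \notin la ->
  (size la <= sumn [seq `|x|%N | x <- la])%N /\
  {in la, forall x, (`|x| <= sumn [seq `|x|%N | x <- la])%N}.
Proof.
elim: la => //= x la IH; rewrite inE negb_or => /andP[x0 /IH[sz bd]].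
split.
  have x1 : (0 < `|x|)%N by rewrite absz_gt0 eq_sym.
  by rewrite -add1n leq_add.
move=> y; rewrite inE => /orP[/eqP->|/bd yle]; first exact: leq_addr.
exact: leq_trans yle (leq_addl _ _).
Qed.

Fact spart_codeK : pcancel spart_code spart_decode.
Proof.
move=> la; have /and5P[nz /eqP sz _ _ _] := spartP la.
have [szla bd] := spart_bounds nz; rewrite sz in szla bd.
rewrite /spart_decode /spart_code /= /insub_bseq val_insubd size_map szla.
rewrite -map_comp /=; set s := map _ _.
suff -> : s = val la by rewrite valK.
rewrite /s -[RHS]map_id; apply/eq_in_map=> x /bd xle /=.
rewrite inordK ?ltnS //; case: ltrP => x0; last by rewrite gez0_abs.
by rewrite ltz0_abs ?opprK.
Qed.

End SignedPartitionFinite.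

HB.instance Definition _ n : isFinite (signed_partition n) :=
  PCanIsFinite (@spart_codeK n).

(** * The elements attached to a signed partition

   The entries of la are numbered from 0: the index i below is i + 1 in the
   numbering lambda_1, lambda_2, ... *)

Section Blocks.
Variables (n : nat) (la : seq int).
Implicit Types i : nat.

Definition la_hat i : nat := sumn (take i [seq `|x|%N | x <- la]).

Definition block i : {set 'I_n} :=
  [set l : 'I_n | (la_hat i <= l)%N && (l < la_hat i.+1)%N].

Definition W_la : {set signed_perm n} :=
  [set w : signed_perm n | [forall i : 'I_(size la),
     [forall l in block i, (w (l, false)).1 \in block i]]].

Definition X_la : {set signed_perm n} :=
  [set w : signed_perm n |
     [forall v in (w *: W_la)%g, (sp_length w <= sp_length v)%N]].

Definition c_la i : signed_perm n := pos_cycle (block i).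

Definition d_la i : signed_perm n :=
  if odd (absz la`_i) then (c_la i * w0 (block i))%g else neg_cycle (block i).

Definition w_la : signed_perm n :=
  (\prod_(i < size la) (if (0 < la`_i)%R then c_la i else d_la i))%g.

End Blocks.

(** * The group algebra and the characters phi *)

(* exp (2 pi i / m): m.-root (-1) is the m-th root of -1 of least nonnegative
   argument, that is exp (pi i / m). *)
Definition omega (m : nat) : algC := (m.-root (-1)) ^+ 2.

Section GroupAlgebra.
Variables (gT : finGroupType) (G : {group gT}).

(* The group algebra C[G] is realised inside 'M_#|G| by letting it act on
   itself, as the space of row vectors, by right multiplication; in
   particular aG (g * h) = aG g * aG h. *)
Local Notation aG := (regular_repr algC G).
Local Notation CG := 'M[algC]_#|G|.

Definition zeta (g : gT) : CG :=
  #[g]%g%:R^-1 *: \sum_(1 <= j < #[g]%g.+1) omega #[g]%g ^- j *: aG (g ^+ j)%g.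

Definition zeta_tilde (g : gT) : CG :=
  #[g]%g%:R^-1 *: \sum_(1 <= j < #[g]%g.+1)
    (omega #[g]%g ^+ (#[g]%g.+1)./2) ^- j *: aG (g ^+ j)%g.

(* The character of H afforded by the right H-module C a; gring_row a is the
   coordinate vector of a, and <<_>> turns it into a square matrix with the
   same row space, as submod_repr requires.  The value is 0 if C a is not
   stable under H. *)
Definition right_module_char (H : {group gT}) (sHG : H \subset G) (a : CG) :
    'CF(H) :=
  let rH := subg_repr aG sHG in
  if @idP (mxmodule rH <<gring_row a>>%MS) is ReflectT modCa
  then cfRepr (submod_repr modCa) else 0.

End GroupAlgebra.

Section Phi.
Variables (n : nat) (la : seq int).

Local Notation aW := (regular_repr algC (W n)).
Local Notation CW := 'M[algC]_#|W n|.

Definition eps_plus (P : {set 'I_n}) : CW := 2^-1 *: (aW 1%g + aW (w0 P)).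

Definition eps_minus (P : {set 'I_n}) : CW := 2^-1 *: (aW 1%g - aW (w0 P)).

Definition x_la : CW := \sum_(w in X_la n la) aW w.

Definition f_la (i : nat) : CW :=
  if 0 < la`_i then eps_plus (block n la i) * zeta (W n) (c_la n la i)
  else if odd (absz la`_i)
  then eps_minus (block n la i) * zeta_tilde (W n) (c_la n la i)
  else zeta (W n) (d_la n la i).

Definition e_la : CW := x_la * \prod_(i < size la) f_la i.

Definition phi_la : 'CF('C_(W n)[w_la n la]%g) :=
  right_module_char (subsetIl _ _) e_la.

End Phi.

(* Main.v *)
Require Import Defs.
From mathcomp Require Import all_boot all_order all_algebra all_fingroup.
From mathcomp Require Import all_solvable all_field all_character.
From mathcomp Require Import ring zify.

Set Implicit Arguments.
Unset Strict Implicit.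
Unset Printing Implicit Defensive.

Import Order.TTheory GRing.Theory Num.Theory.
Local Open Scope ring_scope.

(* The character phi_la of the centralizer of w_la has an intrinsic description,
   which makes sense for every w and is invariant under conjugation: choose a
   phase theta on {+-1, ..., +-n} that is multiplied by exp (2 pi i / M) along
   each <w>-orbit of size M and is even on positive cycles; then Phi w g is the
   product of theta (g x) / theta x over representatives x of the cycles of w.
   As every w is conjugate to exactly one w_la, the right hand side evaluated at
   g is the sum of Phi w g over all w commuting with g, and one has to show that
   this vanishes for g <> 1.  Let g p <> p, and let q act as g on the cycle of p
   up to sign and trivially elsewhere.  Replacing w by w q^i, for i modulo the
   size N of the <g>-orbit of p, only changes the factor of Phi belonging to the
   component of p, and this factor runs once through the N-th roots of unity.

   To identify the character of C e_la with Phi: X_la consists of the w that are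
   positive and increasing on each block; the product of the f_i is the
   idempotent of Phi on the group A_la of elements commuting with w_la and
   stabilizing each block; and every element of the centralizer of w_la is y a
   with a in A_la and y translating blocks to blocks, so that X_la y = X_la. *)

(** * Roots of unity *)

(** The orbit sizes of w q^i, and with them the roots of unity in its phases, change with i. The N
    factors can be compared only because [omega (a * b) ^+ a = omega b]. As [omega] comes from the
    root of -1 of least argument, this compatibility is itself extracted from inequalities between
    real and imaginary parts.

    No formula for the factor as a function of i is sought. There are as many i as N-th roots of
    unity, so it is enough to hit a prescribed power of [omega N], that is, to solve a congruence.
    The sign is the obstacle: the first return of w to the g-cycle of p may carry a sign, and -p may
    lie in the g-orbit of p. This forces a case distinction on parities.

    That the product of the f_i commutes with the whole centralizer of w_la is not visible from its
    factors. It becomes so once the product is rewritten as an average over A_la, since conjugation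
    by the centralizer preserves both A_la and Phi. *)

Lemma rotate_upper (x y : algC) : `|x| = 1 -> `|y| = 1 -> 0 <= 'Im x ->
    0 <= 'Im y -> 'Re x <= 'Re y -> y != 1 ->
  0 <= 'Im (x / y) /\ 'Re x < 'Re (x / y).
Proof.
(* In angles: if 0 < arg y <= arg x <= pi, then 0 <= arg x - arg y < arg x. Written with real and
   imaginary parts this becomes polynomial inequalities on the unit circle; the signs of the two
   real parts decide how the imaginary parts compare. *)
move=> nx ny; rewrite Im_div Re_div ny expr1n !divr1.
have := normC2_Re_Im x; have := normC2_Re_Im y; rewrite nx ny expr1n.
have := Creal_Re x; have := Creal_Re y.
have yE : ('Re y == 1) && ('Im y == 0) = (y == 1).
  rewrite {3}[y]Crect; apply/andP/eqP => [[/eqP-> /eqP->]|/eqP].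
    by rewrite mulr0 addr0.
  by rewrite -Crect => /eqP->; rewrite (Creal_ReP _ _) ?(Creal_ImP _ _) ?rpred1.
move: yE; move: ('Re x) ('Im x) ('Re y) ('Im y) => a b c d yE cR aR E1 E2 b0 d0.
move=> ac /negP; rewrite -yE => nc.
have d2 : d ^+ 2 = (1 - c) * (1 + c).
  by transitivity (1 - c ^+ 2); [rewrite {1}E1|]; ring.
have b2 : b ^+ 2 = (1 - a) * (1 + a).
  by transitivity (1 - a ^+ 2); [rewrite {1}E2|]; ring.
have c1 : c < 1.
  rewrite real_ltNge ?rpred1 //; apply/negP => c1.
  have c2 : c ^+ 2 = 1.
    apply/eqP; rewrite eq_le; apply/andP; split.
      by rewrite E1 lerDl exprn_ge0.
    by rewrite expr_ge1 // (le_trans ler01).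
  apply: nc; have/eqP := E1; rewrite c2 -subr_eq0 opprD addNKr oppr_eq0.
  rewrite expf_eq0 /= => ->; rewrite andbT.
  by rewrite -(@eqrXn2 _ 2) // ?expr1n ?c2 ?(le_trans ler01).
have c1' : 0 < 1 - c by rewrite subr_gt0.
case: (real_leP (real0 _) aR) => a0.
  have c0 : 0 <= c by apply: le_trans ac.
  have db : d <= b.
    rewrite -(@ler_pXn2r _ 2) ?nnegrE // d2 b2.
    rewrite (_ : (1 - a) * (1 + a) = 1 - a ^+ 2); last by ring.
    rewrite (_ : (1 - c) * (1 + c) = 1 - c ^+ 2); last by ring.
    by rewrite lerD2l lerN2 ler_pXn2r ?nnegrE.
  split; first by rewrite subr_ge0 [_ * b]mulrC [a * d]mulrC [b * c]mulrC [d * a]mulrC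
    ler_pM.
  rewrite -subr_gt0.
  have -> : a * c + b * d - a = b * d - a * (1 - c) by ring.
  rewrite subr_gt0; apply: lt_le_trans (_ : d ^+ 2 <= _);
    last by rewrite expr2 ler_wpM2r.
  by rewrite d2 mulrC ltr_pM2l // (le_lt_trans ac) // ltrDr ltr01.
split; last first.
  rewrite -subr_gt0.
  have -> : a * c + b * d - a = b * d + (- a) * (1 - c) by ring.
  by rewrite ltr_wpDl ?mulr_ge0 // mulr_gt0 // oppr_gt0.
case: (real_leP (real0 _) cR) => c0.
  by rewrite subr_ge0 (@le_trans _ _ 0) ?mulr_ge0 // mulr_le0_ge0 // ltW.
have bd : b <= d.
  rewrite -(@ler_pXn2r _ 2) ?nnegrE // d2 b2.
  rewrite (_ : (1 - a) * (1 + a) = 1 - (- a) ^+ 2); last by ring.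
  rewrite (_ : (1 - c) * (1 + c) = 1 - (- c) ^+ 2); last by ring.
  by rewrite lerD2l lerN2 ler_pXn2r ?nnegrE ?oppr_ge0 ?(ltW c0) ?(ltW a0) ?lerN2.
have -> : c * b - a * d = (- a) * d - (- c) * b by ring.
by rewrite subr_ge0 ler_pM ?oppr_ge0 ?lerN2 ?(ltW c0).
Qed.

(** * The root of -1 of least argument generates all roots of unity of twice the order *)

Section MinimalRoot.
Variable n : nat.
Hypothesis n_gt0 : (0 < n)%N.
Local Notation x := (n.-root (-1) : algC).
Local Notation upper y :=
  [/\ (y : algC) ^+ n.*2 = 1, 0 <= 'Im y & y != 1].

Lemma norm_unity_root (m : nat) (y : algC) : (0 < m)%N -> y ^+ m = 1 -> `|y| = 1.
Proof.
move=> m0 ym; apply/eqP; rewrite -(@pexpr_eq1 _ _ m) //.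
by rewrite -normrX ym normr1.
Qed.

Lemma rootN1_expn : x ^+ n = -1. Proof. by rewrite rootCK. Qed.

Lemma rootN1_Im_ge0 : 0 <= 'Im x.
Proof.
case: (ltngtP n 1) => [|n1|->]; first by rewrite ltnNge n_gt0.
  exact: Im_rootC_ge0.
by rewrite root1C (Creal_ImP _ _) ?rpredN ?rpred1.
Qed.

Lemma rootN1_upper : upper x.
Proof.
split; first by rewrite -muln2 exprM rootN1_expn sqrrN expr1n.
  exact: rootN1_Im_ge0.
apply: contra_eq_neq rootN1_expn => ->; rewrite expr1n -subr_eq0 opprK.
by rewrite -mulr2n pnatr_eq0.
Qed.

(* If y were an n-th root of 1 at a smaller angle than x, then x / y would be
   an n-th root of -1 at a smaller angle than x. *)
Lemma rootN1_Re_max y : upper y -> 'Re y <= 'Re x.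
Proof.
case=> y2n y0 y1; have [x2n x0 x1] := rootN1_upper.
have n2_gt0 : (0 < n.*2)%N by rewrite double_gt0.
have ny := norm_unity_root n2_gt0 y2n; have nx := norm_unity_root n2_gt0 x2n.
have [|/eqP yn] := eqVneq (y ^+ n) (- 1); first by move=> yn; apply: rootC_Re_max.
have {yn} yn : y ^+ n = 1.
  have /eqP : (y ^+ n) ^+ 2 = 1 by rewrite -exprM muln2.
  by rewrite sqrf_eq1 => /orP[/eqP//|/eqP/yn].
rewrite real_leNgt ?Creal_Re //; apply/negP => xy.
have [xy0 xyR] := rotate_upper nx ny x0 y0 (ltW xy) y1.
have := @rootC_Re_max _ n (-1) (x / y) n_gt0.
rewrite expr_div_n rootN1_expn yn divr1 => /(_ erefl xy0).
by rewrite real_leNgt ?Creal_Re // xyR.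
Qed.

(** Each quotient y / x^i with i < j is again an upper root of unity, so its angle is at least that
    of x by [rootN1_Re_max] and [rotate_upper] applies once more. The assumption on y keeps the
    quotients away from 1. *)
Lemma rootN1_descend y j : upper y -> (forall i, (i <= j)%N -> y != x ^+ i) ->
  upper (y / x ^+ j) /\ ((0 < j)%N -> 'Re y < 'Re (y / x ^+ j)).
Proof.
move=> uy; have [x2n x0 x1] := rootN1_upper.
have n2_gt0 : (0 < n.*2)%N by rewrite double_gt0.
have nx := norm_unity_root n2_gt0 x2n.
have xn0 : x != 0 by rewrite -normr_eq0 nx oner_eq0.
elim: j => [|j IH] yN; first by rewrite expr0 divr1.
have [|uz Rz] := IH; first by move=> i ij; apply/yN/leqW.
have [z2n z0 z1] := uz; have nz := norm_unity_root n2_gt0 z2n.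
have [w0 wR] := rotate_upper nz nx z0 x0 (rootN1_Re_max uz) x1.
have wE : y / x ^+ j / x = y / x ^+ j.+1 by rewrite exprSr invfM mulrA mulrAC.
rewrite wE in w0 wR; split=> [|_].
  split=> //; first by rewrite -wE expr_div_n z2n x2n divr1.
  by apply: contra_neq (yN _ (leqnn _)) => /divr1_eq.
case: j Rz wR {IH yN uz z2n z0 z1 nz w0 wE} => [|j] Rz wR.
  by rewrite expr0 divr1 in wR.
exact: lt_trans (Rz _) wR.
Qed.

(** Otherwise 2n rotations by the angle of x would lead from y back to y while strictly increasing
    the real part. *)
Lemma upper_powerP y : upper y -> exists i, y = x ^+ i.
Proof.
move=> uy; have [x2n _ _] := rootN1_upper.
have [/existsP[i /eqP ->]|] := boolP [exists i : 'I_(n.*2.+1), y == x ^+ i].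
  by exists i.
rewrite negb_exists => /forallP yN.
have [|_] := @rootN1_descend y n.*2 uy.
  by move=> i; rewrite -ltnS => ile; apply: (yN (Ordinal ile)).
by rewrite double_gt0 x2n divr1 ltxx => /(_ n_gt0).
Qed.

Lemma rootN1_prim : n.*2.-primitive_root x.
Proof.
have n2_gt0 : (0 < n.*2)%N by rewrite double_gt0.
have [x2n _ _] := rootN1_upper.
have [m xm mn] := prim_order_exists n2_gt0 x2n.
have gen y : y ^+ n.*2 = 1 -> exists i, y = x ^+ i.
  move=> yn; have [->|y1] := eqVneq y 1; first by exists 0; rewrite expr0.
  have [y0|y0] := real_leP (real0 _) (Creal_Im y); first exact: upper_powerP.
  have ny := norm_unity_root n2_gt0 yn.
  have yV : y^-1 = y^*.
    by rewrite invC_norm ny expr1n invr1 mul1r.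
  have [|i yi] := @upper_powerP y^-1.
    split; first by rewrite exprVn yn invr1.
      by rewrite yV Im_conj oppr_ge0 ltW.
    by rewrite invr_eq1.
  (* A root in the lower half plane is the inverse, hence the (2n-1)-st power, of one in the upper
     half plane. *)
  exists (n.*2.-1 * i)%N; rewrite mulnC exprM -yi exprVn.
  apply: (mulIf (_ : y ^+ n.*2.-1 != 0)).
    by rewrite expf_neq0 // -normr_eq0 ny oner_eq0.
  by rewrite -exprS prednK // yn mulVf // expf_neq0 // -normr_eq0 ny oner_eq0.
have [z zP] := C_prim_root_exists n2_gt0.
have [i zi] := gen z (prim_expr_order zP).
suff -> : n.*2 = m by [].
apply/eqP; rewrite eqn_dvd mn andbT (prim_order_dvd zP) zi.
by rewrite exprAC (prim_expr_order xm) expr1n.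
Qed.

End MinimalRoot.

(** The root y of order parameter b is some power x^i, and i b = a b modulo 2 a b forces i >= a.
    Descending from y by i - a steps gives Re y <= Re x^a; the maximality of y among the upper b-th
    roots of -1 gives the reverse inequality. *)
Lemma rootN1M a b : (0 < a)%N -> (0 < b)%N ->
  (((a * b)%N.-root (-1) : algC) ^+ a = b.-root (-1)).
Proof.
move=> a0 b0; have ab0 : (0 < a * b)%N by rewrite muln_gt0 a0.
set x := (a * b)%N.-root (-1); set y := b.-root (-1).
have xP : (a * b).*2.-primitive_root x by apply: rootN1_prim.
have [y2n yI y1] := rootN1_upper b0.
have uy : [/\ y ^+ (a * b).*2 = 1, 0 <= 'Im y & y != 1].
  by split=> //; rewrite mulnC doubleMl exprM y2n expr1n.
have [i0 yi0] := upper_powerP ab0 uy.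
pose i := (i0 %% (a * b).*2)%N.
have yi : y = x ^+ i by rewrite (prim_expr_mod xP).
have i_lt : (i < (a * b).*2)%N by rewrite ltn_mod double_gt0.
have ai : (a <= i)%N.
  have : x ^+ (i * b) == x ^+ (a * b).
    by rewrite exprM -yi /x !rootCK // rootCK.
  rewrite (eq_prim_root_expr xP) -mul2n mulnA -!muln_modl.
  rewrite eqn_pmul2r // => /eqP E.
  rewrite leqNgt; apply/negP => ia.
  have a2 : (a < 2 * a)%N by rewrite mul2n -addnn -[X in (X < _)%N]addn0 ltn_add2l.
  by move: E ia (ltn_trans ia a2) => + + ia2; rewrite (modn_small a2) modn_small // =>
    ->; rewrite ltnn.
have x0 : x != 0 by rewrite rootC_eq0 // oppr_eq0 oner_eq0.
have [xaI xaR] : 0 <= 'Im (x ^+ a) /\ 'Re y <= 'Re (x ^+ a).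
  have [<-|ia] := eqVneq i a; first by rewrite -yi.
  have [|[_ I _] R] := @rootN1_descend _ ab0 y (i - a) uy.
    move=> j ji; rewrite yi (eq_prim_root_expr xP) !modn_small ?(leq_ltn_trans _ i_lt)
      //.
      by rewrite gtn_eqF // (leq_ltn_trans ji) // ltn_subrL a0 (leq_trans a0).
    by rewrite (leq_trans ji) ?leq_subr.
  have E : y / x ^+ (i - a) = x ^+ a.
    by rewrite yi -{1}(subnKC ai) exprD mulfK // expf_neq0.
  rewrite -/x E in I R; split=> //; apply/ltW/R.
  by rewrite subn_gt0 ltn_neqAle eq_sym ia.
have xaR' : 'Re (x ^+ a) <= 'Re y.
  by apply: rootC_Re_max => //; rewrite -exprM rootCK.
have eR : 'Re (x ^+ a) = 'Re y by apply/eqP; rewrite eq_le xaR xaR'.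
have eI : 'Im (x ^+ a) = 'Im y.
  apply/eqP; rewrite -(@eqrXn2 _ 2) //.
  have n1 : `|x ^+ a| = 1.
    apply: (@norm_unity_root (b.*2)); rewrite ?double_gt0 //.
    by rewrite -exprM -muln2 mulnA muln2 (prim_expr_order xP).
  have n2 : `|y| = 1 by apply: (@norm_unity_root (b.*2)); rewrite ?double_gt0.
  have := normC2_Re_Im (x ^+ a); rewrite n1 eR -n2 normC2_Re_Im.
  by move/addrI => ->.
by rewrite [LHS]Crect eR eI -Crect.
Qed.

Lemma omega_prim m : (0 < m)%N -> m.-primitive_root (omega m).
Proof.
move=> m0; have := exp_prim_root (rootN1_prim m0) 2.
by rewrite -muln2 gcdnMl mulnK.
Qed.

Lemma omegaM a b : (0 < a)%N -> (0 < b)%N -> omega (a * b) ^+ a = omega b.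
Proof. by move=> a0 b0; rewrite /omega exprAC rootN1M. Qed.

Lemma omega_exp m : (0 < m)%N -> omega m ^+ m = 1.
Proof. by move=> m0; rewrite (prim_expr_order (omega_prim m0)). Qed.

Lemma omega_neq0 m : (0 < m)%N -> omega m != 0.
Proof. by move=> m0; rewrite /omega expf_neq0 // rootC_eq0 // oppr_eq0 oner_eq0. Qed.

(** * Signed cycles and the character Phi *)

(* The exponents at which a power acts trivially, or preserves a block, form
   the multiples of the least positive one. *)
Lemma nat_period (P : pred nat) (k0 : nat) : (0 < k0)%N -> P k0 -> P 0%N ->
    (forall k l, P k -> P (k + l)%N = P l) ->
  {m : nat | (0 < m)%N & forall a, P a = (m %| a)%N}.
Proof.
move=> k0_gt0 Pk0 P0 PD.
have exP : exists k, (0 < k)%N && P k by exists k0; rewrite k0_gt0.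
exists (ex_minn exP); case: ex_minnP => m /andP[m0 Pm] mmin // a.
have PM k : P (k * m)%N by elim: k => [|k IH]; rewrite ?mul0n // mulSn PD.
rewrite /dvdn {1}(divn_eq a m) PD //.
apply/idP/eqP => [Pr|->//]; apply/eqP; rewrite -leqn0 leqNgt; apply/negP => r0.
by have := mmin (a %% m)%N; rewrite r0 Pr => /(_ isT); rewrite leqNgt ltn_mod m0.
Qed.

Section Orbits.
Variable n : nat.
Implicit Types (v w g u : signed_perm n) (x y : pm n) (b : bool).

Definition pm_sign b x : pm n := (x.1, x.2 (+) b).

Lemma pm_signF x : pm_sign false x = x. Proof. by case: x => i c;
  rewrite /pm_sign addbF. Qed.
Lemma pm_signT x : pm_sign true x = pmopp x. Proof. by case: x => i c;
  rewrite /pm_sign addbT. Qed.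
Lemma pm_signM b c x : pm_sign b (pm_sign c x) = pm_sign (b (+) c) x.
Proof. by rewrite /pm_sign /= -addbA [b (+) c]addbC. Qed.
Lemma pm_signK b : involutive (pm_sign b).
Proof. by move=> x; rewrite pm_signM addbb pm_signF. Qed.
Lemma pm_sign_inj b : injective (pm_sign b). Proof. exact: inv_inj (@pm_signK b). Qed.
Lemma pm_sign_fix b x : (pm_sign b x == x) = ~~ b.
Proof.
case: x => i c; rewrite /pm_sign /= xpair_eqE eqxx /=.
by case: b; case: c.
Qed.
Lemma pm_sign_act v b x : v (pm_sign b x) = pm_sign b (v x).
Proof. by case: b; rewrite ?pm_signT ?pm_signF ?signed_permN. Qed.

Lemma sp_oneE x : (1 : signed_perm n)%g x = x. Proof. exact: perm1. Qed.
Lemma sp_XD v k l x : (v ^+ (k + l))%g x = (v ^+ k)%g ((v ^+ l)%g x).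
Proof. by rewrite expgD sp_mulE. Qed.
Lemma sp_inj v : injective v. Proof. exact: perm_inj. Qed.
Lemma sp_VK v : cancel v (v^-1)%g.
Proof. by move=> x; rewrite -sp_mulE mulVg sp_oneE. Qed.
Lemma sp_KV v : cancel (v^-1)%g v.
Proof. by move=> x; rewrite -sp_mulE mulgV sp_oneE. Qed.
Lemma sp_eqP v w : v =1 w -> v = w.
Proof. by move=> vw; apply/val_inj/permP. Qed.
Lemma sp_ext v w : (forall i, v (i, false) = w (i, false)) -> v = w.
Proof.
move=> vw; apply: sp_eqP => -[i c].
have -> : (i, c) = pm_sign c (i, false) by rewrite /pm_sign.
by rewrite !pm_sign_act vw.
Qed.
Lemma sp_commute v w x : commute v w -> v (w x) = w (v x).
Proof. by move=> vw; rewrite -!sp_mulE vw. Qed.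

Fact orbit_size_key v x : {m : nat | (0 < m)%N & forall a,
  ((v ^+ a)%g x == x) = (m %| a)%N}.
Proof.
apply: (@nat_period _ #[v]%g); rewrite ?order_gt0 ?expg_order ?expg0 ?sp_oneE //.
by move=> k l /eqP vk; rewrite addnC sp_XD vk.
Qed.

Definition orbit_size v x : nat := s2val (orbit_size_key v x).
Lemma orbit_size_gt0 v x : (0 < orbit_size v x)%N. Proof. exact: (s2valP
  (orbit_size_key v x)). Qed.
Lemma orbit_sizeP v x a : ((v ^+ a)%g x == x) = (orbit_size v x %| a)%N.
Proof. exact: (s2valP' (orbit_size_key v x) a). Qed.
Lemma orbit_size_uniq v x m : (forall a, ((v ^+ a)%g x == x) = (m %| a)%N) ->
  orbit_size v x = m.
Proof.
by move=> E; apply/eqP; rewrite eqn_dvd -orbit_sizeP E dvdnn -E orbit_sizeP dvdnn.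
Qed.
Lemma orbit_size_expn v x k : (v ^+ (k %% orbit_size v x))%g x = (v ^+ k)%g x.
Proof.
rewrite [in RHS](divn_eq k (orbit_size v x)) addnC sp_XD.
have /eqP-> // : (v ^+ (k %/ orbit_size v x * orbit_size v x))%g x == x.
by rewrite orbit_sizeP dvdn_mull.
Qed.
Lemma orbit_size_eq v x k l : ((v ^+ k)%g x == (v ^+ l)%g x) = (k == l %[mod orbit_size
  v x])%N.
Proof.
wlog kl : k l / (k <= l)%N.
  by case/orP: (leq_total k l) => kl H; [|rewrite eq_sym [RHS]eq_sym]; apply: H.
rewrite -(subnKC kl) sp_XD (inj_eq (@sp_inj _)) eq_sym orbit_sizeP.
by rewrite -{2}[k]addn0 eqn_modDl mod0n eq_sym.
Qed.

Definition is_negative v x : bool := [exists i : 'I_#[v]%g, (v ^+ i)%g x == pmopp x].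

Lemma is_negativeP v x : reflect (exists k, (v ^+ k)%g x = pmopp x) (is_negative v x).
Proof.
apply: (iffP existsP) => [[i /eqP E]|[k E]]; first by exists i.
exists (Ordinal (ltn_pmod k (order_gt0 v))).
by rewrite /= expg_mod_order E.
Qed.

(** The orbit of x under v and -1: a single orbit if the cycle is negative, two opposite orbits if
    it is positive. Both cases can thus be handled together. *)
Definition signed_cycle v x : {set pm n} :=
  [set pm_sign b ((v ^+ i)%g x) | i : 'I_#[v]%g, b : bool].

Lemma signed_cycleP v x y : reflect (exists k b,
  y = pm_sign b ((v ^+ k)%g x)) (y \in signed_cycle v x).
Proof.
apply: (iffP imset2P) => [[i b _ _ ->]|[k [b ->]]]; first by exists i, b.
exists (Ordinal (ltn_pmod k (order_gt0 v))) b => //.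
by rewrite /= expg_mod_order.
Qed.

Lemma signed_cycle_refl v x : x \in signed_cycle v x.
Proof. by apply/signed_cycleP; exists 0%N, false; rewrite pm_signF sp_oneE. Qed.

Lemma signed_cycle_trans v x y z : y \in signed_cycle v x -> z \in signed_cycle v y ->
  z \in signed_cycle v x.
Proof.
case/signed_cycleP=> k [b ->] /signed_cycleP[l [c ->]]; apply/signed_cycleP.
by exists (l + k)%N, (c (+) b); rewrite pm_sign_act pm_signM sp_XD.
Qed.

Lemma signed_cycle_sym v x y : y \in signed_cycle v x -> x \in signed_cycle v y.
Proof.
case/signed_cycleP=> k [b ->]; apply/signed_cycleP.
exists (k * #[v]%g.-1)%N, b; rewrite pm_sign_act pm_signM addbb pm_signF -sp_XD.
by rewrite addnC -mulnS prednK ?order_gt0 // mulnC expgM expg_order expg1n sp_oneE.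
Qed.

Lemma signed_cycle_eq v x y : (y \in signed_cycle v x) = (signed_cycle v y ==
  signed_cycle v x).
Proof.
apply/idP/eqP => [xy|<-]; last exact: signed_cycle_refl.
apply/setP => z; apply/idP/idP; first exact: signed_cycle_trans.
exact/signed_cycle_trans/signed_cycle_sym.
Qed.

Lemma signed_cycle_pm_sign v b x : pm_sign b x \in signed_cycle v x.
Proof. by apply/signed_cycleP; exists 0%N, b; rewrite expg0 sp_oneE. Qed.
Lemma signed_cycle_X v k x : (v ^+ k)%g x \in signed_cycle v x.
Proof. by apply/signed_cycleP; exists k, false; rewrite pm_signF. Qed.

Lemma orbit_size_pm_sign v b x : orbit_size v (pm_sign b x) = orbit_size v x.
Proof.
by apply: orbit_size_uniq => a; rewrite pm_sign_act (inj_eq (@pm_sign_inj _))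
  orbit_sizeP.
Qed.
Lemma orbit_size_comm v g x : commute v g -> orbit_size v (g x) = orbit_size v x.
Proof.
move=> vg; apply: orbit_size_uniq => a.
by rewrite (sp_commute x (commute_sym (commuteX a (commute_sym vg)))) (inj_eq (@sp_inj
  _)) orbit_sizeP.
Qed.
Lemma orbit_size_act v x : orbit_size v (v x) = orbit_size v x.
Proof. exact: orbit_size_comm. Qed.
Lemma is_negative_pm_sign v b x : is_negative v (pm_sign b x) = is_negative v x.
Proof.
apply/is_negativeP/is_negativeP=> -[k E]; exists k;
  last by rewrite pm_sign_act E -!pm_signT !pm_signM addbC.
by apply: (@pm_sign_inj b); rewrite -pm_sign_act E -!pm_signT !pm_signM addbC.
Qed.
Lemma is_negative_comm v g x : commute v g -> is_negative v (g x) = is_negative v x.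
Proof.
move=> vg; have C k : commute (v ^+ k)%g g by apply/commute_sym/commuteX/commute_sym.
apply/is_negativeP/is_negativeP=> -[k E]; exists k;
  last by rewrite (sp_commute _ (C k)) E signed_permN.
by apply: (@sp_inj g); rewrite -(sp_commute _ (C k)) E signed_permN.
Qed.
Lemma is_negative_act v x : is_negative v (v x) = is_negative v x.
Proof. exact: is_negative_comm. Qed.

Lemma signed_cycle_ind v x (T : Type) (f : pm n -> T) :
    (forall y, y \in signed_cycle v x -> f (v y) = f y) ->
    (forall y b, y \in signed_cycle v x -> f (pm_sign b y) = f y) ->
  {in signed_cycle v x, forall y, f y = f x}.
Proof.
move=> fv fs y /signed_cycleP[k [b ->]]; rewrite fs ?signed_cycle_X //.
by elim: k => [|k IH]; rewrite ?expg0 ?sp_oneE // expgS sp_mulE fv ?signed_cycle_X.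
Qed.

Lemma orbit_size_signed_cycle v x : {in signed_cycle v x, forall y,
  orbit_size v y = orbit_size v x}.
Proof. by apply: signed_cycle_ind => *; rewrite ?orbit_size_act ?orbit_size_pm_sign.
  Qed.
Lemma is_negative_signed_cycle v x : {in signed_cycle v x, forall y,
  is_negative v y = is_negative v x}.
Proof. by apply: signed_cycle_ind => *; rewrite ?is_negative_act ?is_negative_pm_sign.
  Qed.

(** If v^k x = -x, then the remainder of k modulo the orbit size M is positive and less than M, and
    its double is divisible by M; so it is M / 2. *)
Lemma is_negative_half v x : is_negative v x ->
  orbit_size v x = (orbit_size v x)./2.*2 /\ (v ^+ (orbit_size v x)./2)%g x = pmopp x.
Proof.
case/is_negativeP => k; set M := orbit_size v x => vk.
have v2k : (M %| k + k)%N.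
  by rewrite -orbit_sizeP sp_XD vk signed_permN vk -!pm_signT pm_signM pm_signF.
have kM : ~~ (M %| k)%N by rewrite -orbit_sizeP vk -pm_signT pm_sign_fix.
have M0 : (0 < M)%N := orbit_size_gt0 v x.
move: vk; rewrite -orbit_size_expn -/M => vk.
have r0 : (0 < k %% M)%N by rewrite lt0n.
have rM : (k %% M < M)%N by rewrite ltn_mod.
have : (M %| k %% M + k %% M)%N.
  by rewrite /dvdn modnDm.
case/dvdnP => q Eq.
have q1 : q = 1%N.
  have : (q * M < 2 * M)%N by rewrite -Eq; lia.
  rewrite ltn_pmul2r // => q2.
  have : (0 < q * M)%N by rewrite -Eq; lia.
  by rewrite muln_gt0; case: q q2 {Eq} => [|[]].
have MM : M = (k %% M).*2 by rewrite -addnn Eq q1 mul1n.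
by rewrite {2 3}MM doubleK -MM.
Qed.

End Orbits.

Lemma omega_half h : (0 < h)%N -> omega h.*2 ^+ h = -1.
Proof.
move=> h0; have P : h.*2.-primitive_root (omega h.*2) by rewrite omega_prim ?double_gt0.
have /eqP : (omega h.*2 ^+ h) ^+ 2 = 1 by rewrite -exprM muln2 prim_expr_order.
rewrite sqrf_eq1 => /orP[|/eqP//].
by rewrite -(prim_order_dvd P) => /(dvdn_leq h0); lia.
Qed.

(** * Phases on unions of signed cycles, and independence of Phi from all choices *)

Section Phases.
Variable n : nat.
Implicit Types (v w g u : signed_perm n) (x y : pm n) (b : bool).
Implicit Types (S T : {set pm n}) (theta : pm n -> algC).

Lemma is_negative_pair v x j k : (v ^+ j)%g x = pmopp ((v ^+ k)%g x) -> is_negative v x.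
Proof.
move=> E; apply/is_negativeP; exists (k * #[v]%g.-1 + j)%N.
rewrite sp_XD E signed_permN -sp_XD addnC -mulnS prednK ?order_gt0 //.
by rewrite mulnC expgM expg_order expg1n sp_oneE.
Qed.

Definition cycle_transversal v S T :=
  [/\ T \subset S, forall x, x \in S -> exists2 t, t \in T & x \in signed_cycle v t
    & {in T &, forall s t, t \in signed_cycle v s -> s = t}].

Definition signed_cycle_closed v S := {in S, forall x, signed_cycle v x \subset S}.

Lemma signed_cycle_closedT v : signed_cycle_closed v setT.
Proof. by move=> x _; apply: subsetT. Qed.

Lemma cycle_transversal_reindex (R : Type) (idx : R) (op : Monoid.com_law idx) v S T T'
  (h : pm n -> R) :
    cycle_transversal v S T -> cycle_transversal v S T' ->
    {in S, forall x, {in signed_cycle v x, forall y, h y = h x}} ->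
  \big[op/idx]_(x in T) h x = \big[op/idx]_(x in T') h x.
Proof.
pose H (C : {set pm n}) := if [pick x in C] is Some x then h x else idx.
move=> TS T'S hS.
suff E U : cycle_transversal v S U ->
    \big[op/idx]_(x in U) h x = \big[op/idx]_(C in [set signed_cycle v x | x in S]) H C.
  by rewrite !E.
case=> /subsetP US SU Uinj.
have -> : [set signed_cycle v x | x in S] = [set signed_cycle v x | x in U].
  apply/setP=> C; apply/imsetP/imsetP=> -[x xS ->]; last by exists x => //; apply: US.
  by have [t tU xt] := SU x xS; exists t => //; apply/eqP; rewrite -signed_cycle_eq.
rewrite big_imset /=; last first.
  by move=> s t sU tU /eqP; rewrite eq_sym -signed_cycle_eq; apply: Uinj.
apply: eq_bigr => x xU; rewrite /H; case: pickP => [y yx|/(_ x)];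
  last by rewrite signed_cycle_refl.
by rewrite (hS x) ?US.
Qed.

(** Values may be prescribed cycle by cycle as long as they respect coincidences between points.
    This serves to build phases and, later, conjugating elements. *)
Lemma equivariant_extension (Y : Type) v T (A : pm n -> bool -> nat -> Y) :
    cycle_transversal v setT T ->
    {in T, forall t b j c k, pm_sign b ((v ^+ j)%g t) = pm_sign c ((v ^+ k)%g t) ->
       A t b j = A t c k} ->
  {F : pm n -> Y | {in T, forall t b j, F (pm_sign b ((v ^+ j)%g t)) = A t b j}}.
Proof.
move=> [_ cov inj] HA.
have ex x : exists q : pm n * bool * 'I_#[v]%g,
    (q.1.1 \in T) && (x == pm_sign q.1.2 ((v ^+ q.2)%g q.1.1)).
  have [t tT /imset2P[i b _ _ ->]] := cov x (in_setT _).
  by exists (t, b, i); rewrite /= tT eqxx.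
exists (fun x => let q := xchoose (ex x) in A q.1.1 q.1.2 q.2) => t tT b j.
set x := pm_sign _ _; move: (xchoose _) (xchooseP (ex x)) =>
  [[t' c] k] /= /andP[t'T /eqP E].
have tt' : t = t'.
  apply: inj => //; apply: (@signed_cycle_trans _ _ _ x); first by apply/signed_cycleP;
    exists j, b.
  by apply: signed_cycle_sym; apply/signed_cycleP; exists k, c.
by rewrite -tt' in E *; apply/esym/HA => //; rewrite -E.
Qed.

(* theta turns the action of v into multiplication by a root of unity; on a
   negative cycle this forces theta (pmopp x) = - theta x. *)
Definition phase v S theta := forall x, x \in S ->
  [/\ theta x != 0, theta (v x) = omega (orbit_size v x) * theta x
    & ~~ is_negative v x -> theta (pmopp x) = theta x].

Lemma phase_exists v T : cycle_transversal v setT T ->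
  {theta | phase v setT theta & {in T, forall t, theta t = 1}}.
Proof.
move=> TT.
(* On a negative cycle of orbit size M the value at -t is forced, because -t = v^(M/2) t and
   [omega M ^+ M./2 = -1]; the sign factor agrees with it. *)
pose A t b j : algC := (if is_negative v t then (-1) ^+ b else 1) * omega (orbit_size v
  t) ^+ j.
have [t tT b j c k E|th thE] := @equivariant_extension _ v T A TT.
  have P := omega_prim (orbit_size_gt0 v t); rewrite /A.
  have [bc|bc] := eqVneq b c.
    rewrite -bc in E *; move/pm_sign_inj/eqP: E;
      rewrite orbit_size_eq -(eq_prim_root_expr P).
    by move/eqP->.
  have {}E : (v ^+ j)%g t = pmopp ((v ^+ k)%g t).
    have bc1 : b (+) c = true by move: bc; case: (b); case: (c).
    by have := congr1 (pm_sign b) E; rewrite !pm_signM addbb pm_signF bc1 pm_signT.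
  have ng := is_negative_pair E; have [M2 half] := is_negative_half ng; rewrite ng.
  rewrite -signed_permN -half -sp_XD in E; move/eqP: E.
  rewrite orbit_size_eq -(eq_prim_root_expr P) exprD => /eqP->.
  set h := (orbit_size v t)./2 in M2 *.
  have h0 : (0 < h)%N by rewrite -double_gt0 -M2 orbit_size_gt0.
  rewrite {2}M2 omega_half //.
  by move: bc; case: (b); case: (c) => // _; rewrite /= ?expr1 ?expr0; ring.
exists th => [x _|t tT]; last first.
  by have := thE t tT false 0%N; rewrite pm_signF sp_oneE /A expr0 => ->; case: ifP =>
    _; rewrite ?expr0 !mul1r.
have [_ cov _] := TT; have [t tT /signed_cycleP[j [b ->]]] := cov x (in_setT _).
have t0 := orbit_size_gt0 v t.
have E1 : v (pm_sign b ((v ^+ j)%g t)) = pm_sign b ((v ^+ j.+1)%g t) by rewrite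
  pm_sign_act expgS sp_mulE.
have E2 : pmopp (pm_sign b ((v ^+ j)%g t)) = pm_sign (~~ b) ((v ^+ j)%g t) by rewrite
  -pm_signT pm_signM.
rewrite E1 E2 !thE // /A is_negative_pm_sign orbit_size_pm_sign.
have -> : orbit_size v ((v ^+ j)%g t) = orbit_size v t by apply:
  orbit_size_signed_cycle; apply: signed_cycle_X.
have -> : is_negative v ((v ^+ j)%g t) = is_negative v t by apply:
  is_negative_signed_cycle; apply: signed_cycle_X.
split.
- apply: mulf_neq0; last exact/expf_neq0/omega_neq0.
  by case: ifP => _; rewrite ?expf_neq0 ?oppr_eq0 ?oner_eq0.
- by rewrite exprS mulrCA.
- by move/negPf->.
Qed.

Lemma phaseX v S theta x k : signed_cycle_closed v S -> phase v S theta -> x \in S ->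
  theta ((v ^+ k)%g x) = omega (orbit_size v x) ^+ k * theta x.
Proof.
move=> cS ph xS; elim: k => [|k IH]; first by rewrite expr0 mul1r sp_oneE.
rewrite expgS sp_mulE; have [|_ -> _] := ph ((v ^+ k)%g x).
  by apply: (subsetP (cS x xS)); apply: signed_cycle_X.
by rewrite IH (orbit_size_signed_cycle (signed_cycle_X v k x)) mulrA exprS.
Qed.

Lemma phase_opp v S theta x : signed_cycle_closed v S -> phase v S theta -> x \in S ->
  theta (pmopp x) = (if is_negative v x then -1 else 1) * theta x.
Proof.
move=> cS ph xS; case: ifP => [ng|/negbT ng]; last first.
  by have [_ _ ->] := ph x xS; rewrite ?mul1r.
have [M2 <-] := is_negative_half ng; rewrite (phaseX _ cS) //.
set h := (orbit_size v x)./2 in M2 *.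
have h0 : (0 < h)%N by rewrite -double_gt0 -M2 orbit_size_gt0.
by rewrite M2 omega_half.
Qed.

(** As g commutes with v it preserves orbit sizes and signs of cycles, so v, or -1, multiplies
    numerator and denominator by the same scalar. *)
Lemma phase_ratio v g S theta : commute v g -> signed_cycle_closed v S ->
    {in S, forall x, g x \in S} -> phase v S theta ->
  {in S, forall x, {in signed_cycle v x, forall y,
    theta (g y) / theta y = theta (g x) / theta x}}.
Proof.
move=> vg cS gS ph x xS; apply: signed_cycle_ind => [y yx|y b yx].
  have yS : y \in S by apply: (subsetP (cS x xS)).
  have [t0 -> _] := ph y yS; have [_ E _] := ph (g y) (gS y yS).
  rewrite -(sp_commute _ vg) E (orbit_size_comm _ vg).
  have o0 := omega_neq0 (orbit_size_gt0 v y).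
  by rewrite -mulf_div divff // mul1r.
have yS : y \in S by apply: (subsetP (cS x xS)).
case: b; rewrite ?pm_signF // pm_signT signed_permN !(phase_opp cS ph) ?gS //.
rewrite (is_negative_comm _ vg) -mulf_div divff ?mul1r //.
by case: ifP; rewrite ?oppr_eq0 oner_eq0.
Qed.

(** Orbits, signs, phases and transversals on a closed set S depend only on the restriction to S.
    The twisted elements w q^i agree with w outside one component, which is such a set. *)
Lemma act_local v v' S x k : signed_cycle_closed v S -> {in S, v =1 v'} -> x \in S ->
  (v' ^+ k)%g x = (v ^+ k)%g x.
Proof.
move=> cS vv xS; elim: k => [|k IH]; first by rewrite !sp_oneE.
by rewrite !expgS !sp_mulE IH vv // (subsetP (cS x xS)) ?signed_cycle_X.
Qed.

Lemma orbit_size_local v v' S x : signed_cycle_closed v S -> {in S, v =1 v'} ->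
  x \in S ->
  orbit_size v' x = orbit_size v x.
Proof.
by move=> cS vv xS; apply: orbit_size_uniq => a;
  rewrite (act_local _ cS vv xS) orbit_sizeP.
Qed.

Lemma is_negative_local v v' S x : signed_cycle_closed v S -> {in S, v =1 v'} ->
  x \in S ->
  is_negative v' x = is_negative v x.
Proof.
move=> cS vv xS.
by apply/is_negativeP/is_negativeP => -[k E]; exists k;
  rewrite (act_local _ cS vv xS) in E *.
Qed.

Lemma signed_cycle_local v v' S x : signed_cycle_closed v S -> {in S, v =1 v'} ->
  x \in S ->
  signed_cycle v' x = signed_cycle v x.
Proof.
move=> cS vv xS; apply/setP=> y.
by apply/signed_cycleP/signed_cycleP => -[k [b E]]; exists k, b;
  rewrite (act_local _ cS vv xS) in E *.
Qed.

Lemma signed_cycle_closed_local v v' S : signed_cycle_closed v S -> {in S, v =1 v'} ->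
  signed_cycle_closed v' S.
Proof. by move=> cS vv x xS; rewrite (signed_cycle_local cS vv xS); apply: cS. Qed.

Lemma phase_local v v' S theta : signed_cycle_closed v S -> {in S, v =1 v'} ->
  phase v S theta -> phase v' S theta.
Proof.
move=> cS vv ph x xS; have [p1 p2 p3] := ph x xS.
by rewrite -vv // (orbit_size_local cS vv xS) (is_negative_local cS vv xS).
Qed.

Lemma cycle_transversal_local v v' S T : signed_cycle_closed v S -> {in S, v =1 v'} ->
  cycle_transversal v S T -> cycle_transversal v' S T.
Proof.
move=> cS vv [TS cov inj]; have TS' := subsetP TS; split=>
  // [x /cov[t tT xt]|s t sT tT].
  by exists t => //; rewrite (signed_cycle_local cS vv) ?TS'.
by rewrite (signed_cycle_local cS vv) ?TS' //; apply: inj.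
Qed.

Lemma cycle_transversal_comm v g S T : commute v g -> {in S, forall x, g x \in S} ->
  cycle_transversal v S T -> cycle_transversal v S [set g x | x in T].
Proof.
move=> vg gS [/subsetP TS cov inj].
have cg x y : (g y \in signed_cycle v (g x)) = (y \in signed_cycle v x).
  apply/signed_cycleP/signed_cycleP => -[k [b E]]; exists k, b.
    apply: (@sp_inj _ g); rewrite E pm_sign_act.
    by rewrite -(sp_commute _ (commute_sym (commuteX k (commute_sym vg)))).
  rewrite E pm_sign_act.
  by rewrite -(sp_commute _ (commute_sym (commuteX k (commute_sym vg)))).
have gS' : S \subset [set g x | x in S].
  suff -> : [set g x | x in S] = S by [].
  apply/eqP; rewrite eqEcard card_imset ?leqnn ?andbT; last exact: sp_inj.
  by apply/subsetP => _ /imsetP[x xS ->]; apply: gS.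
split.
- by apply/subsetP=> _ /imsetP[x xT ->]; apply/gS/TS.
- move=> x /(subsetP gS')/imsetP[y /cov[t tT yt] ->].
  by exists (g t); rewrite ?imset_f ?cg.
- move=> _ _ /imsetP[s sT ->] /imsetP[t tT ->]; rewrite cg => /inj-> //.
Qed.

(** With v' = v this is the independence of Phi from the phase and the transversal; with v' a twist
    of v it shows that the part of Phi outside the twisted component does not change. *)
Lemma prod_phase v v' g S theta theta' T T' : commute v g ->
    signed_cycle_closed v S -> {in S, v =1 v'} -> {in S, forall x, g x \in S} ->
    phase v S theta -> phase v' S theta' -> cycle_transversal v S T ->
      cycle_transversal v' S T' ->
  \prod_(x in T) (theta (g x) / theta x) = \prod_(x in T') (theta' (g x) / theta' x).
Proof.
move=> vg cS vv gS ph ph' tT tT'.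
have v'v : {in S, v' =1 v} by move=> x /vv.
have cS' := signed_cycle_closed_local cS vv.
have {}ph' := phase_local cS' v'v ph'; have {cS' v'v}tT' :=
  cycle_transversal_local cS' v'v tT'.
rewrite -(cycle_transversal_reindex _ tT tT'); last exact: phase_ratio.
pose ka x := theta x / theta' x.
have kaS : {in S, forall x, {in signed_cycle v x, forall y, ka y = ka x}}.
  move=> x xS; apply: signed_cycle_ind => [y|y b] yx; rewrite /ka.
    have yS : y \in S by apply: (subsetP (cS x xS)).
    have [_ -> _] := ph y yS; have [_ -> _] := ph' y yS.
    by rewrite -mulf_div divff ?mul1r // omega_neq0 ?orbit_size_gt0.
  have yS : y \in S by apply: (subsetP (cS x xS)).
  case: b; rewrite ?pm_signF // pm_signT (phase_opp cS ph) // (phase_opp cS ph') //.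
  by rewrite -mulf_div divff ?mul1r //; case: ifP; rewrite ?oppr_eq0 oner_eq0.
(* theta / theta' is constant on cycles, which g permutes. *)
have := cycle_transversal_reindex *%R (cycle_transversal_comm vg gS tT) tT kaS.
rewrite big_imset /=; last by move=> ? ? _ _; apply: sp_inj.
have [/subsetP TS _ _] := tT.
have nz x : x \in T -> (theta x != 0) && (theta' x != 0).
  by move=> /TS xS; have [-> _ _] := ph x xS; have [-> _ _] := ph' x xS.
have nzg x : x \in T -> (theta (g x) != 0) && (theta' (g x) != 0).
  by move=> /TS/gS xS; have [-> _ _] := ph _ xS; have [-> _ _] := ph' _ xS.
move=> E.
have nzk : \prod_(x in T) ka x != 0.
  by apply/prodf_neq0 => x /nz/andP[a1 a2]; rewrite mulf_neq0 ?invr_neq0.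
transitivity ((\prod_(x in T) (theta' (g x) / theta' x)) *
    ((\prod_(x in T) ka (g x)) / \prod_(x in T) ka x)); last first.
  by rewrite E divff // mulr1.
rewrite -prodf_div -big_split /=; apply: eq_bigr => x xT.
have /andP[a1 a2] := nz x xT; have /andP[a3 a4] := nzg x xT; rewrite /ka.
by field; rewrite a1 a2 a4.
Qed.

(** The choice depends only on the set [signed_cycle v x], so it is the same for all points of a
    cycle; the default x is never returned, as the set contains x. *)
Definition cycle_rep v x := odflt x [pick y in signed_cycle v x].
Definition cycle_reps v := [set x | cycle_rep v x == x].

Lemma cycle_rep_mem v x : cycle_rep v x \in signed_cycle v x.
Proof. by rewrite /cycle_rep; case: pickP => //= /(_ x); rewrite signed_cycle_refl. Qed.

Lemma cycle_rep_eq v x y : y \in signed_cycle v x -> cycle_rep v y = cycle_rep v x.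
Proof.
rewrite signed_cycle_eq => /eqP E; have := signed_cycle_refl v x; rewrite /cycle_rep E.
by case: pickP => //= /(_ x) ->.
Qed.

Lemma cycle_reps_transversal v : cycle_transversal v setT (cycle_reps v).
Proof.
split=> [|x _|s t]; first exact: subsetT.
  exists (cycle_rep v x); last exact/signed_cycle_sym/cycle_rep_mem.
  by rewrite inE; apply/eqP/cycle_rep_eq/cycle_rep_mem.
by rewrite !inE => /eqP Es /eqP Et /cycle_rep_eq; rewrite Es Et.
Qed.

Definition std_phase v : pm n -> algC := s2val (phase_exists (cycle_reps_transversal
  v)).
Lemma std_phaseP v : phase v setT (std_phase v).
Proof. exact: (s2valP (phase_exists (cycle_reps_transversal v))). Qed.

(* Neither the phase nor the transversal matters, by prod_phase. *)
Definition Phi v g : algC := \prod_(x in cycle_reps v) (std_phase v (g x) / std_phase v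
  x).

Lemma PhiE v g theta T : commute v g -> phase v setT theta ->
  cycle_transversal v setT T ->
  Phi v g = \prod_(x in T) (theta (g x) / theta x).
Proof.
move=> vg ph tT; by apply: (prod_phase vg (@signed_cycle_closedT v) _ _ (@std_phaseP v)
  ph (cycle_reps_transversal v) tT) => // x _; rewrite in_setT.
Qed.

Lemma Phi1 v : Phi v 1%g = 1.
Proof.
rewrite /Phi big1 // => x _; rewrite sp_oneE divff //.
by have [] := std_phaseP v (in_setT x).
Qed.

(** Computing the factor of g on the transversal moved by h makes the quotients telescope. *)
Lemma PhiM v g h : commute v g -> commute v h -> Phi v (g * h)%g = Phi v g * Phi v h.
Proof.
move=> vg vh.
rewrite (PhiE vg (@std_phaseP v) (cycle_transversal_comm vh (fun x _ =>
  in_setT _) (cycle_reps_transversal v))).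
rewrite big_imset /=; last by move=> ? ? _ _; apply: sp_inj.
rewrite /Phi -big_split /=; apply: eq_bigr => x _; rewrite sp_mulE.
rewrite mulrA divfK //; first by have [] := std_phaseP v (in_setT (h x)).
Qed.

Lemma Phi_neq0 v g : Phi v g != 0.
Proof.
apply/prodf_neq0 => x _; rewrite mulf_neq0 ?invr_neq0 //.
  by have [] := std_phaseP v (in_setT (g x)).
by have [] := std_phaseP v (in_setT x).
Qed.

Lemma conj_act v u x k : ((v ^ u) ^+ k)%g x = (u^-1)%g ((v ^+ k)%g (u x)).
Proof. by rewrite -conjXg /conjg !sp_mulE. Qed.

Lemma conj_act1 v u x : (v ^ u)%g x = (u^-1)%g (v (u x)).
Proof. by rewrite /conjg !sp_mulE. Qed.

Lemma orbit_size_conj v u x : orbit_size (v ^ u)%g x = orbit_size v (u x).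
Proof.
apply: orbit_size_uniq => a; rewrite conj_act -orbit_sizeP.
by rewrite -[in RHS](inj_eq (@sp_inj _ (u^-1)%g)) sp_VK.
Qed.

Lemma is_negative_conj v u x : is_negative (v ^ u)%g x = is_negative v (u x).
Proof.
apply/is_negativeP/is_negativeP => -[k E]; exists k; rewrite conj_act in E *;
  last first.
  by rewrite E signed_permN sp_VK.
by apply: (@sp_inj _ (u^-1)%g); rewrite E signed_permN sp_VK.
Qed.

Lemma signed_cycle_conj v u x y : (y \in signed_cycle (v ^ u)%g x) = (u y \in
  signed_cycle v (u x)).
Proof.
apply/signed_cycleP/signed_cycleP => -[k [b E]]; exists k, b.
  by rewrite E conj_act -pm_sign_act sp_KV.
by apply: (@sp_inj _ u); rewrite E conj_act pm_sign_act sp_KV.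
Qed.

(** If theta is a phase for v, then theta o u is one for the conjugate u^-1 v u. *)
Lemma Phi_conj v g u : commute v g -> Phi (v ^ u)%g (g ^ u)%g = Phi v g.
Proof.
move=> vg; pose T := [set (u^-1)%g x | x in cycle_reps v].
have [_ cov inj] := cycle_reps_transversal v.
rewrite (@PhiE _ _ (fun x => std_phase v (u x)) T).
- rewrite big_imset /=; last by move=> ? ? _ _; exact: (@sp_inj _ (u^-1)%g).
  apply: eq_bigr => x _; congr (std_phase v _ / std_phase v _); last exact: sp_KV.
  by rewrite conj_act1 !sp_KV.
- by rewrite /commute -!conjMg vg.
- move=> x _; rewrite orbit_size_conj is_negative_conj.
  have [p1 p2 p3] := std_phaseP v (in_setT (u x)); split=> //;
    last by rewrite signed_permN.
  by rewrite conj_act1 sp_KV.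
- split=> [|x _|_ _ /imsetP[s sT ->] /imsetP[t tT ->]]; first exact: subsetT.
    have [t tT xt] := cov (u x) (in_setT _); exists ((u^-1)%g t); first exact: imset_f.
    by rewrite signed_cycle_conj sp_KV.
  by rewrite signed_cycle_conj !sp_KV => /inj->.
Qed.

End Phases.

(** * Vanishing of the sum of Phi over a centralizer *)

(** N indices that attain all N roots attain each exactly once, so the sum is the geometric sum of
    all N-th roots of unity. *)
Lemma sum_unity_surj N (psi : 'I_N -> algC) : (1 < N)%N ->
    (forall t : 'I_N, exists i, psi i = omega N ^+ t) ->
  \sum_i psi i = 0.
Proof.
move=> N1 sur; have N0 := ltnW N1; have P := omega_prim N0.
have sur' (t : 'I_N) : exists i, psi i == omega N ^+ t by have [i E] := sur t;
  exists i; rewrite E.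
pose f (t : 'I_N) := xchoose (sur' t).
have fE (t : 'I_N) : psi (f t) = omega N ^+ t by apply/eqP/(xchooseP (sur' t)).
have f_inj : injective f.
  move=> s t /(congr1 psi)/eqP; rewrite !fE (eq_prim_root_expr P).
  by rewrite !modn_small // => /eqP/val_inj.
rewrite (reindex_inj f_inj) /= (eq_bigr _ (fun t _ => fE t)).
have : (omega N - 1) * (\sum_(t < N) omega N ^+ t) = 0.
  by rewrite -subrX1 (prim_expr_order P) subrr.
move/eqP; rewrite mulf_eq0 subr_eq0 => /orP[/eqP o1|/eqP//].
have := prim_order_dvd P 1; rewrite o1 expr1n eqxx dvdn1.
by move/eqP => N1'; rewrite N1' in N1.
Qed.

Lemma modn_inverse t d : (0 < d)%N -> coprime t d -> exists s, (s * t = 1 %[mod d])%N.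
Proof.
move=> d0 td; exists (t ^ (totient d).-1)%N.
by rewrite -expnSr prednK ?totient_gt0 // Euler_exp_totient.
Qed.

Lemma gcd_split t N : (0 < N)%N ->
  exists k d t', [/\ N = (k * d)%N, t = (k * t')%N, coprime t' d,
    (0 < k)%N & (0 < d)%N].
Proof.
move=> N0; pose k := gcdn t N; have k0 : (0 < k)%N by rewrite gcdn_gt0 N0 orbT.
have Nk : N = (k * (N %/ k))%N by rewrite mulnC divnK ?dvdn_gcdr.
have tk : t = (k * (t %/ k))%N by rewrite mulnC divnK ?dvdn_gcdl.
exists k, (N %/ k)%N, (t %/ k)%N; split=> //.
  by rewrite /coprime -(eqn_pmul2l k0) muln_gcdr -tk -Nk muln1.
by rewrite divn_gt0 // dvdn_leq // dvdn_gcdr.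
Qed.

Lemma eqn_mod_pmul2l k d x y : (0 < k)%N ->
  (k * x == k * y %[mod k * d])%N = (x == y %[mod d])%N.
Proof. by move=> k0; rewrite -!muln_modr eqn_pmul2l. Qed.

(* The component of p under <v, g, -1>: v permutes m signed cycles of g
   cyclically, v ^+ m acts on them as eta g ^+ s, and k signed cycles of v are
   permuted cyclically by g. *)
Section Evaluate.
Variables (n : nat) (v g : signed_perm n) (p : pm n) (m s : nat) (eta : bool).
Hypothesis vg : commute v g.
Hypothesis m_gt0 : (0 < m)%N.
Hypothesis vQ : forall a, ((v ^+ a)%g p \in signed_cycle g p) = (m %| a)%N.
Hypothesis vm : (v ^+ m)%g p = pm_sign eta ((g ^+ s)%g p).

Lemma pow_muln_act a : (v ^+ (m * a))%g p = pm_sign (odd a && eta) ((g ^+ (s * a))%g p).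
Proof.
have vgs k : commute (v ^+ m)%g (g ^+ k)%g by apply/commuteX2.
elim: a => [|a IH]; first by rewrite !muln0 !sp_oneE pm_signF.
rewrite mulnS sp_XD IH pm_sign_act (sp_commute _ (vgs _)) vm pm_sign_act pm_signM
  -sp_XD.
by rewrite mulnS addnC /=; congr pm_sign; case: (odd a); case: (eta).
Qed.

Definition component := [set x | [exists a : 'I_#[v]%g,
  x \in signed_cycle g ((v ^+ a)%g p)]].

Lemma componentP x : reflect (exists a c b, x = pm_sign b ((g ^+ c)%g ((v ^+ a)%g p)))
  (x \in component).
Proof.
rewrite inE; apply: (iffP existsP) => [[a /signed_cycleP[c [b ->]]]|[a [c [b ->]]]].
  by exists a, c, b.
exists (Ordinal (ltn_pmod a (order_gt0 v))); apply/signed_cycleP.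
by exists c, b; rewrite /= expg_mod_order.
Qed.

Variable k : nat.
Hypothesis Hk : forall b,
  (exists a f, (g ^+ b)%g p = pm_sign f ((g ^+ (s * a))%g p)) <-> (k %| b)%N.

(** Read through [pow_muln_act]: D is the size of the orbit of p under v^m, and g^k p equals v^(m j)
    p up to the sign e. If e holds, no power of v^m sends p to -p, so the cycle of p is positive and
    a phase does not see this sign. *)
Variables (D j : nat) (e : bool).
Hypothesis HD : forall a, (pm_sign (odd a && eta) ((g ^+ (s * a))%g p) == p) = (D %|
  a)%N.
Hypothesis Hj : (g ^+ k)%g p = pm_sign (e (+) (odd j && eta)) ((g ^+ (s * j))%g p).
Hypothesis He : e -> forall a, pm_sign (odd a && eta) ((g ^+ (s * a))%g p) <> pmopp p.

Lemma component_reps_gt0 : (0 < k)%N.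
Proof.
apply: (@dvdn_gt0 _ (orbit_size g p)); first exact: orbit_size_gt0.
apply/Hk; exists 0%N, false; rewrite pm_signF muln0 sp_oneE; apply/eqP.
by rewrite orbit_sizeP.
Qed.

Lemma orbit_size_component : orbit_size v p = (m * D)%N.
Proof.
apply: orbit_size_uniq => a; have [/dvdnP[a' ->]|nma] := boolP (m %| a)%N.
  by rewrite mulnC pow_muln_act HD dvdn_pmul2l.
have -> : (m * D %| a)%N = false.
  by apply: contraNF nma; apply: dvdn_trans; apply: dvdn_mulr.
by apply: contraNF nma => /eqP E; rewrite -vQ E signed_cycle_refl.
Qed.

Lemma is_negative_component : e -> ~~ is_negative v p.
Proof.
move=> /He nE; apply/is_negativeP => -[a E].
have : (m %| a)%N by rewrite -vQ E -pm_signT signed_cycle_pm_sign.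
by case/dvdnP => a' Ea; apply: (nE a'); rewrite -pow_muln_act mulnC -Ea.
Qed.

Definition component_reps := [set (g ^+ b)%g p | b : 'I_k].

Lemma dvdn_component_reps b b' f a : (g ^+ (b + b'))%g p = pm_sign f ((v ^+ a)%g ((g ^+
  b)%g p)) -> (k %| b')%N.
Proof.
have vga : commute (v ^+ a)%g (g ^+ b)%g by apply/commuteX2.
rewrite (sp_commute _ vga) -pm_sign_act sp_XD => /sp_inj E.
have : (m %| a)%N.
  rewrite -vQ -(pm_signK f ((v ^+ a)%g p)) -E; apply/signed_cycleP.
  by exists b', f.
case/dvdnP=> a' Ea; rewrite Ea mulnC pow_muln_act pm_signM in E.
by apply/Hk; exists a', (f (+) (odd a' && eta)).
Qed.

Lemma component_reps_inj (b b' : 'I_k) : (g ^+ b')%g p \in signed_cycle v ((g ^+ b)%g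
  p) -> b = b'.
Proof.
wlog bb : b b' / (b <= b')%N.
  case/orP: (leq_total b b') => bb H; first exact: H.
  by move/signed_cycle_sym/H => <-.
case/signed_cycleP=> a [f]; rewrite -{1}(subnKC bb) => /dvdn_component_reps kb;
  apply/val_inj/eqP => /=.
rewrite eqn_leq bb -subn_eq0 -leqn0 leqNgt; apply/negP => b0.
have := leq_trans (dvdn_leq b0 kb) (leq_subr b b').
by rewrite leqNgt ltn_ord.
Qed.

Lemma component_repsP : cycle_transversal v component component_reps.
Proof.
split.
- apply/subsetP=> _ /imsetP[b _ ->]; apply/componentP.
  by exists 0%N, b, false; rewrite pm_signF sp_oneE.
- move=> x /componentP[a [c [b ->]]].
  exists ((g ^+ (c %% k))%g p); first by apply/imsetP;
    exists (Ordinal (ltn_pmod c component_reps_gt0)).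
  have /Hk[a' [f E]] : (k %| c %/ k * k)%N by apply: dvdn_mull.
  have vga l c' : commute (g ^+ c')%g (v ^+ l)%g by apply/commute_sym/commuteX2.
  rewrite [in X in X \in _](divn_eq c k) addnC sp_XD.
  rewrite [((g ^+ _)%g ((v ^+ a)%g p))](sp_commute _ (vga _ _)) E.
  have -> : (g ^+ (s * a'))%g p = pm_sign (odd a' && eta) ((v ^+ (m * a'))%g p).
    by rewrite pow_muln_act pm_signM addbb pm_signF.
  rewrite pm_signM !pm_sign_act pm_signM -sp_XD (sp_commute _ (vga _ _)).
  by apply/signed_cycleP; exists (a + m * a')%N, (b (+) (f (+) (odd a' && eta))).
- move=> _ _ /imsetP[b _ ->] /imsetP[b' _ ->] E.
  by rewrite (component_reps_inj E).
Qed.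

(** Along p, g p, ..., g^k p the product telescopes to theta (g^k p) / theta p. As g^k p is v^(m j)
    p up to a sign invisible to theta, and the v-orbit of p has size m D, this is
    [omega (m * D) ^+ (m * j)]. *)
Lemma component_eval S theta : signed_cycle_closed v S -> phase v S theta ->
    (forall b, (g ^+ b)%g p \in S) ->
  \prod_(x in component_reps) (theta (g x) / theta x) = omega D ^+ j.
Proof.
move=> cS ph gpS; have pS : p \in S by have := gpS 0%N; rewrite sp_oneE.
have D0 : (0 < D)%N by have := orbit_size_gt0 v p;
  rewrite orbit_size_component muln_gt0 => /andP[].
rewrite big_imset /=; last first.
  by move=> b b' _ _ E; apply: component_reps_inj; rewrite E signed_cycle_refl.
have nz b : theta ((g ^+ b)%g p) != 0 by have [] := ph _ (gpS b).
have -> : \prod_(b < k) (theta (g ((g ^+ b)%g p)) / theta ((g ^+ b)%g p)) =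
   theta ((g ^+ k)%g p) / theta p.
  elim: (k) => [|l IH]; first by rewrite big_ord0 sp_oneE divff // -[p]sp_oneE (nz 0%N).
  rewrite big_ord_recr /= IH expgS sp_mulE mulrC mulrA divfK //.
have -> : theta ((g ^+ k)%g p) = theta ((v ^+ (m * j))%g p).
  rewrite Hj -pm_signM -pow_muln_act; case: (e) is_negative_component =>
    [/(_ isT) nn|_]; last by rewrite pm_signF.
  have /(ph _)[_ _] : (v ^+ (m * j))%g p \in S by apply: (subsetP (cS p pS));
    apply: signed_cycle_X.
  by rewrite (is_negative_signed_cycle (signed_cycle_X v _ p)) pm_signT => ->.
rewrite (phaseX _ cS ph pS) orbit_size_component mulfK;
  last by rewrite -[p]sp_oneE (nz 0%N).
by rewrite exprM omegaM.
Qed.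

End Evaluate.

(** * Congruences that realize a prescribed root of unity *)

Section Arithmetic.
Variables (n : nat) (g : signed_perm n) (p : pm n).
Local Notation N := (orbit_size g p).

(** The assumptions of [component_eval] that concern only g on the orbit of p; the permutation v
    enters through eta and s alone. *)
Definition eval_data eta s D k j e :=
  [/\ forall a, (pm_sign (odd a && eta) ((g ^+ (s * a))%g p) == p) = (D %| a)%N,
      forall b, (exists a f, (g ^+ b)%g p = pm_sign f ((g ^+ (s * a))%g p)) <->
        (k %| b)%N,
      (g ^+ k)%g p = pm_sign (e (+) (odd j && eta)) ((g ^+ (s * j))%g p)
    & e -> forall a, pm_sign (odd a && eta) ((g ^+ (s * a))%g p) <> pmopp p].

Lemma pow_eq a b : ((g ^+ a)%g p = (g ^+ b)%g p) <-> (a == b %[mod N])%N.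
Proof. by rewrite -orbit_size_eq; split=> /eqP. Qed.

Lemma pow_nsg f a b : ~~ is_negative g p -> (g ^+ a)%g p = pm_sign f ((g ^+ b)%g p) ->
  f = false.
Proof.
by case: f => // nn; rewrite pm_signT => /is_negative_pair; rewrite (negPf nn).
Qed.

Lemma pow_nsg_eq f a : ~~ is_negative g p -> (pm_sign f ((g ^+ a)%g p) == p) = (~~ f &&
  (N %| a)%N).
Proof.
move=> nn; case: f => /=; last by rewrite pm_signF orbit_sizeP.
apply/negbTE/negP => /eqP E; have := @pow_nsg true 0 a nn.
by rewrite sp_oneE E => /(_ erefl).
Qed.

(* Write N = k d and t = k t' with t' prime to d.  One takes s = k s' with
   s' t' = 1 mod d, except if d is odd and moreover eta = true or - p lies in
   the orbit of p under g: then 2 s' t' = 1 mod d. *)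
Lemma eval_data_exists eta (t : nat) : (is_negative g p -> ~~ eta) ->
  exists s D k j e, eval_data eta s D k j e /\ omega D ^+ j = omega N ^+ t.
Proof.
move=> ngeta; have [k [d [t' [Nk tk cop k0 d0]]]] := gcd_split t (orbit_size_gt0 g p).
have cops s : (s * t' = 1 %[mod d])%N -> coprime s d.
  move=> E; have : coprime (s * t') d by rewrite -coprime_modl E coprime_modl coprime1n.
  by rewrite coprimeMl => /andP[].
have cops2 s : (s * (2 * t') = 1 %[mod d])%N -> coprime s d.
  move=> E; have : coprime (s * (2 * t')) d by rewrite -coprime_modl E coprime_modl
    coprime1n.
  by rewrite coprimeMl => /andP[].
have wt : omega d ^+ t' = omega N ^+ t by rewrite Nk tk exprM omegaM.
have kdvd s a : coprime s d -> (N %| k * s * a)%N = (d %| a)%N.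
  by move=> cs; rewrite Nk -mulnA dvdn_pmul2l // Gauss_dvdr // coprime_sym.
have kmod s b : (s = 1 %[mod d])%N -> (k * (s * b) == k * b %[mod N])%N.
  by move=> E; rewrite Nk eqn_mod_pmul2l // -modnMml E modnMml mul1n.
have kmodk a b : (a == k * b %[mod N])%N -> (k %| a)%N.
  rewrite Nk => /eqP E; rewrite /dvdn -(modn_dvdm a (dvdn_mulr d (dvdnn k))) E.
  by rewrite modn_dvdm ?dvdn_mulr // modnMr.
have [nn|nn] := boolP (is_negative g p); last first.
  have Hk0 r s : (s * r = 1 %[mod d])%N -> forall b : nat,
    (exists a f, (g ^+ b)%g p = pm_sign f ((g ^+ (k * s * a))%g p)) <-> (k %| b)%N.
    move=> E b; split=> [[a [f H]]|/dvdnP[b' ->]].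
      have f0 := pow_nsg nn H; rewrite f0 pm_signF in H; move/pow_eq: H; rewrite -mulnA.
      exact: kmodk.
    exists (r * b')%N, false; rewrite pm_signF; apply/pow_eq.
    by rewrite eq_sym -!mulnA [(b' * k)%N]mulnC [(s * _)%N]mulnA kmod.
  have Hk1 r s : (s * r = 1 %[mod d])%N -> (g ^+ k)%g p = (g ^+ (k * s * r))%g p.
    move=> E; apply/pow_eq; rewrite eq_sym -mulnA -[X in (_ == X %[mod _])%N]muln1.
    by rewrite -[(s * r)%N]muln1 kmod.
  case: eta {ngeta} => [|]; last first.
    have [s E] := modn_inverse d0 cop; have cs := cops _ E.
    exists (k * s)%N, d, k, t', false; split=> //; split=> //.
    - by move=> a; rewrite andbF pm_signF orbit_sizeP kdvd.
    - exact: Hk0 E.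
    - by rewrite andbF pm_signF; apply: Hk1.
  have [od|ed] := boolP (odd d).
    have [s E] : exists s, (s * (2 * t') = 1 %[mod d])%N.
      by apply: modn_inverse => //; rewrite coprimeMl cop andbT coprime2n.
    have cs := cops2 _ E.
    (* The sign eta doubles the odd orbit size d, and [omega (2 * d) ^+ (2 * t') = omega d ^+
       t']. *)
    exists (k * s)%N, (2 * d)%N, k, (2 * t')%N, false; split;
      last by rewrite exprM omegaM.
    split=> //.
    - move=> a; rewrite andbT pow_nsg_eq // kdvd // Gauss_dvd ?coprime2n //.
      by rewrite dvdn2.
    - exact: Hk0 E.
    - by rewrite mul2n odd_double pm_signF -mul2n; apply: Hk1.
  have [s E] := modn_inverse d0 cop; have cs := cops _ E.
  have ot : odd t'.
    rewrite -[odd t']negbK; apply/negP => et.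
    have : (2 %| gcdn t' d)%N by rewrite dvdn_gcd !dvdn2 et.
    by rewrite (eqP cop).
  (* Since t' is odd, e = true cancels the sign eta. Reaching -p would need an odd exponent
     divisible by the even number d. *)
  exists (k * s)%N, d, k, t', true; split=> //; split=> //.
  - move=> a; rewrite andbT pow_nsg_eq // kdvd // andb_idl // => da.
    by rewrite -dvdn2 (dvdn_trans _ da) // dvdn2.
  - exact: Hk0 E.
  - by rewrite ot pm_signF; apply: Hk1.
  - move=> _ a; rewrite andbT => H.
    have : pm_sign (~~ odd a) ((g ^+ (k * s * a))%g p) == p.
      by rewrite -[~~ odd a]/(true (+) odd a) -pm_signM H -pm_signT pm_signM pm_signF.
    rewrite pow_nsg_eq // kdvd // negbK => /andP[oa da].
    have : (2 %| a)%N by rewrite (dvdn_trans _ da) // dvdn2.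
    by rewrite dvdn2 oa.
have {ngeta}-> : eta = false by apply/negbTE/ngeta.
have [N2 half] := is_negative_half nn; set r := N./2 in N2 half.
have sgfl f b a : (g ^+ b)%g p = pm_sign f ((g ^+ a)%g p) <->
  (b == a + f * r %[mod N])%N.
  rewrite -pow_eq; case: f; rewrite ?pm_signT ?pm_signF ?mul0n ?addn0 // mul1n.
  by rewrite sp_XD half signed_permN.
have [od|ed] := boolP (odd d); last first.
  have [s E] := modn_inverse d0 cop; have cs := cops _ E.
  (* With d even, -p = g^r p for a multiple r of k, so allowing signs does not refine the classes
     modulo k. *)
  have kr : (k %| r)%N.
    have : (2 * r = k * d)%N by rewrite mul2n -N2.
    have -> : d = (2 * d./2)%N by rewrite mul2n even_halfK.
    rewrite mulnCA => /eqP; rewrite eqn_pmul2l // => /eqP->; exact: dvdn_mulr.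
  exists (k * s)%N, d, k, t', false; split=> //; split=> //.
  - by move=> a; rewrite andbF pm_signF orbit_sizeP kdvd.
  - move=> b; split=> [[a [f /sgfl]]|/dvdnP[b' ->]].
      case/dvdnP: kr => r' ->.
      have -> : (k * s * a + f * (r' * k) = k * (s * a + f * r'))%N by ring.
      exact: kmodk.
    exists (t' * b')%N, false; apply/sgfl; rewrite mul0n addn0.
    by rewrite eq_sym -!mulnA [(b' * k)%N]mulnC [(s * _)%N]mulnA kmod.
  - rewrite andbF pm_signF; apply/pow_eq.
    by rewrite eq_sym -mulnA -[X in (_ == X %[mod _])%N]muln1 -[(s * t')%N]muln1 kmod.
(* [h] inverts 2 modulo the odd number d, so s = s0 h satisfies 2 s t' = 1 modulo d. Here k is even,
   and -p = g^r p with r an odd multiple of k / 2, so up to sign the classes are those modulo k /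
   2. *)
have [s0 E0] := modn_inverse d0 cop; pose h := uphalf d.
have hE : (2 * h = 1 + d)%N by rewrite /h mul2n uphalfE even_halfK //= od.
pose s := (s0 * h)%N.
have cs : coprime s d.
  rewrite coprimeMl (cops _ E0) /=.
  have : coprime (2 * h) d by rewrite hE add1n coprimeSn.
  by rewrite coprimeMl => /andP[].
have ek : k = (2 * k./2)%N.
  rewrite mul2n even_halfK //; move/(congr1 odd): N2;
    rewrite Nk odd_double oddM od andbT.
  by move->.
set k2 := k./2 in ek.
have k20 : (0 < k2)%N by move: k0; rewrite ek; case: (k2).
have rk : r = (k2 * d)%N.
  by apply/eqP; rewrite -(eqn_pmul2l (isT : 0 < 2)%N) mul2n -N2 Nk {1}ek mulnA.
have NE : N = (k2 * (2 * d))%N by rewrite Nk {1}ek; ring.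
have key b' : (k2 * b' == k * s * (t' * b') + odd b' * r %[mod N])%N.
  have -> : (k * s * (t' * b') + odd b' * r = k2 * (2 * (s0 * t' * h) * b' + odd b' *
    d))%N.
    by rewrite ek rk /s; ring.
  rewrite NE eqn_mod_pmul2l // -modnDml -modnMml -muln_modr -[(s0 * t' * h %%
    d)%N]modnMml E0.
  rewrite modnMml mul1n muln_modr modnMml modnDml hE.
  have -> : ((1 + d) * b' + odd b' * d = b' + d * (odd b' + b'))%N by ring.
  have -> : (odd b' + b' = 2 * (odd b' + b'./2))%N by have := odd_double_half b'; lia.
  move: (odd b' + b'./2)%N => z.
  by have -> : (b' + d * (2 * z) = z * (2 * d) + b')%N; [ring | rewrite modnMDl].
exists (k * s)%N, d, k2, t', true; split=> //; split=> //.
- by move=> a; rewrite andbF pm_signF orbit_sizeP kdvd.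
- move=> b; split=> [[a [f /sgfl]]|/dvdnP[b' ->]].
    have -> : (k * s * a + f * r = k2 * (2 * s * a + f * d))%N by rewrite {1}ek rk;
      ring.
    rewrite NE => /eqP H; rewrite /dvdn -(modn_dvdm b (dvdn_mulr (2 * d) (dvdnn k2))) H.
    by rewrite modn_dvdm ?dvdn_mulr // modnMr.
  by exists (t' * b')%N, (odd b'); apply/sgfl; rewrite mulnC.
- by rewrite andbF; apply/sgfl; have := key 1%N; rewrite !muln1.
move=> _ a; rewrite andbF pm_signF -[p in pmopp p]sp_oneE -pm_signT -(expg0 g) => /sgfl.
rewrite add0n mul1n NE -mulnA ek rk => /eqP H.
have dv : (2 * k2 %| k2 * (2 * d))%N by rewrite mulnCA mulnA dvdn_mulr.
have : (2 * k2 %| k2 * d)%N.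
  by rewrite /dvdn -(modn_dvdm (k2 * d) dv) -H (modn_dvdm _ dv) modnMr.
by rewrite mulnC dvdn_pmul2l // dvdn2 od.
Qed.
End Arithmetic.

Section MakeSignedPerm.
Variables (n : nat) (f : pm n -> pm n).
Hypotheses (f_inj : injective f) (f_opp : forall x, f (pmopp x) = pmopp (f x)).

Fact mk_sp_subproof : [forall x, perm f_inj (pmopp x) == pmopp (perm f_inj x)].
Proof. by apply/forallP=> x; rewrite !permE f_opp. Qed.
Definition mk_sp : signed_perm n := SignedPerm mk_sp_subproof.
Lemma mk_spE x : mk_sp x = f x. Proof. by rewrite permE. Qed.
End MakeSignedPerm.

(** * Twisting w by powers of g on one signed cycle *)

Section SumZero.
Variable n : nat.
Implicit Types (v w g : signed_perm n) (x y p : pm n).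

Lemma signed_cycle_memX g p k x : ((g ^+ k)%g x \in signed_cycle g p) = (x \in
  signed_cycle g p).
Proof. by rewrite !signed_cycle_eq; congr (_ == _); apply/eqP;
  rewrite -signed_cycle_eq signed_cycle_X. Qed.

Lemma signed_cycle_mem_pm_sign g p b x : (pm_sign b x \in signed_cycle g p) = (x \in
  signed_cycle g p).
Proof. by rewrite !signed_cycle_eq; congr (_ == _); apply/eqP;
  rewrite -signed_cycle_eq signed_cycle_pm_sign. Qed.

Lemma powV g k x y : y = (g ^+ k)%g x -> x = (g ^+ (k * #[g]%g.-1))%g y.
Proof.
move->; rewrite -sp_XD addnC -mulnS prednK ?order_gt0 // mulnC expgM expg_order.
by rewrite expg1n sp_oneE.
Qed.

Lemma signed_cycle_closed_intro v (S : {set pm n}) : {in S, forall x, v x \in S} ->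
  (forall b, {in S, forall x, pm_sign b x \in S}) -> signed_cycle_closed v S.
Proof.
move=> vS sS x xS; apply/subsetP=> y /signed_cycleP[k [b ->]]; apply: sS.
by elim: k => [|k IH]; rewrite ?expg0 ?sp_oneE // expgS sp_mulE vS.
Qed.

Lemma signed_cycle_closedC v (S : {set pm n}) : signed_cycle_closed v S ->
  signed_cycle_closed v (~: S).
Proof.
move=> cS x; rewrite inE => xS; apply/subsetP=> y yx; rewrite inE.
by apply: contra xS => /cS/subsetP/(_ x); apply; apply: signed_cycle_sym.
Qed.

Lemma cycle_transversal_restrict v (S T : {set pm n}) :
  signed_cycle_closed v S -> cycle_transversal v setT T ->
    cycle_transversal v S (T :&: S).
Proof.
move=> cS [_ cov inj]; split=> [|x xS|s t]; first exact: subsetIr.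
  have [t tT xt] := cov x (in_setT x); exists t => //; rewrite inE tT /=.
  by apply: (subsetP (cS x xS)); apply: signed_cycle_sym.
by rewrite !inE => /andP[sT _] /andP[tT _]; apply: inj.
Qed.

Lemma twist_exists g p :
  {q : signed_perm n | forall x, q x = if x \in signed_cycle g p then g x else x}.
Proof.
pose f x := if x \in signed_cycle g p then g x else x.
have gQ x : (g x \in signed_cycle g p) = (x \in signed_cycle g p) by have :=
  signed_cycle_memX g p 1 x; rewrite expg1.
have f_inj : injective f.
  move=> x y; rewrite /f; case: ifP => xQ; case: ifP => yQ //.
  - exact: sp_inj.
  - by move=> E; move: yQ; rewrite -E gQ xQ.
  - by move=> E; move: xQ; rewrite E gQ yQ.
have f_opp x : f (pmopp x) = pmopp (f x).
  by rewrite /f -!pm_signT signed_cycle_mem_pm_sign; case: ifP => _;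
    rewrite ?pm_sign_act ?pm_signT.
by exists (mk_sp f_inj f_opp) => x; rewrite mk_spE.
Qed.

Section Twist.
Variables (w g q : signed_perm n) (p : pm n).
Hypothesis wg : commute w g.
Hypothesis qE : forall x, q x = if x \in signed_cycle g p then g x else x.
Let Q := signed_cycle g p.

Lemma twistX i x : (q ^+ i)%g x = if x \in Q then (g ^+ i)%g x else x.
Proof.
elim: i => [|i IH]; first by rewrite !sp_oneE if_same.
rewrite !expgS !sp_mulE IH qE; case xQ: (x \in Q); last by rewrite xQ.
by rewrite signed_cycle_memX xQ.
Qed.

Lemma twist_comm : commute q g.
Proof.
apply: sp_eqP => x; rewrite !sp_mulE !qE; have := signed_cycle_memX g p 1 x.
by rewrite expg1 => ->; case: ifP.
Qed.

Let v i := (w * q ^+ i)%g.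

Lemma twisted_comm i : commute (v i) g.
Proof. by apply/commute_sym/commuteM; [apply: commute_sym |
  apply/commuteX/commute_sym/twist_comm]. Qed.

(** Every visit to the signed g-cycle of p inserts a power of g, which can be moved to the front
    since g commutes with w. Hence twisted and untwisted orbits meet the same g-cycles. *)
Lemma twist_orbit i a : exists c, (v i ^+ a)%g p = (g ^+ c)%g ((w ^+ a)%g p).
Proof.
elim: a => [|a [c IH]]; first by exists 0%N; rewrite !sp_oneE.
have wgc c' : commute w (g ^+ c')%g by apply: commuteX.
rewrite !expgS [((v i) * _)%g _]sp_mulE IH /v sp_mulE twistX; case: ifP => _.
  by exists (i + c)%N; rewrite -sp_XD (sp_commute _ (wgc _)) sp_mulE.
by exists c; rewrite (sp_commute _ (wgc _)) sp_mulE.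
Qed.

Lemma twist_mem i a : ((v i ^+ a)%g p \in Q) = ((w ^+ a)%g p \in Q).
Proof. by have [c ->] := twist_orbit i a; rewrite signed_cycle_memX. Qed.

Let K := component w g p.

Lemma twist_comp i : component (v i) g p = K.
Proof.
apply/setP=> x; apply/componentP/componentP => -[a [c [b ->]]]; have [c' E] :=
  twist_orbit i a.
  by exists a, (c + c')%N, b; rewrite E sp_XD.
by exists a, (c + c' * #[g]%g.-1)%N, b; rewrite sp_XD -(powV E).
Qed.

Lemma component_closed : signed_cycle_closed w K.
Proof.
have wgc c' : commute w (g ^+ c')%g by apply: commuteX.
apply: signed_cycle_closed_intro => [x|b' x] /componentP[a [c [b ->]]];
  apply/componentP.
  by exists a.+1, c, b; rewrite pm_sign_act (sp_commute _ (wgc _)) expgS sp_mulE.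
by exists a, c, (b' (+) b); rewrite pm_signM.
Qed.

Lemma component_act x : x \in K -> g x \in K.
Proof.
case/componentP=> a [c [b ->]]; apply/componentP; exists a, c.+1, b.
by rewrite pm_sign_act expgS sp_mulE.
Qed.

Lemma component_actC x : x \in ~: K -> g x \in ~: K.
Proof.
rewrite !in_setC; apply: contra => /componentP[a [c [b E]]]; apply/componentP.
exists a, (c + 1 * #[g]%g.-1)%N, b.
have -> : x = (g ^+ (1 * #[g]%g.-1))%g (g x) by apply: powV.
by rewrite E pm_sign_act -sp_XD addnC.
Qed.

Lemma sub_component x : x \in Q -> x \in K.
Proof.
case/signed_cycleP=> c [b ->]; apply/componentP; exists 0%N, c, b.
by rewrite sp_oneE.
Qed.

Lemma twist_off i : {in ~: K, w =1 v i}.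
Proof.
move=> x; rewrite in_setC => xK; rewrite /v sp_mulE twistX ifN //.
by apply: contra xK; apply: sub_component.
Qed.

End Twist.

Lemma Phi_split v g (S : {set pm n}) :
  Phi v g = (\prod_(x in cycle_reps v :&: S) (std_phase v (g x) / std_phase v x)) *
            (\prod_(x in cycle_reps v :&: ~: S) (std_phase v (g x) / std_phase v x)).
Proof. by rewrite -setDE /Phi (big_setID S). Qed.

Lemma std_phase_on v (S : {set pm n}) : phase v S (std_phase v).
Proof. by move=> x _; apply: std_phaseP. Qed.

(* The factor psi i of the component of p takes every N-th root of unity as a
   value, hence each of them exactly once. *)
Lemma twist_sum w g p (q : signed_perm n) : commute w g -> g p != p ->
    (forall x, q x = if x \in signed_cycle g p then g x else x) ->
  \sum_(i < orbit_size g p) Phi (w * q ^+ i)%g g = 0.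
Proof.
move=> wg gp qE; set N := orbit_size g p; pose v i := (w * q ^+ i)%g.
have vg i : commute (v i) g := twisted_comm wg qE i.
pose K := component w g p.
have cK : signed_cycle_closed w K := component_closed wg.
have cKC := signed_cycle_closedC cK.
have cKv i : signed_cycle_closed (v i) K by rewrite /K -(twist_comp wg qE i);
  apply: component_closed.
have N1 : (1 < N)%N.
  rewrite ltn_neqAle orbit_size_gt0 andbT eq_sym; apply: contra gp => /eqP N1.
  by rewrite -{1}(expg1 g) orbit_sizeP -/N N1.
pose psi i := \prod_(x in cycle_reps (v i) :&: K) (std_phase (v i) (g x) / std_phase (v
  i) x).
(* Off the component v i coincides with w, so that factor can be pulled out of the sum over i. *)
have PhiE i : Phi (v i) g = psi i *
    \prod_(x in cycle_reps w :&: ~: K) (std_phase w (g x) / std_phase w x).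
  rewrite (Phi_split _ _ K); congr (_ * _); symmetry.
  apply: (@prod_phase _ w (v i) g (~: K)) => //.
  - exact: (twist_off qE).
  - by move=> x; apply: component_actC.
  - exact: std_phase_on.
  - exact: std_phase_on.
  - exact: cycle_transversal_restrict cKC (cycle_reps_transversal _).
  - apply: cycle_transversal_restrict (cycle_reps_transversal _);
    exact: signed_cycle_closedC.
rewrite (eq_bigr _ (fun (i : 'I_N) _ => PhiE i)) -big_distrl /= [X in X * _](_ : _ = 0)
  ?mul0r //.
apply: sum_unity_surj => // t.
have [m m0 mP] : {m : nat | (0 < m)%N & forall a,
  ((w ^+ a)%g p \in signed_cycle g p) = (m %| a)%N}.
  apply: (@nat_period _ #[w]%g); rewrite ?order_gt0 ?expg_order ?expg0 ?sp_oneE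
    ?signed_cycle_refl //.
  move=> k l /signed_cycleP[c [b E]]; rewrite addnC sp_XD E pm_sign_act
    signed_cycle_mem_pm_sign.
  have C : commute (w ^+ l)%g (g ^+ c)%g by apply: commuteX2.
  by rewrite (sp_commute _ C) signed_cycle_memX.
have [c [eta [wm ngeta]]] : exists c eta, (w ^+ m)%g p = pm_sign eta ((g ^+ c)%g p)
    /\ (is_negative g p -> ~~ eta).
  have : (w ^+ m)%g p \in signed_cycle g p by rewrite mP.
  case/signed_cycleP=> c [[] E]; last by exists c, false.
  have [ng|nn] := boolP (is_negative g p); last by exists c, true.
  (* If -p lies in the g-orbit of p, the sign is absorbed into the exponent of g; this is the
     condition on eta in [eval_data_exists]. *)
  have [_ half] := is_negative_half ng; exists (c + N./2)%N, false; split=> //.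
  by rewrite pm_signF sp_XD half signed_permN E pm_signT.
have [s [D [k [j [e [[E1 E2 E3 E4] Et]]]]]] := eval_data_exists t ngeta.
have N0 : (0 < N)%N := ltnW N1.
(* This i is s - c modulo N, chosen so that g^i turns the exponent c of the first return of w into
   s. *)
exists (Ordinal (ltn_pmod (s + c * N.-1) N0)) => /=; set i := (_ %% _)%N.
have vm : (v i ^+ m)%g p = pm_sign eta ((g ^+ s)%g p).
  (* The orbit starts at p and next meets the signed g-cycle of p at time m, so q^i acts
     nontrivially at the first step only. *)
  have va a : (0 < a <= m)%N -> (v i ^+ a)%g p = (g ^+ i)%g ((w ^+ a)%g p).
    elim: a => // -[|a] IH /andP[_ am].
      rewrite !expg1 /v sp_mulE (twistX qE) signed_cycle_refl.
      by apply: sp_commute; apply: commuteX.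
    rewrite expgS sp_mulE IH ?(ltnW am) // /v sp_mulE (twistX qE) signed_cycle_memX mP.
    rewrite gtnNdvd // (sp_commute _ (commuteX i wg)).
    by rewrite [in RHS]expgS sp_mulE.
  rewrite va ?m0 ?leqnn // wm pm_sign_act -sp_XD; congr pm_sign.
  apply/eqP; rewrite orbit_size_eq -/N /i modnDml -addnA -mulnSr prednK //.
  by rewrite addnC modnMDl.
rewrite /psi -Et -(@component_eval _ (v i) g p m s eta (vg i) m0 _ vm k E2 D j e E1 E3
  E4 K (std_phase (v i))).
- apply: (@prod_phase _ (v i) (v i) g K) => //.
  - by move=> x; apply: component_act.
  - exact: std_phase_on.
  - exact: std_phase_on.
  - exact: cycle_transversal_restrict (cycle_reps_transversal _).
  rewrite /K -(twist_comp wg qE i); apply: (component_repsP (vg i) _ vm E2).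
  by move=> a; rewrite -mP; apply: (twist_mem wg qE).
- by move=> a; rewrite -mP; apply: (twist_mem wg qE).
- exact: cKv.
- exact: std_phase_on.
by move=> b; apply: sub_component; apply: signed_cycle_X.
Qed.

(** Right multiplication by q^i permutes the centralizer of g. Summing over all i therefore gives a
    positive multiple of the sum, and also, after exchanging the sums, a sum of the vanishing
    [twist_sum] terms. *)
Lemma Phi_sum_neq1 g : g != 1%g -> \sum_(w in 'C[g]%g) Phi w g = 0.
Proof.
move=> g1; have [p gp] : exists p, g p != p.
  apply/existsP; apply: contraNT g1; rewrite negb_exists => /forallP H.
  by apply/eqP/sp_eqP => x; rewrite sp_oneE; apply/eqP; have := H x; rewrite negbK.
have [q qE] := twist_exists g p.
have : \sum_(i < orbit_size g p) \sum_(w in 'C[g]%g) Phi w g = 0.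
  transitivity (\sum_(i < orbit_size g p) \sum_(w in 'C[g]%g) Phi (w * q ^+ i)%g g).
    apply: eq_bigr => i _; rewrite (reindex_inj (mulIg (q ^+ i)%g)) /=.
    apply: eq_bigl => w; rewrite groupMr // groupX //.
    by apply/cent1P; apply: (twist_comm qE).
  rewrite exchange_big big1 // => w /cent1P wg.
  by apply: twist_sum => //; apply: commute_sym.
rewrite sumr_const card_ord => /eqP; rewrite mulrn_eq0 => /orP[|/eqP//].
by rewrite -leqn0 leqNgt orbit_size_gt0.
Qed.

End SumZero.

(** * The elements w_la *)

Section ActionFormulas.
Variable n : nat.

Lemma sp_ofE (f : {perm 'I_n}) (P : {set 'I_n}) x :
  sp_of f P x = (f x.1, x.2 (+) (x.1 \in P)).
Proof. by rewrite permE. Qed.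

Lemma w0E (P : {set 'I_n}) x : w0 P x = (x.1, x.2 (+) (x.1 \in P)).
Proof.
pose r := [seq j <- index_enum 'I_n | j \in P].
have -> : (x.1 \in P) = (x.1 \in r) by rewrite mem_filter mem_index_enum andbT.
rewrite /w0 -big_filter -/r.
have : uniq r by rewrite filter_uniq ?index_enum_uniq.
elim: r => [|j r IH] /=; first by rewrite big_nil sp_oneE addbF; case: x.
case/andP=> jr /IH E; rewrite big_cons sp_mulE E sp_ofE /= perm1 !inE -addbA.
congr (_, _ (+) _); move: jr.
by case: (eqVneq x.1 j) => [->|_] /=; [move/negPf-> | rewrite addbF].
Qed.

Lemma enum_interval (P : {set 'I_n}) a b : (b <= n)%N ->
    (forall l : 'I_n, (l \in P) = (a <= l < b)%N) ->
  [seq val l | l <- enum P] = iota a (b - a).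
Proof.
move=> bn PE; apply: (irr_sorted_eq ltn_trans ltnn).
- have -> : enum P = filter (mem P) (enum 'I_n) by rewrite enumT.
  rewrite sorted_map; apply: sorted_filter => [k l m|]; first exact: ltn_trans.
  by rewrite -sorted_map val_enum_ord iota_ltn_sorted.
- exact: iota_ltn_sorted.
move=> k; rewrite mem_iota; apply/mapP/idP.
  case=> l; rewrite mem_enum PE => /andP[al lb] ->; rewrite al subnKC //.
  exact: leq_trans (ltnW lb).
move=> /andP[ak kb]; have {}kb : (k < b)%N by lia.
have kn : (k < n)%N by apply: leq_trans bn.
by exists (Ordinal kn); rewrite // mem_enum PE ak.
Qed.

Lemma cycle_permE (P : {set 'I_n}) a b (l : 'I_n) : (b <= n)%N ->
    (forall l : 'I_n, (l \in P) = (a <= l < b)%N) -> l \in P ->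
  cycle_perm P l = (if l.+1 < b then l.+1 else a)%N :> nat.
Proof.
move=> bn PE lP; rewrite permE -/(val _) -(next_map val_inj) ?enum_uniq //.
rewrite -[map _ _]/[seq val l | l <- enum P] (enum_interval bn PE).
have /andP[al lb] : (a <= l < b)%N by rewrite -PE.
rewrite next_nth mem_iota al subnKC ?lb ?(ltnW (leq_ltn_trans al lb)) //.
have -> : (b - a = (b - a).-1.+1)%N by rewrite prednK // subn_gt0 (leq_ltn_trans al lb).
have -> : index (val l) (iota a (b - a).-1.+1) = (l - a)%N.
  have la : (l - a < (b - a).-1.+1)%N by lia.
  have := @index_uniq _ a (l - a) (iota a (b - a).-1.+1).
  by rewrite size_iota iota_uniq nth_iota // subnKC // => ->.
rewrite [iota _ _]/=; case: ifP => lb'.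
  by rewrite nth_iota ?addSn ?subnKC //; lia.
by rewrite nth_default // size_iota; lia.
Qed.

Lemma cycle_perm_out (P : {set 'I_n}) l : l \notin P -> cycle_perm P l = l.
Proof. by move=> lP; rewrite permE next_nth mem_enum (negPf lP). Qed.

End ActionFormulas.

(** * The action of w_la on the blocks and its signed cycles *)

Section Blocks.
Variables (n : nat) (la : seq int).
Hypothesis laP : is_signed_partition n la.
Local Notation L i := (absz la`_i).
Local Notation H i := (la_hat la i).
Local Notation K := (size la).
Local Notation block i := (block n la i).
Local Notation w := (w_la n la).

Lemma la_neq0 i : (i < K)%N -> la`_i != 0.
Proof.
move=> iK; case/and5P: laP => nz _ _ _ _.
by apply: contraNneq nz => <-; apply: mem_nth.
Qed.

Lemma L_gt0 i : (i < K)%N -> (0 < L i)%N.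
Proof. by move/la_neq0; rewrite absz_gt0. Qed.

Lemma la_hat0 : H 0 = 0%N. Proof. by rewrite /la_hat take0. Qed.

Lemma la_hatS i : (i < K)%N -> H i.+1 = (H i + L i)%N.
Proof.
move=> iK; rewrite /la_hat (take_nth 0%N) ?size_map // sumn_rcons.
by rewrite (nth_map 0).
Qed.

Lemma la_hat_size i : (K <= i)%N -> H i = n.
Proof.
move=> iK; rewrite /la_hat take_oversize ?size_map //.
by case/and5P: laP => _ /eqP.
Qed.

Lemma la_hat_mono i j : (i <= j)%N -> (H i <= H j)%N.
Proof.
move=> ij; rewrite /la_hat -(subnKC ij) takeD sumn_cat; exact: leq_addr.
Qed.

Lemma la_hat_le i : (H i <= n)%N.
Proof.
have [/la_hat_size->//|iK] := leqP K i.
by rewrite -(la_hat_size (leqnn K)) la_hat_mono // ltnW.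
Qed.

Lemma blockE i (l : 'I_n) : (l \in block i) = (H i <= l < H i.+1)%N.
Proof. by rewrite inE. Qed.

Lemma block_inj i j l : l \in block i -> l \in block j -> i = j.
Proof.
wlog ij : i j / (i <= j)%N.
  by case/orP: (leq_total i j) => ij wl; [|move=> *; symmetry]; apply: wl.
rewrite !blockE => /andP[_ l1] /andP[l2 _]; apply/eqP; rewrite eqn_leq ij leqNgt.
apply/negP => /la_hat_mono H1; have := leq_trans l1 (leq_trans H1 l2).
by rewrite ltnn.
Qed.

Lemma block_ex (l : 'I_n) : exists i : 'I_K, l \in block i.
Proof.
have ex : exists i, (l < H i)%N by exists K; rewrite la_hat_size.
case: (ex_minnP ex) => -[|i] li imin; first by rewrite la_hat0 in li.
have iK : (i < K)%N.
  rewrite ltnNge; apply/negP => Ki.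
  have := imin K; rewrite la_hat_size // => /(_ (ltn_ord l)).
  by rewrite leqNgt ltnS Ki.
exists (Ordinal iK); rewrite blockE li andbT leqNgt; apply/negP => /imin.
by rewrite ltnn.
Qed.

Lemma la_hat_lt (i : 'I_K) : (H i < n)%N.
Proof.
apply: leq_trans (la_hat_le i.+1); rewrite la_hatS // -addn1 leq_add2l.
exact: L_gt0.
Qed.

Definition block_start (i : 'I_K) : pm n := (Ordinal (la_hat_lt i), false).

Lemma block_start_mem i : (block_start i).1 \in block i.
Proof. by rewrite blockE /= leqnn la_hatS // -addn1 leq_add2l L_gt0. Qed.

Definition factor_la i := if 0 < la`_i then c_la n la i else d_la n la i.

(** For a negative entry the sign changes at every step if the block size is odd, and only at the
    last letter if it is even. Either way one turn makes an odd number of sign changes, so the cycle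
    is negative. *)
Lemma factor_laE i x : (i < K)%N -> x.1 \in block i ->
  (factor_la i x).1 = (if x.1.+1 < H i.+1 then x.1.+1 else H i)%N :> nat /\
  (factor_la i x).2 = x.2 (+) ((la`_i < 0) && (odd (L i) || (x.1.+1 == H i.+1))).
Proof.
move=> iK xb.
have cE := cycle_permE (la_hat_le i.+1) (blockE i) xb.
rewrite /factor_la; case: ltrP => la0.
  by rewrite /c_la /pos_cycle sp_ofE /= cE in_set0 ltNge (ltW la0).
have -> : (la`_i < 0) by rewrite lt_neqAle la_neq0.
rewrite /d_la; case: ifP => od.
  by rewrite sp_mulE w0E xb /c_la /pos_cycle sp_ofE /= cE in_set0 addbF.
rewrite /neg_cycle sp_ofE /= cE; split=> //; congr (_ (+) _).
rewrite inE xb /=; apply/forall_inP/eqP => [mx|E k].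
  apply/eqP; rewrite eqn_leq; move: (xb); rewrite blockE => /andP[x1 ->] /=.
  have H1 : (H i < H i.+1)%N by rewrite la_hatS // -addn1 leq_add2l L_gt0.
  have kn : ((H i.+1).-1 < n)%N.
    by apply: leq_trans (la_hat_le i.+1); rewrite prednK // (leq_ltn_trans _ H1).
  have /mx /= : Ordinal kn \in block i by rewrite blockE /=; lia.
  by lia.
by rewrite blockE -E ltnS => /andP[].
Qed.

Lemma factor_la_out i x : x.1 \notin block i -> factor_la i x = x.
Proof.
case: x => l c /= xb; have cE := cycle_perm_out xb.
have c_out : c_la n la i (l, c) = (l, c).
  by rewrite /c_la /pos_cycle sp_ofE /= cE in_set0 addbF.
rewrite /factor_la /d_la; case: ifP => // _; case: ifP => _.
  by rewrite sp_mulE w0E /= (negPf xb) addbF.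
rewrite /neg_cycle sp_ofE /= cE; have -> : l \in [set l in block i | [forall k in block
  i, (k <= l)%N]] = false.
  by rewrite inE (negPf xb).
by rewrite addbF.
Qed.

Lemma prod_blocks (u : 'I_K -> signed_perm n) (i : 'I_K) (x : pm n) :
    (forall (j : 'I_K) (y : pm n), y.1 \notin block j -> u j y = y) ->
      x.1 \in block i ->
  (\prod_(j < K) u j)%g x = u i x.
Proof.
move=> uout xb.
have ux : (u i x).1 \in block i.
  apply: contraT => nb; have /sp_inj E := uout i _ nb.
  by rewrite E xb in nb.
rewrite -[LHS]/((\prod_(j <- index_enum 'I_K) u j)%g x).
suff -> : forall r : seq 'I_K, uniq r -> (\prod_(j <- r) u j)%g x = if i \in r then u i
  x else x.
  by rewrite mem_index_enum.
  exact: index_enum_uniq.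
elim=> [|j r IH] /=; first by rewrite big_nil sp_oneE.
case/andP=> jr /IH E; rewrite big_cons sp_mulE E inE.
case: (eqVneq i j) jr => [<- ir|ij _] /=; first by rewrite (negPf ir).
case: ifP => _; apply: uout; apply: contra ij => b.
  by apply/eqP/val_inj; exact: (block_inj ux b).
by apply/eqP/val_inj; exact: (block_inj xb b).
Qed.

Lemma w_la_block (i : 'I_K) x : x.1 \in block i -> w x = factor_la i x.
Proof. by move=> xb; apply: (prod_blocks (u := factor_la)) => // j y;
  apply: factor_la_out. Qed.

Lemma w_laX (i : 'I_K) j : (j < L i)%N ->
  ((w ^+ j)%g (block_start i)).1 = (H i + j)%N :> nat /\
  ((w ^+ j)%g (block_start i)).2 = [&& odd j, la`_i < 0 & odd (L i)].
Proof.
have HS := la_hatS (ltn_ord i).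
elim: j => [|j IH] jL; first by rewrite sp_oneE addn0.
have [IH1 IH2] := IH (ltnW jL).
have xb : ((w ^+ j)%g (block_start i)).1 \in block i by rewrite blockE IH1 HS; lia.
rewrite expgS sp_mulE (w_la_block xb); have [-> ->] := factor_laE (ltn_ord i) xb.
rewrite IH1 IH2 HS -addnS ltn_add2l jL; split=> //.
rewrite eqn_add2l (ltn_eqF jL) orbF /=.
by case: (odd j) (la`_i < 0) (odd (L i)) => [] [] [].
Qed.

Lemma w_laXL (i : 'I_K) : (w ^+ (L i))%g (block_start i) = pm_sign (la`_i < 0)
  (block_start i).
Proof.
have HS := la_hatS (ltn_ord i); have L0 := L_gt0 (ltn_ord i).
have [jL [E1 E2]] : exists jL : ((L i).-1 < L i)%N,
  ((w ^+ (L i).-1)%g (block_start i)).1 = (H i + (L i).-1)%N :> nat /\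
  ((w ^+ (L i).-1)%g (block_start i)).2 = [&& odd (L i).-1, la`_i < 0 & odd (L i)].
  have jL : ((L i).-1 < L i)%N by rewrite prednK.
  by exists jL; apply: w_laX.
have xb : ((w ^+ (L i).-1)%g (block_start i)).1 \in block i by rewrite blockE E1 HS;
  lia.
rewrite -{1}(prednK L0) expgS sp_mulE (w_la_block xb).
have [F1 F2] := factor_laE (ltn_ord i) xb.
apply/eqP; rewrite -pair_eqE /pair_eq /=; apply/andP; split.
  by apply/eqP/ord_inj; rewrite F1 E1 HS -addnS prednK // ltnn.
rewrite F2 E1 E2 HS -addnS prednK // eqxx orbT andbT /=.
by rewrite -{2}(prednK L0) /=; case: (odd _.-1) (la`_i < 0) => [] [].
Qed.

Lemma w_laXM (i : 'I_K) q : (w ^+ (L i * q))%g (block_start i) = pm_sign (odd q &&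
  (la`_i < 0)) (block_start i).
Proof.
elim: q => [|q IH]; first by rewrite muln0 sp_oneE pm_signF.
rewrite mulnS sp_XD IH pm_sign_act w_laXL pm_signM /=.
by congr pm_sign; case: (odd q); case: (la`_i < 0).
Qed.

Lemma block_orbit (i : 'I_K) x : x.1 \in block i ->
  exists2 j, (j < L i)%N & exists b, x = pm_sign b ((w ^+ j)%g (block_start i)).
Proof.
rewrite blockE (la_hatS (ltn_ord i)) => /andP[x1 x2].
have jL : (x.1 - H i < L i)%N by lia.
exists (x.1 - H i)%N => //; have [E1 _] := w_laX jL.
exists (x.2 (+) ((w ^+ (x.1 - H i))%g (block_start i)).2); apply/eqP.
rewrite -pair_eqE /pair_eq /= addbC addbK eqxx andbT.
by apply/eqP/ord_inj; rewrite E1 /= subnKC.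
Qed.

Lemma w_la_pow_eq (i : 'I_K) a b : ((w ^+ a)%g (block_start i) == pm_sign b
  (block_start i)) =
  (L i %| a)%N && (odd (a %/ L i) && (la`_i < 0) == b).
Proof.
have L0 := L_gt0 (ltn_ord i); have rL : (a %% L i < L i)%N by rewrite ltn_mod.
have -> : (w ^+ a)%g (block_start i) = pm_sign (odd (a %/ L i) && (la`_i < 0)) ((w ^+
  (a %% L i))%g (block_start i)).
  by rewrite {1}(divn_eq a (L i)) addnC sp_XD mulnC w_laXM pm_sign_act.
have [E1 _] := w_laX rL; rewrite /dvdn.
case: (posnP (a %% L i)) => [->|r0] /=.
  rewrite sp_oneE -(inj_eq (@pm_sign_inj _ b)) !pm_signM addbb pm_signF pm_sign_fix.
  by case: b; case: (_ && _).
apply/negbTE/eqP => /(congr1 (fun x => nat_of_ord x.1)) /=; rewrite E1.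
by move: r0; case: (_ %% _)%N => //=; lia.
Qed.

Lemma is_negative_w_la i : is_negative w (block_start i) = (la`_i < 0).
Proof.
apply/is_negativeP/idP => [[k /eqP]|la0].
  by rewrite -pm_signT w_la_pow_eq => /andP[_ /eqP]; case: (la`_i < 0); rewrite ?andbF.
by exists (L i); rewrite w_laXL la0 pm_signT.
Qed.

Lemma orbit_size_w_la i : orbit_size w (block_start i) = if la`_i < 0 then (L i).*2
  else L i.
Proof.
have L0 := L_gt0 (ltn_ord i).
apply: orbit_size_uniq => a; rewrite -[X in _ == X]pm_signF w_la_pow_eq.
case: (la`_i < 0); last by rewrite andbF andbT.
rewrite andbT eqbF_neg -dvdn2 -muln2.
apply/andP/idP => [[/dvdnP[q ->]]|/dvdnP[q ->]];
  first by rewrite mulnK // [(L i * 2)%N]mulnC dvdn_pmul2r.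
by rewrite mulnCA dvdn_mulr // mulKn // dvdn_mull.
Qed.

Lemma signed_cycle_w_la i x : (x \in signed_cycle w (block_start i)) = (x.1 \in block
  i).
Proof.
apply/signed_cycleP/idP => [[k [b ->]]|/block_orbit[j _ [b ->]]]; last by exists j, b.
have L0 := L_gt0 (ltn_ord i); have rL : (k %% L i < L i)%N by rewrite ltn_mod.
rewrite (divn_eq k (L i)) addnC sp_XD mulnC w_laXM pm_sign_act pm_signM.
have [E1 _] := w_laX rL; rewrite blockE /= E1 (la_hatS (ltn_ord i)).
by rewrite leq_addr ltn_add2l.
Qed.

Lemma block_start_inj : injective block_start.
Proof.
move=> i j E; apply/val_inj/(@block_inj _ _ (block_start i).1);
  first exact: block_start_mem.
by rewrite E block_start_mem.
Qed.

Lemma cycle_transversal_w_la : cycle_transversal w setT [set block_start i | i : 'I_K].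
Proof.
split=> [|x _|_ _ /imsetP[i _ ->] /imsetP[j _ ->]]; first exact: subsetT.
  have [i xi] := block_ex x.1; exists (block_start i); first exact: imset_f.
  by rewrite signed_cycle_w_la.
rewrite signed_cycle_w_la => bj; congr block_start; apply/val_inj/(block_inj bj).
exact: block_start_mem.
Qed.

End Blocks.

(** * Conjugacy classes and induction *)

(** Turns a rearrangement of cycle sizes into a rearrangement of the cycle representatives
    themselves. *)
Lemma perm_map_lift (S T : eqType) (f : S -> T) (s : seq S) (t : seq T) :
  perm_eq (map f s) t -> exists2 s', perm_eq s s' & map f s' = t.
Proof.
elim: t s => [|y t IH] s st.
  exists [::] => //; move/perm_size: st; rewrite size_map /=.
  by case: s.
have : y \in map f s by rewrite (perm_mem st) mem_head.
case/mapP=> x xs yx; have sx := perm_to_rem xs.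
have [|s' ss' s't] := IH (rem x s).
  rewrite -(perm_cons y) {1}yx -map_cons; apply: perm_trans st.
  by rewrite perm_sym; apply: perm_map.
exists (x :: s'); last by rewrite /= s't yx.
by apply: perm_trans sx _; rewrite perm_cons.
Qed.

Section CycleTypes.
Variable n : nat.
Implicit Types (v w g u : signed_perm n) (x y : pm n) (b : bool).

(** Decides whether two points of a signed cycle, given by sign and exponent, coincide. Only the
    orbit size and the sign type of the cycle enter, which is why these determine the conjugacy
    class. *)
Definition same_point M (ng : bool) b j c k : bool :=
  if b == c then (j == k %[mod M])%N else ng && (j == k + M./2 %[mod M])%N.

Lemma same_pointP v x b j c k :
  (pm_sign b ((v ^+ j)%g x) == pm_sign c ((v ^+ k)%g x)) = same_point (orbit_size v x)
    (is_negative v x) b j c k.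
Proof.
rewrite /same_point; have [<-|bc] := eqVneq b c;
  first by rewrite (inj_eq (@pm_sign_inj _ _)) orbit_size_eq.
rewrite -(inj_eq (@pm_sign_inj _ b)) !pm_signM addbb pm_signF.
have -> : b (+) c = true by move: bc; case: (b); case: (c).
have [ng|nn] := boolP (is_negative v x) => /=; last first.
  by apply: contraNF nn => /eqP; rewrite pm_signT; apply: is_negative_pair.
have [_ half] := is_negative_half ng.
by rewrite pm_signT -signed_permN -half -sp_XD orbit_size_eq.
Qed.

(** The equivariant extension of beta is well defined and injective because coincidences on both
    sides are decided by the same [same_point]. Control of its values on T' is needed for block
    translations. *)
Lemma conj_of_bij v v' (T' : {set pm n}) (beta : pm n -> pm n) :
    cycle_transversal v' setT T' ->
    {in T', forall t, orbit_size v (beta t) = orbit_size v' t /\ is_negative v (beta t)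
      = is_negative v' t} ->
    {in T' &, forall s t, beta t \in signed_cycle v (beta s) -> s = t} ->
  {u | v' = (v ^ u)%g & {in T', forall t, u t = beta t}}.
Proof.
move=> tT' same binj.
pose A t b j := pm_sign b ((v ^+ j)%g (beta t)).
have AE t b j c k : t \in T' ->
    (pm_sign b ((v' ^+ j)%g t) == pm_sign c ((v' ^+ k)%g t)) = (A t b j == A t c k).
  by move=> /same[E1 E2]; rewrite !same_pointP E1 E2.
have [t tT b j c k /eqP|F FE] := @equivariant_extension _ _ v' T' A tT'.
  by rewrite AE // => /eqP.
have cov x : exists t b j, t \in T' /\ x = pm_sign b ((v' ^+ j)%g t).
  by have [_ cov _] := tT'; have [t tT /signed_cycleP[j [b ->]]] := cov x (in_setT x);
    exists t, b, j.
have F_inj : injective F.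
  move=> x y; have [t [b [j [tT ->]]]] := cov x; have [s [c [k [sT ->]]]] := cov y.
  rewrite !FE // => E; have st : s = t.
    apply: binj => //; apply: (@signed_cycle_trans _ _ _ (A t b j)); last first.
      by apply: signed_cycle_sym; apply/signed_cycleP; exists j, b.
    by rewrite E; apply/signed_cycleP; exists k, c.
  by rewrite st in E *; apply/eqP; rewrite AE // E.
have F_opp x : F (pmopp x) = pmopp (F x).
  have [t [b [j [tT ->]]]] := cov x.
  by rewrite -!pm_signT pm_signM !FE // /A pm_signM.
exists (mk_sp F_inj F_opp) => [|t tT]; last first.
  by rewrite mk_spE; have := FE t tT false 0%N; rewrite /A !pm_signF !sp_oneE.
set u := mk_sp _ _; suff E : (v * u = u * v')%g by rewrite /conjg E mulKg.
apply: sp_eqP => x; rewrite !sp_mulE !mk_spE.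
have [t [b [j [tT ->]]]] := cov x.
by rewrite pm_sign_act -sp_mulE -expgS !FE // /A pm_sign_act -sp_mulE -expgS.
Qed.

(** The entry of the signed partition belonging to the cycle; a negative cycle on L letters has
    orbit size 2 L. *)
Definition signed_size v x : int :=
  if is_negative v x then - ((orbit_size v x)./2)%:Z else (orbit_size v x)%:Z.

Lemma signed_size_signed_cycle v x : {in signed_cycle v x, forall y,
  signed_size v y = signed_size v x}.
Proof. by move=> y yx; rewrite /signed_size (is_negative_signed_cycle yx)
  (orbit_size_signed_cycle yx). Qed.

Lemma half_gt0 v x : is_negative v x -> (0 < (orbit_size v x)./2)%N.
Proof.
move=> ng; have [E _] := is_negative_half ng.
by have := orbit_size_gt0 v x; rewrite {1}E double_gt0.
Qed.

Lemma signed_size_lt0 v x : (signed_size v x < 0) = is_negative v x.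
Proof.
rewrite /signed_size; have [ng|_] := boolP (is_negative v x); last by rewrite ltNge.
by rewrite oppr_lt0 ltz_nat half_gt0.
Qed.

Lemma signed_size_neq0 v x : signed_size v x != 0.
Proof.
rewrite /signed_size; have [ng|_] := boolP (is_negative v x).
  by rewrite oppr_eq0 eqz_nat -lt0n half_gt0.
by rewrite eqz_nat -lt0n orbit_size_gt0.
Qed.

Lemma signed_size_inj v v' x x' : signed_size v x = signed_size v' x' ->
  orbit_size v x = orbit_size v' x' /\ is_negative v x = is_negative v' x'.
Proof.
move=> E; have ngE : is_negative v x = is_negative v' x' by rewrite -!signed_size_lt0 E.
split=> //; move: E; rewrite /signed_size -ngE; have [ng|_] := boolP (is_negative v x);
  last by case.
have [E1 _] := is_negative_half ng; rewrite ngE in ng; have [E2 _] :=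
  is_negative_half ng.
by move/oppr_inj => -[E]; rewrite E1 E2 E.
Qed.

Definition cycle_type v : seq int := [seq signed_size v x | x <- enum (cycle_reps v)].

Lemma cycle_type_cycle_transversal v T : cycle_transversal v setT T ->
  perm_eq (cycle_type v) [seq signed_size v x | x <- enum T].
Proof.
move=> tT; apply/seq.permP => a; rewrite !count_map -!sum1_count !big_enum_cond /= .
rewrite !big_mkcondr; apply: (cycle_transversal_reindex addn (cycle_reps_transversal v)
  tT) => x _ y yx /=.
by rewrite (signed_size_signed_cycle yx).
Qed.

Lemma cycle_transversal_conj v u T : cycle_transversal v setT T ->
  cycle_transversal (v ^ u)%g setT [set (u^-1)%g x | x in T].
Proof.
case=> _ cov inj; split=> [|x _|_ _ /imsetP[s sT ->] /imsetP[t tT ->]].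
- exact: subsetT.
- have [t tT xt] := cov (u x) (in_setT _); exists ((u^-1)%g t); first exact: imset_f.
  by rewrite signed_cycle_conj sp_KV.
by rewrite signed_cycle_conj !sp_KV => /inj->.
Qed.

Lemma signed_size_conj v u x : signed_size (v ^ u)%g x = signed_size v (u x).
Proof. by rewrite /signed_size orbit_size_conj is_negative_conj. Qed.

Lemma cycle_type_conj v u : perm_eq (cycle_type (v ^ u)%g) (cycle_type v).
Proof.
apply: perm_trans (cycle_type_cycle_transversal (cycle_transversal_conj u
  (cycle_reps_transversal v))) _.
apply/seq.permP => a; rewrite !count_map -!sum1_count !big_enum_cond /=.
rewrite !big_mkcondr big_imset /=; last by move=> ? ? _ _; apply: (@sp_inj _ (u^-1)%g).
by apply: eq_bigr => x _; rewrite signed_size_conj sp_KV.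
Qed.

Lemma cycle_type_conj_exists v v' : perm_eq (cycle_type v) (cycle_type v') -> exists u,
  v' = (v ^ u)%g.
Proof.
case/perm_map_lift => bs pbs E.
have sz : size bs = size (enum (cycle_reps v')) by have := congr1 size E;
  rewrite !size_map.
pose beta x := nth x bs (index x (enum (cycle_reps v'))).
have ubs : uniq bs by rewrite -(perm_uniq pbs) enum_uniq.
have [_ _ inj] := cycle_reps_transversal v.
have bT t : t \in cycle_reps v' -> beta t \in cycle_reps v.
  move=> tT; rewrite -mem_enum (perm_mem pbs) mem_nth // sz index_mem mem_enum //.
have [||u -> _] := @conj_of_bij v v' _ beta (cycle_reps_transversal v');
  last by exists u.
  move=> t tT; apply: signed_size_inj.
  rewrite -(nth_map _ 0) ?E; last by rewrite sz index_mem mem_enum.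
  by rewrite (nth_map t) ?nth_index ?index_mem ?mem_enum.
move=> s t sT tT /inj bst; have {bst} := bst (bT s sT) (bT t tT); rewrite /beta.
rewrite (set_nth_default s) ?sz ?index_mem ?mem_enum //.
move/eqP; rewrite nth_uniq ?sz ?index_mem ?mem_enum // => /eqP E2.
have := congr1 (nth s (enum (cycle_reps v'))) E2.
by rewrite !nth_index ?mem_enum.
Qed.

Lemma card_signed_cycle v x : #|signed_cycle v x| = (2 * absz (signed_size v x))%N.
Proof.
have M0 := orbit_size_gt0 v x; rewrite /signed_size; have [ng|nn] :=
  boolP (is_negative v x).
  have [E _] := is_negative_half ng; rewrite abszN absz_nat mul2n -E.
  have -> : signed_cycle v x = [set (v ^+ j)%g x | j : 'I_(orbit_size v x)].
    apply/setP=> y; apply/signed_cycleP/imsetP => [[k [b ->]]|[j _ ->]]; last first.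
      by exists j, false; rewrite pm_signF.
    have [_ half] := is_negative_half ng.
    have [c ->] : exists c, pm_sign b ((v ^+ k)%g x) = (v ^+ c)%g x.
      case: b; last by exists k; rewrite pm_signF.
      by exists (k + (orbit_size v x)./2)%N; rewrite sp_XD half signed_permN pm_signT.
    by exists (Ordinal (ltn_pmod c M0)); rewrite //= orbit_size_expn.
  rewrite card_imset ?card_ord // => i j /eqP; rewrite orbit_size_eq !modn_small //.
  by move/eqP/val_inj.
have -> : signed_cycle v x = [set pm_sign q.1 ((v ^+ q.2)%g x) | q : bool *
  'I_(orbit_size v x)].
  apply/setP=> y; apply/signed_cycleP/imsetP => [[k [b ->]]|[j _ ->]]; last first.
    by exists j.2, j.1.
  by exists (b, Ordinal (ltn_pmod k M0)); rewrite //= orbit_size_expn.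
rewrite card_imset ?card_prod ?card_bool ?card_ord //.
move=> [b i] [c j] /eqP /=; rewrite same_pointP /same_point (negPf nn) /=.
by case: eqP => // -> ; rewrite !modn_small // => /eqP/val_inj->.
Qed.

Lemma sum_cycle_type v : sumn [seq absz z | z <- cycle_type v] = n.
Proof.
have E : \sum_(x in cycle_reps v) #|signed_cycle v x| = (2 * n)%N.
  have -> : (2 * n)%N = #|pm n| by rewrite card_prod card_ord card_bool mulnC.
  rewrite -cardsT -sum1_card [RHS](partition_big (cycle_rep v) (mem (cycle_reps v)))
    /=; last first.
    by move=> x _; rewrite inE; apply/eqP/cycle_rep_eq/cycle_rep_mem.
    apply: eq_bigr => x; rewrite inE => /eqP rx; rewrite -sum1_card; apply: eq_bigl =>
      y.
  rewrite in_setT /=; apply/idP/eqP => [/cycle_rep_eq->//|E].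
  by rewrite -E; apply: signed_cycle_sym; apply: cycle_rep_mem.
apply/eqP; rewrite -(eqn_pmul2l (isT : 0 < 2)%N) -E -map_comp sumnE big_map big_enum /=.
rewrite big_distrr /=; apply/eqP; apply: eq_bigr => x _.
by rewrite card_signed_cycle.
Qed.

Lemma filter_posneg (s : seq int) : 0 \notin s ->
  perm_eq s ([seq x : int <- s | 0 < x] ++ [seq x : int <- s | x < 0]).
Proof.
move=> s0; rewrite perm_sym.
have -> : [seq x : int <- s | x < 0] = [seq x : int <- s | ~~ (0 < x)].
  apply: eq_in_filter => x xs; rewrite -leNgt le_eqVlt.
  by case: eqP => // x0; rewrite -x0 xs in s0.
by rewrite perm_filterC.
Qed.

Lemma signed_partition_of v : exists la : signed_partition n, perm_eq la (cycle_type v).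
Proof.
set s := cycle_type v; pose abs_ge (x y : int) := (absz y <= absz x)%N.
pose pos := sort abs_ge [seq x : int <- s | 0 < x].
pose neg := sort abs_ge [seq x : int <- s | x < 0].
have s0 : 0 \notin s.
  by apply/mapP => -[x _ /eqP]; rewrite eq_sym (negPf (signed_size_neq0 v x)).
have ps : perm_eq (pos ++ neg) s.
  rewrite perm_sym; apply: perm_trans (filter_posneg s0) _.
  by apply: perm_cat; rewrite perm_sym perm_sort.
have posP (x : int) : x \in pos -> 0 < x by rewrite mem_sort mem_filter => /andP[].
have negP (x : int) : x \in neg -> x < 0 by rewrite mem_sort mem_filter => /andP[].
have Fpos : [seq x : int <- pos ++ neg | 0 < x] = pos.
  rewrite filter_cat [X in _ ++ X](_ : _ = [::]) ?cats0; last first.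
    apply/eqP; rewrite -[_ == _]negbK -has_filter; apply/hasPn => x /negP.
    by rewrite -leNgt => /ltW.
  by apply/all_filterP/allP.
have Fneg : [seq x : int <- pos ++ neg | x < 0] = neg.
  rewrite filter_cat [X in X ++ _](_ : _ = [::]) ?cat0s; last first.
    apply/eqP; rewrite -[_ == _]negbK -has_filter; apply/hasPn => x /posP.
    by rewrite -leNgt => /ltW.
  by apply/all_filterP/allP.
have tot : total abs_ge by move=> x y; apply: leq_total.
have ok : is_signed_partition n (pos ++ neg).
  rewrite /is_signed_partition Fpos Fneg (perm_mem ps) s0 eqxx !sorted_map !sort_sorted
    //=.
  by rewrite -(perm_sumn (perm_map absz (_ : perm_eq s _))) ?sum_cycle_type ?eqxx //
    perm_sym.
by exists (SignedPartition ok).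
Qed.

Lemma signed_partition_inj (la mu : signed_partition n) : perm_eq la mu -> la = mu.
Proof.
move=> lm; apply: val_inj => /=; have /and5P[_ _ /eqP la1 la2 la3] := spartP la.
have /and5P[_ _ /eqP mu1 mu2 mu3] := spartP mu; rewrite la1 mu1.
have tr : transitive geq by move=> x y z xy yz; apply: leq_trans yz xy.
have asym : antisymmetric geq by move=> x y; rewrite andbC => /anti_leq.
congr (_ ++ _).
  have E : [seq absz x | x : int <- la & 0 < x] = [seq absz x | x : int <- mu & 0 < x].
    by apply: (sorted_eq tr asym) => //; apply/perm_map/perm_filter.
  have Z (s : seq int) : [seq x : int <- s | 0 < x] = map Posz [seq absz x | x : int <-
    s & 0 < x].
    rewrite -map_comp -[LHS]map_id; apply/eq_in_map => x; rewrite mem_filter =>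
      /andP[x0 _] /=.
    by rewrite gtz0_abs.
  by rewrite Z E -Z.
have E : [seq absz x | x : int <- la & x < 0] = [seq absz x | x : int <- mu & x < 0].
  by apply: (sorted_eq tr asym) => //; apply/perm_map/perm_filter.
have Z (s : seq int) : [seq x : int <- s | x < 0] = map (fun k =>
  - Posz k) [seq absz x | x : int <- s & x < 0].
  rewrite -map_comp -[LHS]map_id; apply/eq_in_map => x; rewrite mem_filter =>
    /andP[x0 _] /=.
  by rewrite ltz0_abs ?opprK.
by rewrite Z E -Z.
Qed.

Lemma signed_size_w_la (la : seq int) (laP : is_signed_partition n la) (i : 'I_(size
  la)) :
  signed_size (w_la n la) (block_start laP i) = la`_i.
Proof.
rewrite /signed_size is_negative_w_la orbit_size_w_la; case: ltrP => la0;
  last by rewrite gez0_abs.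
by rewrite doubleK ltz0_abs ?opprK.
Qed.

Lemma cycle_type_w_la (la : signed_partition n) : perm_eq (cycle_type (w_la n la)) la.
Proof.
have laP := spartP la.
apply: perm_trans (cycle_type_cycle_transversal (cycle_transversal_w_la laP)) _.
have E : perm_eq (enum [set block_start laP i | i : 'I_(size la)]) [seq block_start laP
  i | i <- enum 'I_(size la)].
  apply: uniq_perm; rewrite ?enum_uniq ?(map_inj_uniq (@block_start_inj _ _ laP))
    ?enum_uniq //.
  move=> x; rewrite mem_enum; apply/imsetP/mapP => -[i _ ->]; exists i => //.
  by rewrite mem_enum.
apply: perm_trans (perm_map _ E) _; rewrite -map_comp.
have -> : [seq (signed_size (w_la n la) \o block_start laP) i | i <- enum 'I_(size la)]
  =
          [seq la`_i | i <- [seq val i | i <- enum 'I_(size la)]].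
  by rewrite -map_comp; apply/eq_map => i; apply: signed_size_w_la.
by rewrite val_enum_ord map_nth_iota0 // take_size.
Qed.

Lemma class_w_la v (la : signed_partition n) :
  (v \in (w_la n la) ^: W n)%g = perm_eq la (cycle_type v).
Proof.
apply/imsetP/idP => [[u _ ->]|pv].
  by rewrite perm_sym; apply: perm_trans (cycle_type_conj _ _) (cycle_type_w_la la).
have [|u ->] := @cycle_type_conj_exists (w_la n la) v; last by exists u.
exact: perm_trans (cycle_type_w_la la) pv.
Qed.

(** The fibres of y |-> w^y are cosets of the centralizer of w. *)
Lemma sum_class (gT : finGroupType) (G : {group gT}) (w : gT) (F : gT -> algC) :
  w \in G -> \sum_(y in G) F (w ^ y)%g = #|'C_G[w]%g|%:R * \sum_(x in (w ^: G)%g) F x.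
Proof.
move=> wG; rewrite (partition_big (fun y : gT => (w ^ y)%g) (mem (w ^: G)%g)) /=;
  last first.
  by move=> y yG; apply: memJ_class.
rewrite mulr_sumr; apply: eq_bigr => _ /imsetP[z zG ->].
rewrite (eq_bigr (fun _ => F (w ^ z)%g)) => [|y /andP[_ /eqP->]//].
rewrite sumr_const mulr_natl -(card_rcoset _ z); congr (_ *+ _); apply: eq_card => y.
rewrite unfold_in mem_rcoset in_setI; case yG: (y \in G) => /=; last first.
  by rewrite groupMr ?groupV // yG.
rewrite groupMr ?groupV // yG /= -(inj_eq (conjg_inj (z^-1)%g)) -!conjgM mulgV conjg1.
rewrite -(inj_eq (mulgI (y * z^-1)%g)) -conjgC.
by apply/eqP/cent1P => [E|E]; first [exact: E | exact: commute_sym E].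
Qed.

(** Every w is conjugate to [w_la] for exactly one la, so the sum over w splits into classes. On one
    class it is the formula for the induced character, by the conjugation invariance of Phi. *)
Lemma sum_Ind (phi : forall la : signed_partition n, 'CF('C_(W n)[w_la n la]%g)) g :
    (forall (la : signed_partition n) z, commute (w_la n la) z ->
      phi la z = Phi (w_la n la) z) ->
  \sum_(la : signed_partition n) ('Ind[W n] (phi la)) g = \sum_(w in 'C[g]%g) Phi w g.
Proof.
move=> phiE; pose F w := if w \in 'C[g]%g then Phi w g else 0.
rewrite [RHS]big_mkcond /= -/F.
have ex v : exists la : signed_partition n, perm_eq la (cycle_type v) :=
  signed_partition_of v.
rewrite [RHS](partition_big (fun v => xchoose (ex v)) xpredT) //=.
apply: eq_bigr => la _.
have -> : \sum_(v | xchoose (ex v) == la) F v = \sum_(v in ((w_la n la) ^: W n)%g) F v.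
  apply: eq_bigl => v; rewrite class_w_la; have xv := xchooseP (ex v).
  apply/eqP/idP => [<-//|lv]; apply: signed_partition_inj.
  by apply: perm_trans xv _; rewrite perm_sym.
rewrite cfIndE ?subsetIl //.
have c0 : #|'C_(W n)[w_la n la]%g|%:R != 0 :> algC by rewrite pnatr_eq0 -lt0n cardG_gt0.
apply: (mulfI c0); rewrite mulVKf // -sum_class ?inE //.
(* Induction conjugates g, while the class sum conjugates [w_la]; passing to inverses matches them.
   Outside the centralizer both sides are 0. *)
rewrite (reindex_inj invg_inj) /=; apply: eq_big => y; first by rewrite !inE.
move=> _; rewrite /F; have [cy|ncy] := boolP ((w_la n la ^ y)%g \in 'C[g]%g);
  last first.
  rewrite cfun0 // inE in_setT /=; apply: contra ncy => /cent1P cy.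
  by apply/cent1P/commute_sym; rewrite /commute -(conjgKV y g) -!conjMg cy.
have cw : commute (w_la n la) (g ^ (y^-1))%g.
  move/cent1P: cy => cy; rewrite /commute -(conjgK y (w_la n la)) -!conjMg.
  by rewrite cy.
by rewrite phiE // -(Phi_conj y cw) conjgKV.
Qed.

End CycleTypes.

(** * Minimal coset representatives *)

Section Length.
Variable n : nat.
Local Notation gens := (coxeter_gens n).
Implicit Types (u v w x : signed_perm n).

Definition is_word w := exists k, w \in (gens ^+ k)%g.

Lemma is_word1 : is_word 1%g.
Proof. by exists 0%N; rewrite expg0 inE. Qed.

Lemma is_wordM u v : is_word u -> is_word v -> is_word (u * v)%g.
Proof. by case=> k uk [l vl]; exists (k + l)%N; rewrite expgD mem_mulg. Qed.

Lemma is_word_gen s : s \in gens -> is_word s.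
Proof. by exists 1%N; rewrite expg1. Qed.

(** Products are reversed because permutations multiply from left to right, whereas [signed_perm]
    composes functions. *)
Lemma sp_ofM (f h : {perm 'I_n}) : sp_of (f * h)%g set0 = (sp_of h set0 * sp_of f
  set0)%g.
Proof.
by apply: sp_eqP => y; rewrite sp_mulE !sp_ofE /= !in_set0 !addbF permM.
Qed.

(** Induction on b - a: with c = b - 1, the transposition of a, b is that of a, c conjugated by the
    simple reflection of c, b. *)
Lemma is_word_s (i j : 'I_n) : is_word (sp_s i j).
Proof.
suff le_word : forall d (a b : 'I_n), (a + d = b)%N -> is_word (sp_s a b).
  have [ij|ji] := leqP i j; first by apply: (le_word (j - i)%N); rewrite subnKC.
  rewrite /sp_s tpermC; apply: (le_word (i - j)%N); rewrite subnKC //.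
  exact: ltnW.
elim=> [|d IH] a b ab.
  have -> : b = a by apply/val_inj; rewrite /= -ab addn0.
  suff -> : sp_s a a = 1%g by exact: is_word1.
  by apply: sp_eqP => y; rewrite sp_ofE sp_oneE tperm1 perm1 in_set0 addbF; case: y.
case: d IH ab => [|d] IH ab.
  apply: is_word_gen; rewrite inE; apply/orP; right; apply/imsetP.
  by exists (a, b) => //=; rewrite inE /= -ab addn1.
have cn : (a + d.+1 < n)%N by apply: ltn_trans (ltn_ord b); rewrite -ab; lia.
pose c := Ordinal cn.
have cb : is_word (sp_s c b).
  apply: is_word_gen; rewrite inE; apply/orP; right; apply/imsetP.
  by exists (c, b) => //=; rewrite inE /= -ab; apply/eqP; lia.
have -> : sp_s a b = (sp_s c b * (sp_s a c * sp_s c b))%g.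
  rewrite /sp_s -!sp_ofM; congr sp_of.
  have -> : tperm a b = (tperm a c ^ tperm c b)%g.
    rewrite tpermJ tpermL tpermD //; apply/negP => /eqP/(congr1 val) /=; lia.
  by rewrite /conjg tpermV mulgA.
by apply: is_wordM => //; apply: is_wordM => //; apply: IH.
Qed.

Lemma is_word_t (j : 'I_n) : is_word (sp_t j).
Proof.
have n0 : (0 < n)%N by apply: leq_ltn_trans (ltn_ord j).
pose z := Ordinal n0.
have -> : sp_t j = (sp_s z j * (sp_t z * sp_s z j))%g.
  apply: sp_eqP => -[i c].
  rewrite !sp_mulE /sp_s /sp_t !sp_ofE /= !perm1 !in_set0 !addbF tpermK !in_set1.
  have -> // : (tperm z j i == z) = (i == j).
  by rewrite -{2}(tpermR z j) (inj_eq perm_inj).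
apply: is_wordM; first exact: is_word_s.
apply: is_wordM; last exact: is_word_s.
by apply: is_word_gen; rewrite inE; apply/orP; left; apply/imsetP; exists z;
  rewrite ?inE.
Qed.

Lemma is_word_perm (f : {perm 'I_n}) : is_word (sp_of f set0).
Proof.
have [ts -> _] := prod_tpermP f; elim: ts => [|t ts IH].
  rewrite big_nil; suff -> : sp_of 1 set0 = 1%g :> signed_perm n by exact: is_word1.
  by apply: sp_eqP => y; rewrite sp_ofE sp_oneE perm1 in_set0 addbF; case: y.
by rewrite big_cons sp_ofM; apply: is_wordM => //; apply: is_word_s.
Qed.

Lemma is_wordT w : is_word w.
Proof.
have f_inj : injective (fun i => (w (i, false)).1).
  move=> i j E; have : w (i, false) = w (pm_sign ((w (i, false)).2 (+) (w (j,
    false)).2) (j, false)).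
    rewrite pm_sign_act; apply/eqP; rewrite -pair_eqE /pair_eq /= E eqxx /=.
    by rewrite addbC -addbA addbb addbF.
  by move/sp_inj/(congr1 fst).
pose A := [set i | (w (i, false)).2].
have -> : w = (sp_of (perm f_inj) set0 * w0 A)%g.
  apply: sp_ext => i; rewrite sp_mulE w0E sp_ofE /= permE inE in_set0 addbF.
  by case: (w _).
apply: is_wordM; first exact: is_word_perm.
rewrite /w0; apply: big_ind => [||i _]; [exact: is_word1 | exact: is_wordM |].
exact: is_word_t.
Qed.

(** Length without the search bound of [sp_length]; [sp_lengthE] shows that the bound does no
    harm. *)
Definition word_len w : nat := ex_minn (is_wordT w).

Lemma word_lenP w : w \in (gens ^+ (word_len w))%g.
Proof. by rewrite /word_len; case: ex_minnP. Qed.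

Lemma word_len_min w k : w \in (gens ^+ k)%g -> (word_len w <= k)%N.
Proof. by rewrite /word_len; case: ex_minnP => m _ mmin /mmin. Qed.

Lemma word_lenS w k : word_len w = k.+1 ->
  exists s u, [/\ s \in gens, w = (s * u)%g & word_len u = k].
Proof.
move=> wk; have := word_lenP w; rewrite wk expgS => /mulsgP[s u s_gen uk E].
exists s, u; split=> //; apply/eqP; rewrite eqn_leq word_len_min //=.
rewrite -ltnS -wk E; apply: word_len_min.
by rewrite expgS mem_mulg // word_lenP.
Qed.

Lemma word_len_gen s u : s \in gens -> (word_len (s * u)%g <= (word_len u).+1)%N.
Proof. by move=> s_gen; apply: word_len_min; rewrite expgS mem_mulg // word_lenP. Qed.

(* Dropping letters from a minimal word of w yields an element of every
   smaller length. *)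
Lemma word_len_lt w : (word_len w < #|W n|)%N.
Proof.
have ex (j : 'I_(word_len w).+1) : exists u, word_len u == j.
  case: j => j /=; rewrite ltnS => jw.
  move: {2}(word_len w) (erefl (word_len w)) jw => k; elim: k w => [|k IH] w wk jw.
    by exists w; move: jw; rewrite wk leqn0 => /eqP->.
  move: jw; rewrite leq_eqVlt => /orP[/eqP->|]; first by exists w.
  rewrite wk ltnS => jk; have [s [u [_ _ uk]]] := word_lenS wk.
  by apply: (IH u uk); rewrite uk.
pose f j := xchoose (ex j).
have f_inj : injective f.
  by move=> i j E; apply/val_inj; rewrite /= -(eqP (xchooseP (ex i))) -(eqP (xchooseP
    (ex j))) -/(f i) E.
by have := leq_card f f_inj; rewrite card_ord cardsT.
Qed.

Lemma sp_lengthE w : sp_length w = word_len w.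
Proof.
rewrite /sp_length; set p := (fun k => _).
have wN := word_len_lt w.
have hp : has p (iota 0 #|W n|).
  by apply/hasP; exists (word_len w); rewrite ?mem_iota // /p word_lenP.
have := hp; rewrite has_find size_iota => fN.
apply/eqP; rewrite eqn_leq; apply/andP; split.
  rewrite leqNgt; apply/negP => lt.
  by have := before_find 0%N lt; rewrite nth_iota // /p word_lenP.
by have := nth_find 0%N hp; rewrite nth_iota // => /word_len_min.
Qed.

End Length.

(** * Minimal representatives are those positive and increasing on blocks *)

Section MinimalRepresentatives.
Variables (n : nat) (la : seq int).
Hypothesis laP : is_signed_partition n la.
Implicit Types (u v w x : signed_perm n).
Local Notation block i := (block n la i).
Local Notation K := (size la).

Lemma W_laP w : reflect (forall (i : 'I_K) l, l \in block i -> (w (l,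
  false)).1 \in block i)
  (w \in W_la n la).
Proof.
rewrite inE; apply: (iffP forallP) => H i; last by apply/forall_inP => l; apply: H.
by move=> l lb; have /forall_inP := H i; apply.
Qed.

Lemma W_la_act w (i : 'I_K) (y : pm n) : w \in W_la n la ->
  ((w y).1 \in block i) = (y.1 \in block i).
Proof.
move/W_laP => wW; have sub (j : 'I_K) (z : pm n) : z.1 \in block j ->
  (w z).1 \in block j.
  by case: z => l c /= /(wW _ _); have -> : (l, c) = pm_sign c (l, false) by [];
    rewrite pm_sign_act.
apply/idP/idP; last exact: sub.
have [j yj] := block_ex laP y.1; move=> wyi.
by rewrite (block_inj wyi (sub _ _ yj)).
Qed.

Lemma W_la_group_set : group_set (W_la n la).
Proof.
apply/group_setP; split; first by apply/W_laP => i l; rewrite sp_oneE.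
by move=> u v uW vW; apply/W_laP => i l lb; rewrite sp_mulE !W_la_act.
Qed.
Canonical W_la_group := Group W_la_group_set.

Definition block_increasing x :=
  (forall l, (x (l, false)).2 = false) /\
  (forall (i : 'I_K) (l m : 'I_n), l \in block i -> m \in block i -> (l < m)%N ->
     ((x (l, false)).1 < (x (m, false)).1)%N).

Lemma block_increasing1 : block_increasing 1%g.
Proof. by split=> [l|i l m _ _]; rewrite !sp_oneE. Qed.

(* Hence replacing every suffix of a word by the increasing representative of
   its coset only deletes letters. *)
Lemma increasing_gen s x : s \in coxeter_gens n -> block_increasing x ->
  block_increasing (s * x)%g \/ (s * x)%g \in (x *: W_la n la)%g.
Proof.
move=> s_gen [xpos xinc]; rewrite inE in s_gen; case/orP: s_gen => /imsetP[].
  move=> j _ ->; right; rewrite mem_lcoset; apply/W_laP => i l lb.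
  rewrite !sp_mulE.
  have -> : sp_t j (x (l, false)) = pm_sign ((x (l, false)).1 \in [set j]) (x (l,
    false)).
    by rewrite /sp_t sp_ofE perm1.
  by rewrite pm_sign_act sp_VK.
case=> a b /=; rewrite inE /= => /eqP ab ->.
(* Swapping the adjacent values a and a + 1 can break the order on a block only if both are taken
   there; in that case the swap equals right multiplication of x by an element of [W_la]. *)
have [|nex] := boolP [exists i : 'I_K, [exists l in block i, [exists m in block i,
    ((x (l, false)).1 == a) && ((x (m, false)).1 == b)]]].
  case/existsP=> i /exists_inP[l lb] /exists_inP[m mb] /andP[/eqP xl /eqP xm]; right.
  have xE k : x (k, false) = ((x (k, false)).1, false) by have := xpos k;
    case: (x _) => ? ? /= ->.
  rewrite mem_lcoset; apply/W_laP => j k kb.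
  rewrite !sp_mulE sp_ofE in_set0 addbF xpos.
  have [ka|ka] := eqVneq (x (k, false)).1 a.
    have kl : k = l by have := xE k; rewrite ka -xl -xE => /sp_inj[].
    rewrite ka tpermL -xm -xE sp_VK /=.
    by rewrite (block_inj kb (_ : k \in block i)) ?kl.
  have [kb'|kb'] := eqVneq (x (k, false)).1 b.
    have km : k = m by have := xE k; rewrite kb' -xm -xE => /sp_inj[].
    rewrite kb' tpermR -xl -xE sp_VK /=.
    by rewrite (block_inj kb (_ : k \in block i)) ?km.
  by rewrite tpermD 1?eq_sym // -xE sp_VK.
left; split=> [l|i l m lb mb lm]; first by rewrite sp_mulE sp_ofE /= in_set0 addbF xpos.
rewrite !sp_mulE !sp_ofE /=; have := xinc i l m lb mb lm.
have : ~~ (((x (l, false)).1 == a) && ((x (m, false)).1 == b)).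
  apply: contra nex => H; apply/existsP; exists i; apply/exists_inP; exists l => //.
  by apply/exists_inP; exists m.
move: (x (l, false)).1 (x (m, false)).1 => c d ncd cd.
have ordE (e f : 'I_n) : e <> f -> nat_of_ord e <> f by move=> ef /val_inj.
case: tpermP => [ca|cb|/ordE ca /ordE cb]; case: tpermP => [da|db|/ordE da /ordE db];
  rewrite ?ca ?cb ?da ?db ?eqxx //= in ncd cd *; lia.
Qed.

(** The alternative of equality or strictly smaller length makes any minimal element of a coset
    increasing. *)
Lemma increasing_rep v : exists x, [/\ block_increasing x, x \in (v *: W_la n la)%g
  & x = v \/ (word_len x < word_len v)%N].
Proof.
move: {2}(word_len v) (erefl (word_len v)) => k; elim: k v => [|k IH] v vk.
  have := word_lenP v; rewrite vk expg0 inE => /eqP->.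
  by exists 1%g; split; [exact: block_increasing1 | exact: lcoset_refl | left].
have [s [u [s_gen E uk]]] := word_lenS vk.
have [x [xinc xu xlen]] := IH u uk.
have svx : (s * x)%g \in (v *: W_la n la)%g by rewrite E lcosetM mem_lcoset mulKg.
have [sxinc|sxx] := increasing_gen s_gen xinc.
  exists (s * x)%g; split=> //.
  case: xlen => [->|lt]; [by left; rewrite E | right].
  by rewrite vk -uk; apply: leq_ltn_trans (word_len_gen _ s_gen) _.
exists x; split=> //; last first.
  by right; rewrite vk -uk ltnS; case: xlen => [->|/ltnW].
by rewrite -(lcoset_eqP svx) (lcoset_eqP sxx) lcoset_refl.
Qed.

(** The quotient u has no signs and induces on each block an increasing map h. If h moved a point,
    its iterates would be strictly monotone and leave the finite range. *)
Lemma increasing_uniq x x' : block_increasing x -> block_increasing x' ->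
  x' \in (x *: W_la n la)%g -> x' = x.
Proof.
move=> [xpos xinc] [x'pos x'inc] /lcosetP[u uW x'E].
pose h l := (u (l, false)).1.
have uE l : u (l, false) = (h l, false).
  rewrite /h; have := x'pos l; rewrite x'E sp_mulE; case: (u _) => m c /=.
  by have -> : (m, c) = pm_sign c (m, false); [|rewrite pm_sign_act /= xpos addFb =>
    ->].
have hb (i : 'I_K) l : (h l \in block i) = (l \in block i) by rewrite /h W_la_act.
have hinc (i : 'I_K) l m : l \in block i -> m \in block i -> (l < m)%N -> (h l < h m)%N.
  move=> lb mb lm; have := x'inc i l m lb mb lm; rewrite x'E !sp_mulE !uE.
  case: (ltngtP (h l) (h m)) => // [ml|/val_inj->]; last by rewrite ltnn.
  by have := xinc i _ _ _ _ ml; rewrite !hb => /(_ mb lb) /ltnW; rewrite leqNgt =>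
    /negPf->.
have iterb k (i : 'I_K) l : (iter k h l \in block i) = (l \in block i).
  by elim: k => //= k IH; rewrite hb.
suff hid l : h l = l.
  by rewrite x'E; apply: sp_ext => l; rewrite sp_mulE uE hid.
have [i li] := block_ex laP l; apply/val_inj => /=.
case: (ltngtP (h l) l) => // lt.
  have dec k : (iter k h l + k <= l)%N /\ (iter k.+1 h l < iter k h l)%N.
    elim: k => [|k [IH1 IH2]]; first by rewrite /= addn0.
    split; first by apply: leq_trans IH1; rewrite addnS -addSn leq_add2r.
    by apply: (hinc i) IH2; rewrite iterb.
  by have [] := dec l.+1; lia.
have inc k : (l + k <= iter k h l)%N /\ (iter k h l < iter k.+1 h l)%N.
  elim: k => [|k [IH1 IH2]]; first by rewrite /= addn0.
  split; first by rewrite addnS; apply: leq_ltn_trans IH2.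
  by apply: (hinc i) IH2; rewrite iterb.
by have [] := inc n; have := ltn_ord (iter n h l); lia.
Qed.

Lemma X_laP x : x \in X_la n la <-> block_increasing x.
Proof.
rewrite inE; split=> [/forall_inP xmin|xinc].
  have [y [yinc yx []]] := increasing_rep x; first by move<-.
  by have := xmin y yx; rewrite !sp_lengthE leqNgt => /negPf->.
apply/forall_inP => v vx; have [y [yinc yv ylen]] := increasing_rep v.
have -> : x = y.
  by apply/esym/increasing_uniq => //; rewrite -(lcoset_eqP vx).
by rewrite !sp_lengthE; case: ylen => [->|/ltnW].
Qed.

End MinimalRepresentatives.

(** * The module generated by e_la *)

Section GroupAlgebraAverages.
Variables (gT : finGroupType) (G : {group gT}).
Hypothesis Gfull : forall g, g \in G.
Local Notation D := (regular_repr algC G).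
Local Notation CG := 'M[algC]_#|G|.

Lemma mul_scaler (a : algC) (A B : CG) : A * (a *: B) = a *: (A * B).
Proof. by rewrite -[LHS]/(A *m (a *: B)) -scalemxAr. Qed.

Lemma scale_mulr (a : algC) (A B : CG) : (a *: A) * B = a *: (A * B).
Proof. by rewrite -[LHS]/((a *: A) *m B) -scalemxAl. Qed.

Lemma regular_reprM g h : D (g * h)%g = D g * D h.
Proof. by rewrite repr_mxM. Qed.

Lemma regular_repr1 : D 1%g = 1. Proof. exact: repr_mx1. Qed.

(** Common form of [zeta] and [zeta_tilde]: for z an #[g]-th root of unity, the idempotent of the
    character g |-> z of the cyclic group of g. *)
Definition cyclic_average (z : algC) (g : gT) : CG :=
  #[g]%g%:R^-1 *: \sum_(1 <= j < #[g]%g.+1) z ^- j *: D (g ^+ j)%g.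

Lemma order_unit (g : gT) : #[g]%g%:R != 0 :> algC.
Proof. by rewrite pnatr_eq0 -lt0n order_gt0. Qed.

Lemma cyclic_average_eig z g : z ^+ #[g]%g = 1 ->
  D g * cyclic_average z g = z *: cyclic_average z g.
Proof.
move=> zm; have z0 : z != 0.
  apply: contra_eq_neq zm => ->; rewrite expr0n gtn_eqF ?order_gt0 //=.
  by rewrite eq_sym oner_eq0.
rewrite /cyclic_average mul_scaler scalerA mulrC -scalerA; congr (_ *: _).
rewrite mulr_sumr scaler_sumr.
have E (F : nat -> CG) : \sum_(1 <= j < #[g]%g.+1) F j = \sum_(j < #[g]%g) F j.+1.
  by rewrite big_add1 big_mkord.
rewrite !E; have [m Em] : exists m, #[g]%g = m.+1 by exists #[g]%g.-1; rewrite prednK.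
have T (j : nat) : D g * (z ^- j.+1 *: D (g ^+ j.+1)%g) = z *: (z ^- j.+2 *: D (g ^+
  j.+2)%g).
  by rewrite mul_scaler -regular_reprM -expgS scalerA [z ^+ j.+2]exprS invfM mulrA
    divff // mul1r.
rewrite (eq_bigr _ (fun j _ => T (nat_of_ord j))).
have gm : (g ^+ m.+1)%g = 1%g by rewrite -Em expg_order.
rewrite Em big_ord_recr big_ord_recl /= addrC; congr (_ + _).
rewrite -Em expgS expg_order mulg1 expg1 -/(z ^+ 2).
by rewrite exprS zm mulr1 expr1.
Qed.

Lemma cyclic_average_fix z g (E : CG) : z != 0 -> E * D g = z *: E ->
  E * cyclic_average z g = E.
Proof.
move=> z0 Eg; have EX j : E * D (g ^+ j)%g = z ^+ j *: E.
  elim: j => [|j IH]; first by rewrite expg0 regular_repr1 mulr1 expr0 scale1r.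
  by rewrite expgSr regular_reprM mulrA IH scale_mulr Eg scalerA -exprSr.
rewrite /cyclic_average mul_scaler mulr_sumr big_add1 big_mkord (eq_bigr (fun _ => E));
  last first.
  by move=> j _; rewrite mul_scaler EX scalerA mulVf ?expf_neq0 // scale1r.
by rewrite sumr_const card_ord -scaler_nat scalerA mulVf ?order_unit ?scale1r.
Qed.

Lemma cyclic_average_comm z g a : commute a g -> GRing.comm (D a) (cyclic_average z g).
Proof.
move=> ag; rewrite /GRing.comm /cyclic_average mul_scaler scale_mulr mulr_sumr
  mulr_suml; congr (_ *: _).
apply: eq_bigr => j _; rewrite mul_scaler scale_mulr -!regular_reprM.
by rewrite (commuteX j ag).
Qed.

Lemma zetaE g : zeta G g = cyclic_average (omega #[g]%g) g. Proof. by []. Qed.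
Lemma zeta_tildeE g : zeta_tilde G g = cyclic_average (omega #[g]%g ^+ (#[g]%g.+1)./2)
  g.
Proof. by []. Qed.

Lemma gring_row_regular g : gring_row (D g) = delta_mx 0 (gring_index G g).
Proof.
rewrite /gring_row /= /regular_mx rowK /=.
by rewrite (enum_rankK_in (group1 G)) // mul1g.
Qed.

Lemma gring_row_mulr (A B : CG) : gring_row (A * B) = gring_row A *m B.
Proof. exact: row_mul. Qed.

(** The eigenvector property makes C a stable, which rules out the default value 0; as a is nonzero
    the module has rank one and its trace is the scalar. *)
Lemma right_module_charE (H : {group gT}) (sHG : H \subset G) (a : CG) (chi : gT ->
  algC) z :
    gring_row a != 0 -> {in H, forall h, a * D h = chi h *: a} -> z \in H ->
  right_module_char sHG a z = chi z.
Proof.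
move=> a0 aH zH; rewrite /right_module_char.
set rH := subg_repr D sHG; set U := <<gring_row a>>%MS.
have eig h (V : 'M_(1, _)) : h \in H -> (V <= gring_row a)%MS -> V *m rH h = chi h *: V.
  move=> hH /submxP[B ->]; rewrite -mulmxA -gring_row_mulr aH //.
  by rewrite /gring_row linearZ /= -scalemxAr.
have modU : mxmodule rH U.
  apply/mxmoduleP => h hH; rewrite (eqmxMr _ (genmxE _)) genmxE eig //.
  exact: scalemx_sub.
case: {-}_ / idP => [modCa|/(_ modU)//].
rewrite cfunE zH mulr1n /= /submod_mx.
set V := val_submod _; have VU : (V <= gring_row a)%MS by rewrite -(genmxE (gring_row
  a)) val_submodP.
have -> : V *m rH z = chi z *: V.
  apply/row_matrixP => i; rewrite row_mul linearZ /= eig //.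
  exact: submx_trans (row_sub _ _) VU.
rewrite linearZ /= val_submodK linearZ /= mxtrace1 (_ : \rank U = 1%N) ?mulr1 //.
by rewrite mxrank_gen rank_rV a0.
Qed.

End GroupAlgebraAverages.

(** * The product of the f_i as an average over A_la *)

Section BlockElements.
Variables (n : nat) (la : seq int).
Hypothesis laP : is_signed_partition n la.
Local Notation w := (w_la n la).
Local Notation K := (size la).
Local Notation block i := (block n la i).
Local Notation block_start := (block_start laP).
Local Notation u := (factor_la n la).
Local Notation L i := (absz la`_i).
Implicit Types (a b : signed_perm n) (x : pm n).

Definition supported (i : nat) a := forall x, x.1 \notin block i -> a x = x.

Lemma supported_block i a x : supported i a ->
  ((a x).1 \in block i) = (x.1 \in block i).
Proof.
move=> sa; have [xb|xb] := boolP (x.1 \in block i); last by rewrite sa // (negPf xb).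
by apply: contraT => ab; have /sp_inj E := sa _ ab; rewrite E xb in ab.
Qed.

Lemma supported1 i : supported i 1%g. Proof. by move=> x _; rewrite sp_oneE. Qed.

Lemma supportedM i a b : supported i a -> supported i b -> supported i (a * b)%g.
Proof. by move=> sa sb x xb; rewrite sp_mulE sb // sa. Qed.

Lemma supportedX i a k : supported i a -> supported i (a ^+ k)%g.
Proof.
move=> sa; elim: k => [|k IH]; first by rewrite expg0; apply: supported1.
by rewrite expgS; apply: supportedM.
Qed.

Lemma supported_u i : supported i (u i).
Proof. by move=> x; apply: factor_la_out. Qed.

Lemma supported_w0 i : supported i (w0 (block i)).
Proof. by move=> [l c] /= lb; rewrite w0E /= (negPf lb) addbF. Qed.

Lemma supported_c i : supported i (c_la n la i).
Proof.
by move=> [l c] /= lb; rewrite /c_la /pos_cycle sp_ofE /= cycle_perm_out // in_set0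
  addbF.
Qed.

Lemma supported_comm i j a b : i != j -> supported i a -> supported j b -> commute a b.
Proof.
move=> ij sa sb; apply: sp_eqP => x; rewrite !sp_mulE.
have [xi|xi] := boolP (x.1 \in block i).
  have nb y : y.1 \in block i -> b y = y.
    by move=> yi; apply: sb; apply: contra ij => /(block_inj yi)->.
  by rewrite !nb ?supported_block.
rewrite (sa x xi); have [xj|xj] := boolP (x.1 \in block j);
  last by rewrite (sb x xj) sa.
rewrite sa //; apply: contra ij => bi; apply/eqP/(block_inj bi).
by rewrite supported_block.
Qed.

Lemma supported_comm_w (i : 'I_K) a : supported i a -> commute (u i) a -> commute w a.
Proof.
move=> sa ua; apply: sp_eqP => x; rewrite !sp_mulE.
have [xi|xi] := boolP (x.1 \in block i).
  rewrite !(w_la_block (i := i)) ?supported_block //; exact: sp_commute.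
rewrite (sa x xi) sa //; have [j xj] := block_ex laP x.1.
rewrite (w_la_block xj); apply: contra xi => ui.
have ij : val i = j by apply: (block_inj ui); rewrite supported_block //;
  apply: supported_u.
by rewrite ij.
Qed.

Lemma w0_act i x : w0 (block i) x = pm_sign (x.1 \in block i) x.
Proof. exact: w0E. Qed.

Lemma w0_comm i a : supported i a -> commute (w0 (block i)) a.
Proof.
move=> sa; apply: sp_eqP => x.
by rewrite !sp_mulE !w0_act supported_block // pm_sign_act.
Qed.

Lemma w0K i : (w0 (block i) * w0 (block i))%g = 1%g.
Proof.
by apply: sp_eqP => x; rewrite sp_mulE !w0_act pm_signM sp_oneE /= addbb pm_signF.
Qed.

Lemma comm_w_u (i : 'I_K) : commute w (u i).
Proof. by apply: supported_comm_w => //; apply: supported_u. Qed.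

Lemma comm_w_w0 (i : 'I_K) : commute w (w0 (block i)).
Proof. by apply: supported_comm_w; [exact:
  supported_w0|apply/commute_sym/w0_comm/supported_u]. Qed.

(** Up to sign, the w-orbits of the block starts cover all points, so an element commuting with w is
    determined there. *)
Lemma comm_ext a b : commute w a -> commute w b ->
  (forall i, a (block_start i) = b (block_start i)) -> a = b.
Proof.
move=> wa wb ab; apply: sp_eqP => x; have [i xi] := block_ex laP x.1.
have [j _ [c ->]] := block_orbit laP xi.
have C e : commute w e -> commute e (w ^+ j)%g by move=> /commute_sym; apply: commuteX.
by rewrite !pm_sign_act (sp_commute _ (C a wa)) (sp_commute _ (C b wb)) ab.
Qed.

Lemma factor_laX (i : 'I_K) k x : x.1 \in block i -> (u i ^+ k)%g x = (w ^+ k)%g x.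
Proof.
move=> xi; elim: k => [|k IH]; first by rewrite !sp_oneE.
rewrite !expgS !sp_mulE -IH (w_la_block (i := i)) // supported_block //.
exact/supportedX/supported_u.
Qed.

Lemma Phi_supp (i : 'I_K) a theta : phase w setT theta -> commute w a ->
  supported i a ->
  Phi w a = theta (a (block_start i)) / theta (block_start i).
Proof.
move=> ph wa sa; rewrite (PhiE wa ph (cycle_transversal_w_la laP)).
rewrite big_imset /=; last by move=> j k _ _; apply: block_start_inj.
rewrite (bigD1 i) //= big1 ?mulr1 // => j ji; rewrite sa ?divff //.
  by have [] := ph (block_start j) (in_setT _).
apply: contra ji => bi; apply/eqP/val_inj/(block_inj (block_start_mem laP j) bi).
Qed.

Lemma Phi_u (i : 'I_K) : Phi w (u i) = omega (orbit_size w (block_start i)).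
Proof.
rewrite (Phi_supp (std_phaseP w) (comm_w_u i) (@supported_u i)).
have [t0 E _] := std_phaseP w (in_setT (block_start i)).
by rewrite -w_la_block ?block_start_mem // E mulfK.
Qed.

Lemma Phi_w0 (i : 'I_K) : Phi w (w0 (block i)) = if la`_i < 0 then -1 else 1.
Proof.
rewrite (Phi_supp (std_phaseP w) (comm_w_w0 i) (@supported_w0 i)).
rewrite w0_act block_start_mem pm_signT (phase_opp (@signed_cycle_closedT _ w)
  (std_phaseP w)) ?in_setT // is_negative_w_la.
by rewrite mulfK //; have [] := std_phaseP w (in_setT (block_start i)).
Qed.

Lemma eq1_block_start (i : 'I_K) a : commute w a -> supported i a ->
  (a == 1%g) = (a (block_start i) == block_start i).
Proof.
move=> wa sa; apply/eqP/eqP => [->|E]; first by rewrite sp_oneE.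
apply: comm_ext => // [|j]; first exact: commute1.
rewrite sp_oneE; have [->//|ji] := eqVneq j i; apply: sa.
by apply: contra ji => bi; apply/eqP/val_inj/(block_inj (block_start_mem laP j) bi).
Qed.

Lemma order_u (i : 'I_K) : #[u i]%g = orbit_size w (block_start i).
Proof.
apply/eqP; rewrite eqn_dvd order_dvdn (eq1_block_start (i := i)); first last.
- exact/supportedX/supported_u.
- exact/commuteX/comm_w_u.
rewrite factor_laX ?block_start_mem // orbit_sizeP dvdnn /= -orbit_sizeP -(factor_laX _
  (block_start_mem laP i)).
by rewrite expg_order sp_oneE.
Qed.

Lemma u_pos (i : 'I_K) : 0 < la`_i -> u i = c_la n la i.
Proof. by rewrite /factor_la => ->. Qed.

Lemma u_neg_odd (i : 'I_K) : la`_i < 0 -> odd (L i) ->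
  u i = (c_la n la i * w0 (block i))%g.
Proof. by move=> la0 od; rewrite /factor_la ltNge (ltW la0) /= /d_la od. Qed.

Lemma c_neg_odd (i : 'I_K) : la`_i < 0 -> odd (L i) ->
  c_la n la i = (u i * w0 (block i))%g.
Proof. by move=> la0 od; rewrite u_neg_odd // -mulgA w0K mulg1. Qed.

(** A power k of c = d w0 can fix the block start only if k = q L; then d^k contributes the sign
    (-1)^q and w0^k the sign (-1)^k, which agree since L is odd. *)
Lemma order_c_neg_odd (i : 'I_K) : la`_i < 0 -> odd (L i) -> #[c_la n la i]%g = L i.
Proof.
move=> la0 od; have c_comm : commute w (c_la n la i).
  by rewrite c_neg_odd //; apply: commuteM; [apply: comm_w_u | apply: comm_w_w0].
have E k : (#[c_la n la i]%g %| k)%N = (L i %| k)%N.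
  rewrite order_dvdn (eq1_block_start (i := i)); first last.
  - exact/supportedX/supported_c.
  - exact: commuteX.
  rewrite c_neg_odd // expgMn; last exact/commute_sym/w0_comm/supported_u.
  have w0X : (w0 (block i) ^+ k)%g (block_start i) = pm_sign (odd k) (block_start i).
    elim: k => [|k IH]; first by rewrite sp_oneE pm_signF.
    by rewrite expgS sp_mulE IH w0_act block_start_mem pm_signM.
  rewrite sp_mulE w0X pm_sign_act factor_laX ?block_start_mem // -(inj_eq (@pm_sign_inj
    _ (odd k))) pm_signM addbb pm_signF.
  rewrite w_la_pow_eq la0 andbT; apply: andb_idr => /dvdnP[q ->].
  by rewrite mulnK ?(L_gt0 laP) // oddM od andbT.
by apply/eqP; rewrite eqn_dvd E dvdnn /= -E dvdnn.
Qed.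

Lemma commute_c (i : 'I_K) : 0 < la`_i \/ odd (L i) -> commute w (c_la n la i).
Proof.
case: (ltrP 0 la`_i) => [la0 _|la0 [//|od]]; first by rewrite -u_pos //;
  apply: comm_w_u.
have {}la0 : la`_i < 0 by rewrite lt_neqAle la0 (la_neq0 laP).
by rewrite c_neg_odd //; apply: commuteM; [apply: comm_w_u | apply: comm_w_w0].
Qed.

(** This is where the exponent (m+1)/2 in [zeta_tilde] comes from: c acts by -omega_(2m) and w0 by
    -1, so their product d acts by omega_(2m), whose order is that of d. *)
Lemma omega_odd m : odd m -> omega m ^+ (m.+1)./2 = - omega m.*2.
Proof.
move=> od; have m0 : (0 < m)%N by case: m od.
have -> : omega m = omega (m.*2) ^+ 2 by rewrite -muln2 mulnC omegaM.
rewrite -exprM mul2n even_halfK /= ?od // exprS omega_half //.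
by rewrite mulrN1.
Qed.

Lemma Phi_c_neg_odd (i : 'I_K) : la`_i < 0 -> odd (L i) ->
  Phi w (c_la n la i) = omega (L i) ^+ ((L i).+1)./2.
Proof.
move=> la0 od; rewrite c_neg_odd // PhiM; [|exact: comm_w_u|exact: comm_w_w0].
by rewrite Phi_u Phi_w0 la0 orbit_size_w_la la0 omega_odd // mulrN1.
Qed.

Local Notation D := (regular_repr algC (W n)).
Local Notation CW := 'M[algC]_#|W n|.
Local Notation f := (f_la n la).
Let Gf : forall g, g \in W n := fun g => in_setT g.

Lemma eps_plus_eig i : D (w0 (block i)) * eps_plus (block i) = eps_plus (block i).
Proof.
by rewrite /eps_plus mul_scaler mulrDr -!(regular_reprM Gf) mulg1 w0K addrC.
Qed.

Lemma eps_minus_eig i : D (w0 (block i)) * eps_minus (block i) = - eps_minus (block i).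
Proof.
by rewrite /eps_minus mul_scaler mulrBr -!(regular_reprM Gf) mulg1 w0K -scalerN opprB.
Qed.

Lemma scale_half_double (E : CW) : 2^-1 *: (E + E) = E.
Proof. by rewrite -mulr2n -scaler_nat scalerA mulVf ?scale1r // pnatr_eq0. Qed.

Lemma eps_plus_fix i (E : CW) : E * D (w0 (block i)) = E -> E * eps_plus (block i) = E.
Proof.
by move=> Ew; rewrite /eps_plus mul_scaler mulrDr (regular_repr1 (W n)) mulr1 Ew
  scale_half_double.
Qed.

Lemma eps_minus_fix i (E : CW) : E * D (w0 (block i)) = - E ->
  E * eps_minus (block i) = E.
Proof.
by move=> Ew; rewrite /eps_minus mul_scaler mulrBr (regular_repr1 (W n)) mulr1 Ew opprK
  scale_half_double.
Qed.

Lemma eps_plus_comm i a : commute a (w0 (block i)) ->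
  GRing.comm (D a) (eps_plus (block i)).
Proof.
move=> aw; rewrite /GRing.comm /eps_plus mul_scaler scale_mulr mulrDr mulrDl.
by rewrite -!(regular_reprM Gf) mulg1 mul1g aw.
Qed.

Lemma eps_minus_comm i a : commute a (w0 (block i)) ->
  GRing.comm (D a) (eps_minus (block i)).
Proof.
move=> aw; rewrite /GRing.comm /eps_minus mul_scaler scale_mulr mulrBr mulrBl.
by rewrite -!(regular_reprM Gf) mulg1 mul1g aw.
Qed.

Lemma f_eig_u (i : 'I_K) : D (u i) * f i = Phi w (u i) *: f i.
Proof.
have om := omega_exp (order_gt0 (u i)).
rewrite Phi_u -order_u /f_la; case: ltrP => la0.
  rewrite mulrA eps_plus_comm; last exact/commute_sym/w0_comm/supported_u.
  by rewrite -mulrA -u_pos // zetaE (cyclic_average_eig Gf) // mul_scaler.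
have {}la0 : la`_i < 0 by rewrite lt_neqAle la0 (la_neq0 laP).
case: ifP => od; last first.
  have -> : d_la n la i = u i by rewrite /factor_la ltNge (ltW la0).
  by rewrite zetaE (cyclic_average_eig Gf).
(* With d = c w0, the sign from [eps_minus] cancels the one from [omega_odd]. *)
rewrite mulrA {1}u_neg_odd // (regular_reprM Gf) -(mulrA (D (c_la n la i)))
  eps_minus_eig mulrN mulNr.
rewrite eps_minus_comm; last exact/commute_sym/w0_comm/supported_c.
rewrite -mulrA zeta_tildeE (cyclic_average_eig Gf); last first.
  by rewrite exprAC omega_exp ?order_gt0 // expr1n.
by rewrite mul_scaler order_c_neg_odd // omega_odd // order_u orbit_size_w_la la0
  scaleNr opprK.
Qed.

Lemma f_eig_w0 (i : 'I_K) : 0 < la`_i -> D (w0 (block i)) * f i = f i.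
Proof. by move=> la0; rewrite /f_la la0 mulrA eps_plus_eig. Qed.

(** Every factor of f_i averages over a cyclic group whose generator is supported on block i and
    commutes with w, weighted by the value of Phi there. An E that transforms by Phi absorbs it. *)
Lemma f_fix (i : 'I_K) (E : CW) :
    (forall a, commute w a -> supported i a -> E * D a = Phi w a *: E) ->
  E * f i = E.
Proof.
move=> HE; have Ew := HE _ (comm_w_w0 i) (@supported_w0 i); rewrite Phi_w0 in Ew.
have Eu := HE _ (comm_w_u i) (@supported_u i); rewrite Phi_u in Eu.
rewrite /f_la; case: ltrP => la0.
  rewrite ltNge (ltW la0) scale1r in Ew.
  rewrite mulrA eps_plus_fix // -u_pos // zetaE (cyclic_average_fix Gf) ?omega_neq0
    ?order_gt0 //.
  by rewrite order_u.
have {}la0 : la`_i < 0 by rewrite lt_neqAle la0 (la_neq0 laP).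
case: ifP => od; last first.
  have -> : d_la n la i = u i by rewrite /factor_la ltNge (ltW la0).
  by rewrite zetaE (cyclic_average_fix Gf) ?omega_neq0 ?order_gt0 // order_u.
rewrite la0 scaleN1r in Ew; rewrite mulrA eps_minus_fix // zeta_tildeE
  (cyclic_average_fix Gf) //.
  by apply/expf_neq0/omega_neq0/order_gt0.
rewrite order_c_neg_odd // -Phi_c_neg_odd //; apply: HE; last exact: supported_c.
by apply: commute_c; right.
Qed.

Lemma f_comm (i j : 'I_K) a : i != j -> supported i a -> GRing.comm (D a) (f j).
Proof.
move=> ij sa; have C b : supported j b -> commute a b by apply: (supported_comm (i :=
  i)).
have CM (A B : CW) : GRing.comm (D a) A -> GRing.comm (D a) B ->
  GRing.comm (D a) (A * B).
  by move=> cA cB; rewrite /GRing.comm mulrA cA -mulrA cB mulrA.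
rewrite /f_la; case: ifP => j0; [|case: ifP => od].
- apply: CM; first exact/eps_plus_comm/C/supported_w0.
  exact/(cyclic_average_comm Gf)/C/supported_c.
- apply: CM; first exact/eps_minus_comm/C/supported_w0.
  exact/(cyclic_average_comm Gf)/C/supported_c.
apply: (cyclic_average_comm Gf); apply: C; have ->
  : d_la n la j = u j by rewrite /factor_la j0.
exact: supported_u.
Qed.

Definition F_la : CW := \prod_(i < K) f i.

Lemma prod_eig (r : seq 'I_K) (i : 'I_K) a (z : algC) : uniq r -> i \in r ->
  supported i a ->
  D a * f i = z *: f i -> D a * (\prod_(j <- r) f j) = z *: \prod_(j <- r) f j.
Proof.
move=> + + sa ai; elim: r => // j r IH /= /andP[jr ur]; rewrite inE.
have [<- _|ij /= ir] := eqVneq i j; first by rewrite big_cons mulrA ai scale_mulr.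
by rewrite big_cons mulrA (f_comm ij sa) -mulrA IH // mul_scaler.
Qed.

Lemma F_eig_supp (i : 'I_K) a (z : algC) : supported i a -> D a * f i = z *: f i ->
  D a * F_la = z *: F_la.
Proof. by apply: prod_eig; [exact: index_enum_uniq | exact: mem_index_enum]. Qed.

Definition acts_by_Phi a := commute w a /\ D a * F_la = Phi w a *: F_la.

Lemma acts_by_Phi1 : acts_by_Phi 1%g.
Proof. by split; [exact: commute1 | rewrite Phi1 (regular_repr1 (W n)) mul1r scale1r].
  Qed.

Lemma acts_by_PhiM a b : acts_by_Phi a -> acts_by_Phi b -> acts_by_Phi (a * b)%g.
Proof.
move=> [wa Ea] [wb Eb]; split; first exact: commuteM.
by rewrite (regular_reprM Gf) -mulrA Eb mul_scaler Ea scalerA PhiM // mulrC.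
Qed.

Lemma acts_by_PhiX a k : acts_by_Phi a -> acts_by_Phi (a ^+ k)%g.
Proof.
move=> ga; elim: k => [|k IH]; first by rewrite expg0; apply: acts_by_Phi1.
by rewrite expgS; apply: acts_by_PhiM.
Qed.

Lemma acts_by_Phi_u (i : 'I_K) : acts_by_Phi (u i).
Proof.
split; first exact: comm_w_u.
by apply: (F_eig_supp (@supported_u i)); apply: f_eig_u.
Qed.

Lemma acts_by_Phi_w0 (i : 'I_K) : 0 < la`_i -> acts_by_Phi (w0 (block i)).
Proof.
move=> la0; split; first exact: comm_w_w0.
rewrite Phi_w0 ltNge (ltW la0).
by apply: (F_eig_supp (@supported_w0 i)); rewrite scale1r f_eig_w0.
Qed.

Definition A_la : {group signed_perm n} := ('C[w] :&: W_la_group laP)%G.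

(** On block i, a sends the start to some (-1)^c w^j of it, and this is matched by a product of
    powers of [factor_la] and, for positive entries, of the sign change. The product of these local
    elements agrees with a at all block starts, hence equals a. *)
Lemma A_laP a : a \in A_la -> acts_by_Phi a.
Proof.
rewrite inE => /andP[/cent1P/commute_sym wa aW].
have ex (i : 'I_K) : exists b, [/\ supported i b,
  acts_by_Phi b & b (block_start i) = a (block_start i)].
  have : (a (block_start i)).1 \in block i by rewrite (W_la_act laP) ?block_start_mem.
  case/(block_orbit laP) => j _ [c ->]; have ub k :=
    factor_laX k (block_start_mem laP i).
  case: (ltrP 0 la`_i) => la0.
    exists (u i ^+ j * w0 (block i) ^+ c)%g; split.
    - by apply: supportedM; apply: supportedX;
      [apply: supported_u | apply: supported_w0].
    - by apply: acts_by_PhiM; apply: acts_by_PhiX;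
      [apply: acts_by_Phi_u | apply: acts_by_Phi_w0].
    rewrite sp_mulE; have -> : (w0 (block i) ^+ c)%g (block_start i) = pm_sign c
      (block_start i).
      by case: c; rewrite ?expg1 ?w0_act ?block_start_mem // sp_oneE pm_signF.
    by rewrite pm_sign_act ub.
  have {}la0 : la`_i < 0 by rewrite lt_neqAle la0 (la_neq0 laP).
  (* On a negative cycle a full turn of L steps supplies the sign. *)
  exists (u i ^+ (j + c * L i))%g; split; [exact/supportedX/supported_u |
    exact/acts_by_PhiX/acts_by_Phi_u |].
  rewrite ub sp_XD; case: c; rewrite ?mul1n ?mul0n ?sp_oneE ?pm_signF //.
  by rewrite w_laXL la0 pm_sign_act.
have [h hP] : exists h : 'I_K -> signed_perm n,
    forall i : 'I_K, [/\ supported i (h i), acts_by_Phi (h i) & h i (block_start i) = a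
      (block_start i)].
  have ex' (i : 'I_K) : exists b, [forall x, (x.1 \notin block i) ==> (b x == x)] &&
     (b \in 'C[w]%g) && (D b * F_la == Phi w b *: F_la) && (b (block_start i) == a
       (block_start i)).
    have [b [sb [wb gb] bb]] := ex i; exists b; rewrite bb gb !eqxx !andbT.
    apply/andP; split; last exact/cent1P/commute_sym.
    by apply/forall_inP => x /sb->.
  exists (fun i : 'I_K => xchoose (ex' i)) => i.
  have /andP[/andP[/andP[/forall_inP H1 /cent1P H2] /eqP H3] /eqP H4] :=
    xchooseP (ex' i).
  split; [by move=> x /H1/eqP | split; [exact: commute_sym | exact: H3] | exact: H4].
have gp : acts_by_Phi (\prod_(i < K) h i)%g.
  by apply: big_ind; [exact: acts_by_Phi1 | exact: acts_by_PhiM | move=> i _;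
    have [] := hP i].
suff -> : a = (\prod_(i < K) h i)%g by [].
apply: comm_ext => // [|i]; first by case: gp.
rewrite (prod_blocks (u := h) (i := i)) ?block_start_mem //; last first.
  by move=> j y; have [sj _ _] := hP j; apply: sj.
by have [_ _ ->] := hP i.
Qed.

Definition E_la : CW := \sum_(a in A_la) (Phi w a)^-1 *: D a.

Lemma A_la_comm a : a \in A_la -> commute w a.
Proof. by case/A_laP. Qed.

Lemma E_eig a : a \in A_la -> E_la * D a = Phi w a *: E_la.
Proof.
move=> aA; rewrite /E_la mulr_suml scaler_sumr [RHS](reindex_inj (mulIg a)) /=.
apply: eq_big => [b|b bA]; first by rewrite groupMr.
rewrite scale_mulr -(regular_reprM Gf) scalerA (PhiM (A_la_comm bA) (A_la_comm aA)).
by rewrite invfM mulrCA divff ?mulr1 // Phi_neq0.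
Qed.

Lemma supported_A (i : 'I_K) a : supported i a -> commute w a -> a \in A_la.
Proof.
move=> sa wa; rewrite inE; apply/andP; split; first exact/cent1P/commute_sym.
apply/W_laP => j l lj; have [ij|ij] := eqVneq (i : nat) j;
  first by rewrite -ij supported_block //= ij.
by rewrite sa //; apply: contra ij => /= li; apply/eqP; apply: block_inj li lj.
Qed.

(** The product E F is computed twice: E absorbs each f_i from the right, and each element of [A_la]
    acts on F from the left by Phi. *)
Lemma F_laE : #|A_la|%:R *: F_la = E_la.
Proof.
have EF : E_la * F_la = E_la.
  rewrite /F_la; apply: (big_ind (fun X : CW => E_la * X = E_la)) => [|X Y EX EY|i _].
  - by rewrite mulr1.
  - by rewrite mulrA EX EY.
  by apply: f_fix => a wa sa; apply: E_eig; apply: supported_A sa wa.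
rewrite -[RHS]EF /E_la mulr_suml (eq_bigr (fun _ => F_la)).
  by rewrite sumr_const scaler_nat.
move=> a aA; have [_ Ea] := A_laP aA.
by rewrite scale_mulr Ea scalerA mulVf ?scale1r // Phi_neq0.
Qed.

(** A description by the signed cycles of w instead of blocks, stable under conjugation by the
    centralizer of w. *)
Lemma mem_A a : (a \in A_la) = (a \in 'C[w]%g) && [forall x, a x \in signed_cycle w x].
Proof.
rewrite inE; apply: andb_id2l => _; apply/idP/forallP => [aW x|ac].
  have [i xi] := block_ex laP x.1; have := xi; rewrite -signed_cycle_w_la => xc.
  apply: (@signed_cycle_trans _ _ _ (block_start i)); first exact: signed_cycle_sym.
  by rewrite signed_cycle_w_la (W_la_act laP).
apply/W_laP => i l li; rewrite -(signed_cycle_w_la laP).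
by apply: signed_cycle_trans (ac (l, false)); rewrite signed_cycle_w_la.
Qed.

Lemma E_comm z : commute w z -> GRing.comm (D z) E_la.
Proof.
move=> wz; rewrite /GRing.comm /E_la mulr_sumr mulr_suml (reindex_inj (conjg_inj z)) /=.
have wzE : (w ^ z)%g = w by rewrite /conjg wz mulKg.
have wzx k : commute (w ^+ k)%g z by apply/commute_sym/commuteX/commute_sym.
have CJ a : ((a ^ z)%g \in 'C[w]%g) = (a \in 'C[w]%g).
  apply/cent1P/cent1P => [E|/commute_sym E].
    apply: (@conjg_inj _ z); rewrite !conjMg wzE; exact: E.
  by apply: commute_sym; rewrite /commute -{1 2}wzE -!conjMg E.
apply: eq_big => [a|a aA].
  rewrite !mem_A CJ; congr (_ && _); apply/forallP/forallP => ac x.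
    have := ac ((z^-1)%g x); rewrite conj_act1 sp_KV -{1}wzE signed_cycle_conj !sp_KV.
    by [].
  by rewrite conj_act1 -{1}wzE signed_cycle_conj sp_KV.
have wa : commute w a.
  move: aA; rewrite mem_A CJ => /andP[/cent1P/commute_sym].
  by [].
rewrite mul_scaler scale_mulr -!(regular_reprM Gf) -conjgC; congr (_ *: _).
by rewrite -{1}wzE Phi_conj.
Qed.

End BlockElements.

(** * The action of the centralizer on e_la *)

Section ModuleCharacter.
Variables (n : nat) (la : seq int).
Hypothesis laP : is_signed_partition n la.
Local Notation w := (w_la n la).
Local Notation K := (size la).
Local Notation block i := (block n la i).
Local Notation block_start := (block_start laP).
Local Notation A := (A_la laP).
Local Notation L i := (absz la`_i).
Implicit Types (x y z : signed_perm n).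

Lemma commute_conj_fix x z : commute x z -> (x ^ z)%g = x.
Proof. by move=> xz; rewrite /conjg xz mulKg. Qed.

Lemma signed_cycle_comm v z (p q : pm n) : commute v z ->
  (z q \in signed_cycle v (z p)) = (q \in signed_cycle v p).
Proof. by move=> vz; rewrite -signed_cycle_conj commute_conj_fix. Qed.

(* z permutes the blocks; y permutes them in the same way, each by a
   translation. *)
Lemma block_translation z : commute w z -> exists y, [/\ commute w y, Phi w y = 1,
  forall i : 'I_K, exists2 j : 'I_K, la`_j = la`_i & y (block_start i) = block_start j
  & (y^-1 * z)%g \in A].
Proof.
move=> wz; have tw := cycle_transversal_w_la laP; have [_ cov inj] := tw.
set T := [set block_start i | i : 'I_K] in tw cov inj.
pose beta p := odflt p [pick t in T | z p \in signed_cycle w t].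
have bP p : beta p \in T /\ z p \in signed_cycle w (beta p).
  rewrite /beta; case: pickP => [t /andP[]//|] /= no.
  by have [t tT pt] := cov (z p) (in_setT _); have := no t; rewrite tT pt.
have [||y wy yb] := @conj_of_bij n w w T beta tw.
- move=> t tT; have [_ zt] := bP t.
  by rewrite -(orbit_size_signed_cycle zt) -(is_negative_signed_cycle zt)
    (orbit_size_comm _ wz) (is_negative_comm _ wz).
- move=> s t sT tT st; apply: inj => //; rewrite -(signed_cycle_comm _ _ wz).
  have [_ zt] := bP t; have [_ zs] := bP s.
  by apply: signed_cycle_trans (signed_cycle_sym zs) (signed_cycle_trans st zt).
have {}wy : commute w y by rewrite /commute conjgC -wy.
exists y; split=> //.
(* For the phase equal to 1 at all block starts every quotient in Phi w y is 1, since y permutes the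
   block starts. *)
- have [th ph th1] := phase_exists tw; rewrite (PhiE wy ph tw) big1 // => t tT.
  by have [bT _] := bP t; rewrite yb // !th1 // divr1.
- move=> i; have iT : block_start i \in T by apply: imset_f.
  have [/imsetP[j _ bj] _] := bP (block_start i); exists j; last by rewrite yb.
  by rewrite -!(signed_size_w_la laP) -bj -yb // /signed_size (orbit_size_comm _ wy)
    (is_negative_comm _ wy).
have wa : commute w (y^-1 * z)%g by apply: commuteM => //; apply: commuteV.
rewrite mem_A; apply/andP; split; first exact/cent1P/commute_sym.
apply/forallP => p; have [t tT pt] := cov p (in_setT _).
have at_ : (y^-1 * z)%g t \in signed_cycle w t.
  rewrite -(signed_cycle_comm _ _ wy) -sp_mulE mulKVg yb //.
  by have [] := bP t.
apply: (@signed_cycle_trans _ _ _ t); first exact: signed_cycle_sym.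
by apply: signed_cycle_trans at_ _; rewrite signed_cycle_comm.
Qed.

(** Commuting with w, y carries w^k of one block start to w^k of another. The sign collected after k
    steps depends only on k and the entry, which the two blocks share, so y maps positive letters to
    positive letters in the same order. *)
Lemma translation_increasing y x : commute w y ->
    (forall i : 'I_K, exists2 j : 'I_K, la`_j = la`_i & y (block_start i) = block_start
      j) ->
  block_increasing la x -> block_increasing la (x * y)%g.
Proof.
move=> wy yb [xpos xinc].
have yE (i : 'I_K) : exists j : 'I_K, forall l : 'I_n, l \in block i ->
    [/\ (y (l, false)).2 = false, (y (l, false)).1 = (la_hat la j + (l - la_hat la
      i))%N :> nat
      & (y (l, false)).1 \in block j].
  have [j laE yi] := yb i; exists j => l li; have := li; rewrite blockE la_hatS // =>
    /andP[l1 l2].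
  have lL : (l - la_hat la i < L i)%N by lia.
  have lLj : (l - la_hat la i < L j)%N by rewrite laE.
  have [E1 E2] := @w_laX n la laP i _ lL; have [F1 F2] := @w_laX n la laP j _ lLj.
  set k := (l - la_hat la i)%N in lL lLj E1 E2 F1 F2 *.
  set s := [&& odd k, la`_i < 0 & odd (L i)] in E2.
  have lE : (l, false) = pm_sign s ((w ^+ k)%g (block_start i)).
    apply/eqP; rewrite -pair_eqE /pair_eq /= E2 addbb eqxx andbT.
    by apply/eqP/ord_inj; rewrite E1 subnKC.
  have -> : y (l, false) = pm_sign s ((w ^+ k)%g (block_start j)).
    rewrite lE pm_sign_act -yi; congr pm_sign; apply: sp_commute.
    exact/commuteX/commute_sym.
  rewrite /= F2 laE -/s addbb blockE F1 (la_hatS (ltn_ord j)).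
  by rewrite leq_addr ltn_add2l laE.
split=> [l|i l m li mi lm].
  have [i li] := block_ex laP l; have [j yl] := yE i; have [y2 _ _] := yl l li.
  rewrite sp_mulE; have -> : y (l, false) = ((y (l, false)).1, false); last exact: xpos.
  by move: y2; case: (y _) => ? ? /= ->.
have [j yl] := yE i; have [l2 l1 lj] := yl l li; have [m2 m1 mj] := yl m mi.
rewrite !sp_mulE.
have -> : y (l, false) = ((y (l, false)).1, false) by move: l2; case: (y _) =>
  ? ? /= ->.
have -> : y (m, false) = ((y (m, false)).1, false) by move: m2; case: (y _) =>
  ? ? /= ->.
apply: (xinc j) => //; rewrite l1 m1 ltn_add2l ltn_sub2r //.
by move: li; rewrite blockE => /andP[l1' _]; apply: leq_ltn_trans lm.
Qed.

Local Notation D := (regular_repr algC (W n)).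
Local Notation CW := 'M[algC]_#|W n|.
Let Gf : forall g, g \in W n := fun g => in_setT g.

Lemma x_la_translation y :
    (forall x, block_increasing la x -> block_increasing la (x * y)%g) ->
  x_la n la * D y = x_la n la.
Proof.
move=> yinc; rewrite /x_la mulr_suml.
have XyX : [set (x * y)%g | x in X_la n la] = X_la n la.
  apply/eqP; rewrite eqEcard card_imset ?leqnn ?andbT; last exact: mulIg.
  by apply/subsetP => _ /imsetP[x /(X_laP laP) xinc ->]; apply/(X_laP laP)/yinc.
rewrite -[in RHS]XyX big_imset /=; last by move=> ? ? _ _; apply: mulIg.
by apply: eq_bigr => x _; rewrite -(regular_reprM Gf).
Qed.

(** Write z = y a and move D z to the left of F, with which it commutes: x_la absorbs D y, and D a
    acts on F by Phi w a = Phi w z. *)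
Lemma e_la_eig z : commute w z -> e_la n la * D z = Phi w z *: e_la n la.
Proof.
move=> wz; have [y [wy Phi_y yb aA]] := block_translation wz.
have Dy : x_la n la * D y = x_la n la.
  by apply: x_la_translation => x; apply: translation_increasing wy yb.
set a := (y^-1 * z)%g in aA; have zE : z = (y * a)%g by rewrite mulKVg.
have [wa Ea] := A_laP aA.
rewrite /e_la -/(F_la n la) -mulrA.
have -> : F_la n la * D z = D z * F_la n la.
  have nz : #|A|%:R != 0 :> algC by rewrite pnatr_eq0 -lt0n cardG_gt0.
  apply: (scalerI nz); rewrite -scale_mulr -mul_scaler (F_laE laP).
  exact/esym/(E_comm laP).
rewrite zE PhiM // Phi_y mul1r (regular_reprM Gf) -(mulrA (D y)) Ea !mul_scaler.
by rewrite mulrA Dy.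
Qed.

Lemma gring_row_regular1 g : gring_row (D g) 0 (gring_index (W n) 1%g) = (g == 1%g)%:R.
Proof.
rewrite (gring_row_regular Gf) mxE eqxx /=; congr (_%:R); congr nat_of_bool.
apply/eqP/eqP => [E|->//]; symmetry.
by rewrite -(gring_indexK (G := W n) 1%g (Gf _)) E gring_indexK ?in_setT.
Qed.

(** The coefficient of 1 in #|A| e_la = x_la E_la is 1: if x a = 1 with x increasing and a in
    [A_la], then x lies in [W_la], so x = 1 by uniqueness of representatives. *)
Lemma e_la_neq0 : gring_row (e_la n la) != 0.
Proof.
suff E : (gring_row (#|A|%:R *: e_la n la)) 0 (gring_index (W n) 1%g) = 1.
  apply/eqP => e0; move: E; rewrite linearZ /= e0 scaler0 mxE => /eqP.
  by rewrite eq_sym oner_eq0.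
rewrite /e_la -/(F_la n la) -mul_scaler (F_laE laP) /x_la /E_la mulr_suml.
rewrite linear_sum summxE (bigD1 1%g) /=; last exact/(X_laP laP)/block_increasing1.
rewrite [X in _ + X]big1 ?addr0 => [|x /andP[xX x1]]; last first.
  rewrite mulr_sumr linear_sum summxE big1 // => a aA.
  rewrite mul_scaler -(regular_reprM Gf) linearZ /= mxE gring_row_regular1;
    case: eqP => [xa|]; last by rewrite mulr0.
  case/eqP: x1; apply: (increasing_uniq laP); first exact: block_increasing1.
    exact/(X_laP laP).
  have -> : x = (a^-1)%g by rewrite -[LHS]mulg1 -(mulgV a) mulgA xa mul1g.
  rewrite mem_lcoset invg1 mul1g -/(W_la_group laP : {set _}).
  by move: aA; rewrite inE => /andP[_ aW]; rewrite groupV.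
rewrite mulr_sumr linear_sum summxE (bigD1 1%g) ?group1 //= big1 ?addr0.
  by rewrite Phi1 invr1 scale1r -(regular_reprM Gf) mulg1 gring_row_regular1 eqxx.
move=> a /andP[_ a1].
by rewrite mul_scaler -(regular_reprM Gf) linearZ /= mxE gring_row_regular1 mul1g
  (negPf a1) mulr0.
Qed.

Lemma phi_laE z : commute w z -> phi_la n la z = Phi w z.
Proof.
move=> wz; apply: (@right_module_charE _ (W n) _ _ _ (Phi w) z).
- exact: e_la_neq0.
- by move=> h /setIP[_ /cent1P/commute_sym]; apply: e_la_eig.
by rewrite inE in_setT; apply/cent1P/commute_sym.
Qed.

End ModuleCharacter.

Theorem corollary2p11 (n : nat) (hn : (0 < n)%N) :
  cfReg (W n) =
    (\sum_(la : signed_partition n) 'Ind[W n] (phi_la n la))%R.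
Proof.
apply/cfunP => g; rewrite sum_cfunE cfRegE.
rewrite (sum_Ind (phi := fun la : signed_partition n => phi_la n la)); last first.
  by move=> la z; apply: (phi_laE (spartP la)).
have [->|g1] := eqVneq g 1%g; last by rewrite Phi_sum_neq1.
(* At the identity each w contributes 1 and all of W_n commutes with it, which gives the group
   order. *)
rewrite (eq_bigr (fun=> 1)) => [|w _]; last exact: Phi1.
rewrite mulr1n sumr_const; congr (_%:R); apply: eq_card => w.
by rewrite inE; apply/esym/cent1P/commute1.
Qed.
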